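(* Let $n\ge1$, let $(B_t)$ be a standard Brownian motion on $\mathbb{R}^n$, and let $(z_t)_{0\le t<1}$ be the solution of $dz_t=dB_t-\frac{z_t}{1-t}\,dt$, $z_0=0$ (the Brownian bridge). Let $f:[0,1)\to\mathbb{R}$ be either $f(t)=\frac{1}{(1-t)^\alpha}$ with $\alpha>1$, or $f(t)=\frac{c}{1-t}$ with $c>0$, $c\neq1$. Let $(M_t,t<1)$ be the exponential martingale in the Girsanov transform from the Brownian bridge to the solution of $dy_t=dB_t-f(t)y_t\,dt$, $y_0=0$, that is, $$M_t=\exp\left(N_t-\tfrac12\langle N,N\rangle_t\right),\qquad N_t=\int_0^t\Big\langle\Big(\frac{1}{1-s}-f(s)\Big)z_s,\,dB_s\Big\rangle,\quad t<1.$$ Then $(M_t,t<1)$ cannot be extended to a martingale on $[0,1]$.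
   Context: Martingales are with respect to the (completed) filtration $(\mathcal{F}_t)_{0\le t\le1}$ generated by $(B_t)$. To be extendable to a martingale on $[0,1]$ means that there is an integrable $\mathcal{F}_1$-measurable random variable $M_1$ such that $(M_t)_{0\le t\le1}$ is a martingale. *)

(* Defs.v *)
From HB Require Import structures.
From mathcomp Require Import all_boot all_order all_algebra.
From mathcomp Require Import all_classical all_reals all_analysis.

Set Implicit Arguments.
Unset Strict Implicit.
Unset Printing Implicit Defensive.

Import Order.TTheory GRing.Theory Num.Theory.
Import numFieldNormedType.Exports.

Local Open Scope classical_set_scope.
Local Open Scope ring_scope.

(* An R^n-valued process is a map R -> T -> 'rV[R]_n; only its values at the
   times of [0, 1] (or of [0, 1)) named in the definitions below matter.      *)

Section euclidean.
Context {R : realType} {n : nat}.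
Implicit Types u v : 'rV[R]_n.

Definition dotv u v : R := \sum_(i < n) u ord0 i * v ord0 i.

Definition sqnormv u : R := dotv u u.

End euclidean.

Section sigma_algebras.
Context {R : realType} {d : measure_display} {T : measurableType d}.

Definition G_measurable (G : set_system T) (X : T -> R) : Prop :=
  measurable_fun [set: g_sigma_algebraType G] (X : g_sigma_algebraType G -> R).

Definition G_measurablev (G : set_system T) {n : nat} (X : T -> 'rV[R]_n) :
    Prop :=
  forall i : 'I_n, G_measurable G (fun w => X w ord0 i).

Definition rv_events {n : nat} (X : T -> 'rV[R]_n) : set_system T :=
  \bigcup_(i in [set: 'I_n])
    preimage_set_system setT (fun w => X w ord0 i) measurable.

Definition past_events {n : nat} (B : R -> T -> 'rV[R]_n) (t : R) :
    set_system T :=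
  \bigcup_(s in `[0, t]) rv_events (B s).

(* The null sets are taken in the sigma-algebra of T, which is not assumed to
   be complete; if it is complete they are all the P-negligible sets.         *)
Definition filtration_gen (P : probability T R) {n : nat}
    (B : R -> T -> 'rV[R]_n) (t : R) : set_system T :=
  past_events B t `|` [set A | measurable A /\ P A = 0%E].

Definition filtration (P : probability T R) {n : nat}
    (B : R -> T -> 'rV[R]_n) (t : R) : set_system T :=
  <<s filtration_gen P B t >>.

End sigma_algebras.

Section processes.
Context {R : realType} {d : measure_display} {T : measurableType d}.
Variable P : probability T R.

(* Standard Brownian motion on R^n over the time interval [0, 1].  The law of
   an increment is N(0, (t - s) I_n), the product of the centered normal laws
   with variance t - s (normal_prob takes the standard deviation).            *)
Record brownian_motion {n : nat} (B : R -> T -> 'rV[R]_n) : Prop :=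
  BrownianMotion {
    bm_measurable : forall (t : R) (i : 'I_n), 0 <= t <= 1 ->
      measurable_fun setT (fun w => B t w ord0 i) ;
    bm_start : {ae P, forall w, B 0 w = 0} ;
    bm_continuous : {ae P, forall w, forall i : 'I_n,
      {within `[0, 1], continuous (fun t : R => B t w ord0 i)}} ;
    bm_independent : forall s t : R, 0 <= s -> s < t -> t <= 1 ->
      forall A C, <<s past_events B s >> A ->
        <<s rv_events (fun w => B t w - B s w) >> C ->
        P (A `&` C) = (P A * P C)%E ;
    bm_gaussian : forall s t : R, 0 <= s -> s < t -> t <= 1 ->
      forall C : 'I_n -> set R, (forall i, measurable (C i)) ->
        P [set w | forall i, C i (B t w ord0 i - B s w ord0 i)] =
        (\prod_(i < n) normal_prob 0 (Num.sqrt (t - s)) (C i))%E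
  }.

(* Strong solution of dz = dB - z / (1 - t) dt, z_0 = 0; the noise is additive,
   so the equation is a pathwise integral equation.                           *)
Record brownian_bridge {n : nat} (B z : R -> T -> 'rV[R]_n) : Prop :=
  BrownianBridge {
    bb_adapted : forall t : R, 0 <= t < 1 ->
      G_measurablev (filtration_gen P B t) (z t) ;
    bb_continuous : {ae P, forall w, forall i : 'I_n,
      {within `[0, 1[, continuous (fun t : R => z t w ord0 i)}} ;
    bb_equation : {ae P, forall w, forall t : R, 0 <= t < 1 -> forall i : 'I_n,
      z t w ord0 i = B t w ord0 i -
        \int[lebesgue_measure]_(s in `[0, t]) (z s w ord0 i / (1 - s))}
  }.

(* For a partition 0 :: s of [0, t] (that is, itv_partition 0 t s), its k-th
   point, k <= size s.                                                        *)
Definition part_pt (s : seq R) (k : nat) : R := nth 0 (0 :: s) k.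

Definition mesh (s : seq R) : R :=
  \big[Num.max/0]_(k < size s) (part_pt s k.+1 - part_pt s k).

Record simple_integrand {n : nat} (B : R -> T -> 'rV[R]_n) (t : R) :=
  SimpleIntegrand {
    si_part : seq R ;
    si_val : nat -> T -> 'rV[R]_n ;
    si_partition : itv_partition 0 t si_part ;
    si_measurable : forall k, (k < size si_part)%N ->
      G_measurablev (filtration_gen P B (part_pt si_part k)) (si_val k) ;
    si_bounded : forall k, (k < size si_part)%N ->
      exists c : R, forall w i, `|si_val k w ord0 i| <= c
  }.

Definition simple_eval {n : nat} {B : R -> T -> 'rV[R]_n} {t : R}
    (phi : simple_integrand B t) (s : R) (w : T) : 'rV[R]_n :=
  \sum_(k < size (si_part phi) |
        part_pt (si_part phi) k < s <= part_pt (si_part phi) k.+1)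
    si_val phi k w.

Definition simple_integral {n : nat} {B : R -> T -> 'rV[R]_n} {t : R}
    (phi : simple_integrand B t) (w : T) : R :=
  \sum_(k < size (si_part phi))
    dotv (si_val phi k w)
         (B (part_pt (si_part phi) k.+1) w - B (part_pt (si_part phi) k) w).

(* N_t = \int_0^t <H_s, dB_s> for t < 1, in the L^2 sense of Ito: for integrands
   H with almost surely continuous paths such that E \int_0^t |H_s|^2 ds is
   finite for all t < 1.                                                      *)
Record ito_integral {n : nat} (B H : R -> T -> 'rV[R]_n) (N : R -> T -> R) :
    Prop := ItoIntegral {
  ito_adapted : forall t : R, 0 <= t < 1 ->
    G_measurable (filtration_gen P B t) (N t) ;
  ito_continuous : {ae P, forall w,
    {within `[0, 1[, continuous (fun t : R => N t w)}} ;
  ito_approx : forall t : R, 0 <= t < 1 ->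
    exists phi : nat -> simple_integrand B t,
      ((fun k => \int[P]_w \int[lebesgue_measure]_(s in `[0%R, t])
          (sqnormv (simple_eval (phi k) s w - H s w))%:E)%E @ \oo --> 0%E) /\
      ((fun k => \int[P]_w
          ((simple_integral (phi k) w - N t w) ^+ 2)%:E)%E @ \oo --> 0%E)
}.

Definition cvg_in_probability (X : nat -> T -> R) (Y : T -> R) : Prop :=
  forall e : R, 0 < e ->
    (fun k => P [set w | e <= `|X k w - Y w|]) @ \oo --> 0%E.

(* Q = <N, N> on [0, 1): Q_t is the limit in probability of the sums of squared
   increments of N along partitions of [0, t] whose mesh tends to 0.          *)
Record quadratic_variation (N Q : R -> T -> R) : Prop := QuadraticVariation {
  qv_measurable : forall t : R, 0 <= t < 1 -> measurable_fun setT (Q t) ;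
  qv_limit : forall t : R, 0 <= t < 1 ->
    forall D : nat -> seq R, (forall k, itv_partition 0 t (D k)) ->
      (fun k => mesh (D k)) @ \oo --> (0 : R) ->
      cvg_in_probability
        (fun k w => \sum_(j < size (D k))
           (N (part_pt (D k) j.+1) w - N (part_pt (D k) j) w) ^+ 2)
        (Q t)
}.

(* E[X_t | F_s] = X_s is written out as equality of the integrals of X_t and
   X_s over all events of F_s.                                                *)
Record martingale {n : nat} (B : R -> T -> 'rV[R]_n) (I : set R)
    (X : R -> T -> R) : Prop := Martingale {
  mart_adapted : forall t, I t -> G_measurable (filtration_gen P B t) (X t) ;
  mart_integrable : forall t, I t -> P.-integrable setT (EFin \o X t) ;
  mart_condexp : forall s t, I s -> I t -> s <= t ->
    forall A, filtration P B s A ->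
      (\int[P]_(w in A) (X t w)%:E = \int[P]_(w in A) (X s w)%:E)%E
}.

Definition extendable_to_martingale {n : nat} (B : R -> T -> 'rV[R]_n)
    (M : R -> T -> R) : Prop :=
  exists M1 : T -> R,
    [/\ G_measurable (filtration_gen P B 1) M1,
        P.-integrable setT (EFin \o M1) &
        martingale B `[0, 1] (fun t => if t < 1 then M t else M1)].

End processes.

(* Main.v *)
(* Write [W = z / (1 - t)], so that the integrand of [N] is [g W] with
   [g = 1 - (1 - t) f]; in both cases [|g|] is bounded away from 0 near [t = 1].
   On the uniform grid [t_j] of [[0, t]], the bridge equation shows that [W] is
   close in L^2 to the walk [S_j], the sum of the [(B_(t_(i+1)) - B_(t_i)) /
   (1 - t_i)] for [i < j], and therefore [N_t] to the sum of the
   [D_j = <g(t_j) S_j, B_(t_(j+1)) - B_(t_j)>].  The sum of the [D_j ^ 2] is close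
   to the energy [E = (t / K) sum_j |g(t_j) S_j| ^ 2], whose mean grows like
   [- ln (1 - t)] and whose variance is at most of the same order: it tends to
   infinity in probability as [t] tends to 1.  Since the exponential of
   [sum_j D_j / 2 - sum_j D_j ^ 2 / 8] has mean at most 1, the exponent
   [sum_j D_j - (3 / 8) sum_j D_j ^ 2] tends to minus infinity in probability,
   and it dominates [N_t - <N, N>_t / 2] up to a bounded error (the constant 3/8
   instead of 1/2 pays for the discretization errors).  Hence [M_t] tends to 0 in
   probability.  If [M] were closed by some [M_1], it would be uniformly
   integrable and [E M_t] would tend to 0, whereas [E M_t = E M_0 > 0]. *)
Require Import Defs.
From HB Require Import structures.
From mathcomp Require Import all_boot all_order all_algebra.
From mathcomp Require Import all_classical all_reals all_analysis.
From mathcomp Require Import measurable_realfun ring lra zify.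

Set Implicit Arguments.
Unset Strict Implicit.
Unset Printing Implicit Defensive.

Import Order.TTheory GRing.Theory Num.Theory.
Import numFieldNormedType.Exports.

Local Open Scope classical_set_scope.
Local Open Scope ring_scope.

(** * Real inequalities and random variables with all moments *)

(** [N] and [<N, N>] are known only through limits, in L^2 and in probability, taken separately at
    each time. The argument therefore uses no Ito calculus: it fixes [t < 1], discretizes with
    explicit error bounds, and picks the mesh last, because these bounds blow up as [t] tends to 1.
    The walk replaces the bridge because it is a sum of independent increments with deterministic
    weights: it is adapted and its moments can be computed. The bridge equation serves only to
    compare the two. In the exponential, the squares [D_j ^ 2] stand where one would expect
    conditional variances; symmetry of the increments alone then bounds the mean by 1, with no
    Laplace transform and no integrability to check. The tilt 1/2 leaves room: it controls
    [sum D_j - sum D_j ^ 2 / 4] from above, so the coefficient 3/8 leaves a surplus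
    [sum D_j ^ 2 / 8], which diverges. In the power case [g] vanishes at time 0, so only the energy
    after some time [s0] is counted; one coordinate of the walk is enough. *)

Lemma ler_normD_exp (R : realDomainType) (x y : R) (k : nat) :
  `|x + y| ^+ k <= 2 ^+ k * (`|x| ^+ k + `|y| ^+ k).
Proof.
wlog xy : x y / `|x| <= `|y| => [H|].
  have [/H//|/ltW /H] := leP `|x| `|y|.
  by rewrite [y + x]addrC [X in _ * X]addrC.
have : `|x + y| <= 2 * `|y| by have := ler_normD x y; lra.
move=> /(@lerXn2r _ k); rewrite !nnegrE => h.
apply: (le_trans (h _ _)); [by []|by rewrite mulr_ge0|].
by rewrite exprMn ler_wpM2l ?exprn_ge0// lerDr exprn_ge0.
Qed.

Lemma ler_normM_exp (R : realDomainType) (x y : R) (k : nat) :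
  `|x * y| ^+ k <= `|x| ^+ (2 * k) + `|y| ^+ (2 * k).
Proof.
rewrite normrM exprMn mulnC !exprM.
set a := `|x| ^+ k; set b := `|y| ^+ k.
have : 0 <= a by rewrite exprn_ge0.
have : 0 <= b by rewrite exprn_ge0.
nra.
Qed.

Lemma expR_ge1Dxn2 (R : realType) (x : R) : 0 <= x -> 1 + x + x ^+ 2 / 2 <= expR x.
Proof.
move=> x0.
rewrite expRE; apply: le_trans (nondecreasing_cvgn_le _ _ 3%N).
- rewrite /pseries /series/= !big_nat_recr//= big_nil.
  by rewrite !factS fact0 expr0 expr1; lra.
- apply/nondecreasing_seqP => n; rewrite /pseries /series/= big_nat_recr//= lerDl.
  by rewrite mulr_ge0 ?exprn_ge0 ?invr_ge0.
- have := is_cvg_series_exp_coeff x.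
  by rewrite exp_coeffE.
Qed.

Lemma double_fact_ge (n : nat) : (2 ^ n * n`! <= (2 * n)`!)%N.
Proof.
elim: n => [|n IH]; first by rewrite muln0 fact0 expn0.
rewrite (_ : 2 * n.+1 = (2 * n).+2)%N; last by rewrite mulnS.
rewrite !factS expnS.
have -> : (2 * 2 ^ n * (n.+1 * n`!) = 2 * n.+1 * (2 ^ n * n`!))%N by lia.
by apply: leq_mul; [lia|apply: (leq_trans IH); rewrite leq_pmull].
Qed.

(* The Taylor coefficients satisfy [1 / (2 k)! <= 1 / (2 ^ k k!)]. *)
Lemma cosh_le_expR (R : realType) (y : R) :
  expR y + expR (- y) <= 2 * expR (y ^+ 2 / 2).
Proof.
have c x : series (exp_coeff x) @ \oo --> expR x.
  exact: is_cvg_series_exp_coeff.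
have cc : (fun n => series (exp_coeff y) (2 * n)%N + series (exp_coeff (- y)) (2 * n)%N)
    @ \oo --> expR y + expR (- y).
  have i2 : (fun n : nat => (2 * n)%N) @ \oo --> \oo.
    by apply/cvgnyPge => A; near=> n; rewrite (leq_trans (near (nbhs_infty_ge A) n _))//; lia.
  by apply: cvgD; apply: (cvg_comp _ _ i2); apply: c.
have c2 : (fun n => 2 * series (exp_coeff (y ^+ 2 / 2)) n) @ \oo --> 2 * expR (y ^+ 2 / 2).
  by apply: cvgMr; apply: c.
apply: (ler_cvg_to cc c2); apply: nearW => n.
elim: n => [|n IH]; first by rewrite muln0 /series/= !big_nil; lra.
rewrite (_ : 2 * n.+1 = (2 * n).+2)%N; last by lia.
rewrite [leLHS](_ : _ = (series (exp_coeff y) (2 * n)%N + series (exp_coeff (- y)) (2 * n)%N) + 2 * (y ^+ (2 * n) / (2 * n)`!%:R)).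
  rewrite [in leRHS]/series/= big_nat_recr//= mulrDr lerD//.
  rewrite ler_wpM2l// /exp_coeff/= exprMn -exprM exprVn mulrC -mulrA.
  rewrite (mulrC _^-1); apply: ler_wpM2l.
    rewrite exprM;
    by rewrite exprn_ge0// sqr_ge0.
  rewrite -[leRHS]invfM lef_pV2 ?posrE ?mulr_gt0 ?ltr0n ?fact_gt0 ?exprn_gt0//.
  by rewrite -natrX -natrM ler_nat double_fact_ge.
rewrite /series/= !big_nat_recr//= /exp_coeff/=.
have -> : (- y) ^+ (2 * n) = y ^+ (2 * n) by rewrite exprM sqrrN -exprM.
have -> : (- y) ^+ (2 * n).+1 = - y ^+ (2 * n).+1.
  by rewrite exprSr exprM sqrrN -exprM mulrN -exprSr.
by rewrite mulNr; ring.
Unshelve. all: by end_near.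
Qed.

Section mean.
Context {R : realType} {d : measure_display} {T : measurableType d}.
Variable P : probability T R.
Implicit Types X Y : T -> R.

Definition mean X : R := \int[P]_w X w.

(** This class is closed under sums and products, so every polynomial in Brownian increments is
    integrable and [mean] is linear on such polynomials without further side conditions. *)
Definition all_moments X : Prop := measurable_fun setT X /\
  forall k : nat, P.-integrable setT (EFin \o (fun w => `|X w| ^+ k)).

Lemma all_moments_integrable X : all_moments X -> P.-integrable setT (EFin \o X).
Proof.
move=> [mX /(_ 1%N)]; apply: le_integrable => //; first exact/measurable_EFinP.
by move=> w _ /=; rewrite lee_fin expr1 normr_id.
Qed.

Lemma all_moments_cst (c : R) : all_moments (cst c).
Proof.
split=> [//|k].
exact: (@finite_measure_integrable_cst _ _ _ P setT (`|c| ^+ k) measurableT).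
Qed.

Lemma all_momentsD X Y : all_moments X -> all_moments Y ->
  all_moments (fun w => X w + Y w).
Proof.
move=> [mX iX] [mY iY]; split; first exact: measurable_funD.
move=> k.
apply: (@le_integrable _ _ _ P setT measurableT _
   (EFin \o (fun w => 2 ^+ k * (`|X w| ^+ k + `|Y w| ^+ k)))).
- apply/measurable_EFinP; apply: measurable_funX; apply: measurableT_comp => //.
  exact: measurable_funD.
- move=> w _ /=; rewrite lee_fin ger0_norm ?exprn_ge0//.
  by apply: le_trans (ler_norm _); exact: ler_normD_exp.
- exact: (@integrableZl _ _ _ P setT measurableT _ _ (@integrableD _ _ _ P setT measurableT _ _ (iX k) (iY k))).
Qed.

Lemma all_momentsM X Y : all_moments X -> all_moments Y ->
  all_moments (fun w => X w * Y w).
Proof.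
move=> [mX iX] [mY iY]; split; first exact: measurable_funM.
move=> k.
apply: (@le_integrable _ _ _ P setT measurableT _
   (EFin \o (fun w => (`|X w| ^+ (2 * k) + `|Y w| ^+ (2 * k))))).
- apply/measurable_EFinP; apply: measurable_funX; apply: measurableT_comp => //.
  exact: measurable_funM.
- move=> w _ /=; rewrite lee_fin ger0_norm ?exprn_ge0//.
  by apply: le_trans (ler_norm _); exact: ler_normM_exp.
- exact: (@integrableD _ _ _ P setT measurableT _ _ (iX _) (iY _)).
Qed.

Lemma all_moments_norm X : all_moments X -> all_moments (fun w => `|X w|).
Proof.
move=> [mX iX]; split; first exact: measurableT_comp.
by move=> k; under [X in _ \o X]eq_fun do rewrite normr_id.
Qed.

Lemma all_momentsZ (c : R) X : all_moments X -> all_moments (fun w => c * X w).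
Proof. by move=> mX; apply: all_momentsM => //; exact: all_moments_cst. Qed.

Lemma all_momentsB X Y : all_moments X -> all_moments Y ->
  all_moments (fun w => X w - Y w).
Proof.
move=> mX mY; apply: all_momentsD => //.
rewrite (_ : (fun w => - Y w) = (fun w => -1 * Y w)); first exact: all_momentsZ.
by apply/funext => w; rewrite mulN1r.
Qed.

Lemma all_momentsX (k : nat) X : all_moments X -> all_moments (fun w => X w ^+ k).
Proof.
move=> mX; elim: k => [|k IH].
  by under eq_fun do rewrite expr0; exact: all_moments_cst.
by under eq_fun do rewrite exprS; exact: all_momentsM.
Qed.

Lemma all_moments_sum I (s : seq I) (Q : pred I) (F : I -> T -> R) :
  (forall i, Q i -> all_moments (F i)) ->
  all_moments (fun w => \sum_(i <- s | Q i) F i w).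
Proof.
move=> mF; elim: s => [|i s IH].
  by under eq_fun do rewrite big_nil; exact: all_moments_cst.
under eq_fun do rewrite big_cons; case: (boolP (Q i)) => // Qi.
by apply: all_momentsD => //; exact: mF.
Qed.

Lemma all_moments_bounded X (c : R) : measurable_fun setT X ->
  (forall w, `|X w| <= c) -> all_moments X.
Proof.
move=> mX Xc; split=> // k.
apply: (@le_integrable _ _ _ P setT measurableT _ (EFin \o cst (c ^+ k))).
- by apply/measurable_EFinP; apply: measurable_funX; exact: measurableT_comp.
- move=> w _ /=; rewrite lee_fin ger0_norm ?exprn_ge0//.
  by apply: le_trans (ler_norm _); apply: lerXn2r (Xc w); rewrite nnegrE// (le_trans _ (Xc w)).
- exact: finite_measure_integrable_cst.
Qed.

Lemma mean_cst (c : R) : mean (cst c) = c.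
Proof. rewrite /mean Rintegral_cst//.
by rewrite (_ : fine _ = 1) ?mulr1//; exact: (congr1 fine (probability_setT P)). Qed.

Lemma meanD X Y : all_moments X -> all_moments Y ->
  mean (fun w => X w + Y w) = mean X + mean Y.
Proof. by move=> /all_moments_integrable iX /all_moments_integrable iY; exact: RintegralD. Qed.

Lemma meanB X Y : all_moments X -> all_moments Y ->
  mean (fun w => X w - Y w) = mean X - mean Y.
Proof. by move=> /all_moments_integrable iX /all_moments_integrable iY; exact: RintegralB. Qed.

Lemma meanZ (c : R) X : all_moments X -> mean (fun w => c * X w) = c * mean X.
Proof. by move=> /all_moments_integrable iX; exact: RintegralZl. Qed.

Lemma mean_sum I (s : seq I) (Q : pred I) (F : I -> T -> R) :
  (forall i, Q i -> all_moments (F i)) ->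
  mean (fun w => \sum_(i <- s | Q i) F i w) = \sum_(i <- s | Q i) mean (F i).
Proof.
move=> mF; elim: s => [|i s IH].
  by under [in LHS]eq_fun do rewrite big_nil; rewrite big_nil mean_cst.
under [in LHS]eq_fun do rewrite big_cons; rewrite big_cons; case: (boolP (Q i)) => // Qi.
by rewrite meanD ?IH//; [exact: mF|exact: all_moments_sum].
Qed.

Lemma mean_ge0 X : (forall w, 0 <= X w) -> 0 <= mean X.
Proof. by move=> X0; apply: Rintegral_ge0. Qed.

Lemma mean_le X Y : all_moments X -> all_moments Y ->
  (forall w, X w <= Y w) -> mean X <= mean Y.
Proof.
move=> /all_moments_integrable iX /all_moments_integrable iY XY.
exact: le_Rintegral.
Qed.

Lemma integral_mean X : all_moments X -> (\int[P]_w (X w)%:E = (mean X)%:E)%E.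
Proof.
move=> /all_moments_integrable iX; rewrite /mean /Rintegral fineK//.
exact: integrable_fin_num.
Qed.

End mean.

(** * Expectations of functions of two independent sigma-algebras *)

Section independence.
Context {R : realType} {d : measure_display} {T : measurableType d}.
Variable P : probability T R.
Variables (G1 G2 : set_system T).
Hypothesis mG1 : <<s G1 >> `<=` measurable.
Hypothesis mG2 : <<s G2 >> `<=` measurable.
Hypothesis indG : forall A C, <<s G1 >> A -> <<s G2 >> C ->
  P (A `&` C) = (P A * P C)%E.

Local Notation T1 := (g_sigma_algebraType G1).
Local Notation T2 := (g_sigma_algebraType G2).

Lemma g_sigma_id_measurable (G : set_system T) : <<s G >> `<=` measurable ->
  measurable_fun [set: T] (id : T -> g_sigma_algebraType G).
Proof. by move=> mG _ A mA; rewrite setTI preimage_id; exact: mG. Qed.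

Lemma G_measurable_fun (G : set_system T) (X : T -> R) : <<s G >> `<=` measurable ->
  G_measurable G X -> measurable_fun [set: T] X.
Proof. by move=> mG mX _ A mA; apply: mG; exact: mX. Qed.

(** The identity, read as a random variable with values in [T] carrying the smaller sigma-algebra.
    Its law is the restriction of [P]. *)
Let i1 : {mfun T >-> T1} := HB.pack (id : T -> T1) (isMeasurableFun.Build _ _ _ _ _ (g_sigma_id_measurable mG1)).
Let i2 : {mfun T >-> T2} := HB.pack (id : T -> T2) (isMeasurableFun.Build _ _ _ _ _ (g_sigma_id_measurable mG2)).

Let diag : T -> T1 * T2 := fun w => (w, w).
Let mdiag : measurable_fun setT diag.
Proof. by apply: measurable_fun_pair; [exact: (g_sigma_id_measurable mG1)|exact: (g_sigma_id_measurable mG2)]. Qed.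
Let diagf : {mfun T >-> (T1 * T2)%type} := HB.pack diag (isMeasurableFun.Build _ _ _ _ _ mdiag).

(** Independence says that the law of the diagonal [w |-> (w, w)] on the product of the two
    sub-sigma-algebras is the product of the restrictions of [P]; Tonelli does the rest. *)
Lemma decoupling (g : T1 * T2 -> \bar R) : measurable_fun setT g ->
  (forall x, 0 <= g x)%E ->
  (\int[P]_w g (w, w) = \int[P]_w \int[P]_w' g (w, w'))%E.
Proof.
move=> mg g0.
pose P1 := distribution P i1; pose P2 := distribution P i2.
have PE : forall X, measurable X -> (P1 \x P2)%E X = distribution P diagf X.
  apply: product_measure_unique => A B mA mB.
  by rewrite /distribution /pushforward -indG//.
transitivity (\int[distribution P diagf]_x g x)%E.
  by rewrite ge0_integral_pushforward// preimage_setT.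
transitivity (\int[P1 \x P2]_x g x)%E.
  by apply: eq_measure_integral => A mA _; apply/esym/PE.
rewrite (fubini_tonelli1 g)// ge0_integral_pushforward//=.
- rewrite preimage_setT; apply: eq_integral => x _ /=.
  rewrite /fubini_F ge0_integral_pushforward//= ?preimage_setT//.
    exact: (g_sigma_id_measurable mG2).
  by apply: (measurableT_comp mg); apply: measurable_fun_pair.
- exact: (g_sigma_id_measurable mG1).
- exact: (measurable_fun_fubini_tonelli_F g).
- by move=> x _; apply: integral_ge0.
Qed.

Let mean_indep_ge0 X Y : G_measurable G1 X -> G_measurable G2 Y ->
  all_moments P X -> all_moments P Y ->
  (forall w, 0 <= X w) -> (forall w, 0 <= Y w) ->
  mean P (fun w => X w * Y w) = mean P X * mean P Y.
Proof.
move=> mX mY aX aY X0 Y0; apply: EFin_inj.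
rewrite -integral_mean; last exact: all_momentsM.
rewrite (@decoupling (fun x => (X x.1 * Y x.2)%:E)).
- have inner w : (\int[P]_w' (X w * Y w')%:E = (X w)%:E * (mean P Y)%:E)%E.
    under eq_integral do rewrite EFinM.
    rewrite ge0_integralZl//; first by rewrite (integral_mean aY).
    - by apply/measurable_EFinP; exact: G_measurable_fun mY.
    - by move=> w' _; rewrite lee_fin.
    - by rewrite lee_fin.
  rewrite (eq_integral (fun w => (X w)%:E * (mean P Y)%:E)%E); last first.
    by move=> w _; exact: inner.
  rewrite ge0_integralZr//.
  - by rewrite (integral_mean aX).
  - by apply/measurable_EFinP; exact: G_measurable_fun mX.
  - by move=> w _; rewrite lee_fin.
  - by rewrite lee_fin mean_ge0.
- apply/measurable_EFinP/measurable_funM.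
    exact: (measurableT_comp mX measurable_fst).
  exact: (measurableT_comp mY measurable_snd).
- by move=> x; rewrite lee_fin mulr_ge0.
Qed.

(** Each factor is [|X| - (|X| - X)], a difference of two nonnegative variables with the same
    measurability and all moments; the product is expanded into four nonnegative cases. *)
Lemma mean_indep X Y : G_measurable G1 X -> G_measurable G2 Y ->
  all_moments P X -> all_moments P Y ->
  mean P (fun w => X w * Y w) = mean P X * mean P Y.
Proof.
move=> mX mY aX aY.
have nX : G_measurable G1 (fun w => `|X w|) by exact: measurableT_comp mX.
have nY : G_measurable G2 (fun w => `|Y w|) by exact: measurableT_comp mY.
have dX : G_measurable G1 (fun w => `|X w| - X w) by exact: measurable_funB nX mX.
have dY : G_measurable G2 (fun w => `|Y w| - Y w) by exact: measurable_funB nY mY.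
have anX := all_moments_norm aX; have anY := all_moments_norm aY.
have adX := all_momentsB anX aX; have adY := all_momentsB anY aY.
have sub0 (x : R) : 0 <= `|x| - x by rewrite subr_ge0 ler_norm.
have mE Z : all_moments P Z -> mean P Z = mean P (fun w => `|Z w|) - mean P (fun w => `|Z w| - Z w).
  move=> aZ; rewrite -meanB//; last 2 first.
  - exact: all_moments_norm.
  - by apply: all_momentsB => //; exact: all_moments_norm.
  by congr mean; apply/funext => w; ring.
rewrite (mE X)// (mE Y)//.
transitivity (mean P (fun w => (`|X w| * `|Y w| - `|X w| * (`|Y w| - Y w)) -
   ((`|X w| - X w) * `|Y w| - (`|X w| - X w) * (`|Y w| - Y w)))).
  by congr mean; apply/funext => w; ring.
rewrite meanB; [|by apply: all_momentsB; exact: all_momentsM..].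
rewrite meanB; [|exact: all_momentsM..].
rewrite [X in _ - X = _]meanB; [|exact: all_momentsM..].
rewrite !mean_indep_ge0//.
by ring.
Qed.

End independence.

(** * Moments of the centered normal law *)

Section gaussian_moments.
Context {R : realType}.
Local Notation leb := (@lebesgue_measure R).

(** The Radon-Nikodym derivative of [normal_prob] has the same integral as [normal_pdf] over every
    measurable set, so the two agree almost everywhere. *)
Lemma integral_normal_prob (m s : R) (f : R -> \bar R) :
  measurable_fun setT f -> (forall x, 0 <= f x)%E ->
  (\int[normal_prob m s]_x f x = \int[leb]_x (f x * (normal_pdf m s x)%:E))%E.
Proof.
move=> mf f0.
have dom : normal_prob m s `<< leb := normal_prob_dominates m s.
rewrite -(Radon_Nikodym_SigmaFinite.change_of_variables dom f0 measurableT mf).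
have ifd := Radon_Nikodym_SigmaFinite.f_integrable dom.
have mfd := measurable_int _ ifd.
have mpdf : measurable_fun setT (EFin \o normal_pdf m s).
  by apply/measurable_EFinP; exact: measurable_normal_pdf.
apply: ge0_ae_eq_integral => //.
- exact: emeasurable_funM.
- exact: emeasurable_funM.
- by move=> x _; rewrite mule_ge0// Radon_Nikodym_SigmaFinite.f_ge0.
- by move=> x _; rewrite mule_ge0// lee_fin normal_pdf_ge0.
- have h : ae_eq leb setT (Radon_Nikodym_SigmaFinite.f (normal_prob m s) leb) (EFin \o normal_pdf m s).
    apply: integral_ae_eq => //.
    by move=> E _ mE; rewrite -Radon_Nikodym_SigmaFinite.f_integral.
  by apply: filterS h => x /= hx _; rewrite hx.
Qed.

(* [expR (u x ^ 2)] turns the density of N(0, s ^ 2) into [r] times that of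
   N(0, (r s) ^ 2). *)
Lemma integral_normal_expR_sqr (s r : R) : 0 < s -> 0 < r ->
  (\int[normal_prob 0 s]_x (expR ((1 - r ^- 2) / (2 * s ^+ 2) * x ^+ 2))%:E
   = r%:E)%E.
Proof.
move=> s0 r0; rewrite integral_normal_prob; last 2 first.
- by apply/measurable_EFinP; apply: measurableT_comp => //; apply: measurable_funM => //; exact: measurable_funX.
- by move=> x; rewrite lee_fin expR_ge0.
transitivity (\int[leb]_x (r%:E * (normal_pdf 0 (r * s) x)%:E))%E.
  apply: eq_integral => x _; rewrite -!EFinM; congr EFin.
  rewrite !normal_pdfE ?gt_eqF ?mulr_gt0// /normal_peak /normal_fun !subr0.
  rewrite (_ : (r * s) ^+ 2 * pi *+ 2 = r ^+ 2 * (s ^+ 2 * pi *+ 2)); last by ring.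
  rewrite (sqrtrM _ (sqr_ge0 r)) sqrtr_sqr (gtr0_norm r0) [(r * Num.sqrt _)^-1]invfM mulrCA -expRD.
  rewrite [RHS]mulrA [r * (r^-1 * _)]mulrA divff ?gt_eqF// mul1r; congr (_ * expR _).
  by field; rewrite !gt_eqF.
rewrite ge0_integralZl_EFin ?ltW//.
- by rewrite integral_normal_pdf mule1.
- by move=> x _; rewrite lee_fin normal_pdf_ge0.
- by apply/measurable_EFinP; exact: measurable_normal_pdf.
Qed.

(** Lets [r] decrease to 1: the moment bounds below come with a free parameter [r]. *)
Lemma ler_scale_sqr (x y : R) : (forall r, 1 < r -> x <= y * r ^+ 2) -> 0 <= y -> x <= y.
Proof.
move=> h y0; apply/ler_addgt0Pr => e e0.
have y1 : 0 < y + 1 by lra.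
(* With [r = 1 + q] and [q <= 1] one has [r ^ 2 <= 1 + 3 q], so the excess over [y] is at most
   [3 q y <= e]. *)
pose q := Num.min 1 (e / (3 * (y + 1))).
have q0 : 0 < q by rewrite lt_min ltr01 divr_gt0// mulr_gt0.
have q1 : q <= 1 by rewrite ge_min lexx.
have q2 : q * (3 * (y + 1)) <= e.
  by rewrite -ler_pdivlMr ?mulr_gt0// ge_min lexx orbT.
apply: (le_trans (h (1 + q) _)); first by lra.
nra.
Qed.

Context {d : measure_display} {T : measurableType d}.
Variables (P : probability T R) (X : T -> R) (s : R).
Hypothesis s0 : 0 < s.
Hypothesis mX : measurable_fun setT X.
Hypothesis lawX : forall C, measurable C -> P (X @^-1` C) = normal_prob 0 s C.

Lemma gaussian_expR_sqr (r : R) : 0 < r ->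
  (\int[P]_w (expR ((1 - r ^- 2) / (2 * s ^+ 2) * X w ^+ 2))%:E = r%:E)%E.
Proof.
move=> r0; rewrite -(integral_normal_expR_sqr s0 r0).
have mX' : measurable_fun [set: T] (X : T -> measurableTypeR R) by exact: mX.
pose XX : {mfun T >-> measurableTypeR R} := HB.pack (X : T -> measurableTypeR R) (isMeasurableFun.Build _ _ _ _ _ mX').
transitivity (\int[distribution P XX]_x (expR ((1 - r ^- 2) / (2 * s ^+ 2) * x ^+ 2))%:E)%E; last first.
  by apply: eq_measure_integral => A mA _; exact: lawX.
rewrite ge0_integral_distribution//.
  by apply/measurable_EFinP; apply: measurableT_comp => //; apply: measurable_funM => //; exact: measurable_funX.
Qed.

(** For [|x| > 1] the power is at most [(x ^ 2) ^ k], which one term of the exponential series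
    dominates; for [|x| <= 1] the added 1 is enough. *)
Lemma expr_le_expR (c x : R) (k : nat) : 0 < c ->
  `|x| ^+ k <= (k`!%:R / c ^+ k + 1) * expR (c * x ^+ 2).
Proof.
move=> c0.
have [x1|/ltW x1] := leP `|x| 1.
  rewrite -[leLHS]mulr1 ler_pM ?exprn_ge0//.
    by apply: (@le_trans _ _ 1); [exact: exprn_ile1|rewrite lerDr divr_ge0// exprn_ge0// ltW].
  by rewrite -expR0 ler_expR mulr_ge0 ?sqr_ge0// ltW.
apply: (@le_trans _ _ (k`!%:R / c ^+ k * expR (c * x ^+ 2))); last first.
  by rewrite ler_wpM2r ?expR_ge0// lerDl.
have le1 : `|x| ^+ k <= (x ^+ 2) ^+ k.
  apply: lerXn2r; rewrite ?nnegrE ?sqr_ge0//.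
  by rewrite -(real_normK (num_real x)) expr2 ler_peMl.
apply: (le_trans le1).
rewrite [leRHS]mulrAC ler_pdivlMr ?exprn_gt0//.
have y0 : 0 <= c * x ^+ 2 by rewrite mulr_ge0 ?sqr_ge0// ltW.
case: k {le1} => [|k].
  by rewrite !expr0 mul1r fact0 mul1r -expR0 ler_expR.
rewrite -ler_pdivrMl ?ltr0n ?fact_gt0// -exprMn mulrC (mulrC (x ^+ 2)).
by apply: le_trans (expR_ge1Dxn k y0); rewrite lerDr.
Qed.

Lemma gaussian_all_moments : all_moments P X.
Proof.
(* The rate belonging to [r = 2]: it is positive and [expR (c X ^ 2)] has mean 2. *)
split=> // k; pose c : R := (1 - 2 ^- 2) / (2 * s ^+ 2).
have c0 : 0 < c.
  by rewrite divr_gt0 ?mulr_gt0 ?exprn_gt0// subr_gt0 invf_lt1 ?exprn_gt0// expr_gt1//; lra.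
have mE : measurable_fun setT (fun w => expR (c * X w ^+ 2)).
  by apply: measurableT_comp => //; apply: measurable_funM => //; exact: measurable_funX.
have iE : P.-integrable setT (EFin \o (fun w => expR (c * X w ^+ 2))).
  apply/integrableP; split; first exact/measurable_EFinP.
  under eq_integral do rewrite /= ger0_norm ?expR_ge0//.
  by rewrite /= gaussian_expR_sqr// ltry.
apply: (@le_integrable _ _ _ P setT measurableT _
  (fun w => (k`!%:R / c ^+ k + 1)%:E * (EFin \o (fun w => expR (c * X w ^+ 2))) w)%E).
- by apply/measurable_EFinP; apply: measurable_funX; exact: measurableT_comp.
- move=> w _ /=; rewrite lee_fin ger0_norm ?exprn_ge0//.
  by apply: le_trans (ler_norm _); exact: expr_le_expR.
- exact: integrableZl.
Qed.

Let mean_lt (Y : T -> R) (r : R) : all_moments P Y -> 0 < r ->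
  (forall w, Y w <= expR ((1 - r ^- 2) / (2 * s ^+ 2) * X w ^+ 2)) ->
  mean P Y <= r.
Proof.
move=> aY r0 YE; rewrite -lee_fin -(gaussian_expR_sqr r0) -integral_mean//.
have iY := all_moments_integrable aY.
apply: le_integral => //; last by move=> w _; rewrite lee_fin.
apply/integrableP; split.
  by apply/measurable_EFinP; apply: measurableT_comp => //; apply: measurable_funM => //; exact: measurable_funX.
under eq_integral do rewrite /= ger0_norm ?expR_ge0//.
by rewrite /= gaussian_expR_sqr// ltry.
Qed.

(** Take means in [1 + u X ^ 2 <= expR (u X ^ 2)], where the right side has mean [r], and divide by
    [r - 1]. As [r] tends to 1 from above this gives one inequality; from below, where [u < 0], it
    gives the other. *)
Lemma gaussian_mean_sqr : mean P (fun w => X w ^+ 2) = s ^+ 2.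
Proof.
have aX2 := all_momentsX 2 gaussian_all_moments.
have key r : 0 < r -> 1 + (1 - r ^- 2) / (2 * s ^+ 2) * mean P (fun w => X w ^+ 2) <= r.
  move=> r0; rewrite -{1}[1](@mean_cst _ _ _ P) -meanZ// -meanD; last 2 first.
  - exact: all_moments_cst.
  - exact: all_momentsZ.
  apply: mean_lt => //.
    by apply: all_momentsD; [exact: all_moments_cst|exact: all_momentsZ].
  by move=> w; exact: expR_ge1Dx.
have s20 : 0 < s ^+ 2 by rewrite exprn_gt0.
have m0 : 0 <= mean P (fun w => X w ^+ 2) by apply: mean_ge0 => w; exact: sqr_ge0.
set m := mean _ _ in key m0 *.
have key2 r : 0 < r -> (r ^+ 2 - 1) * m <= 2 * s ^+ 2 * r ^+ 2 * (r - 1).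
  move=> r0; have r20 : 0 < r ^+ 2 by rewrite exprn_gt0.
  have E : r - (1 + (1 - r ^- 2) / (2 * s ^+ 2) * m) =
      (2 * s ^+ 2 * r ^+ 2 * (r - 1) - (r ^+ 2 - 1) * m) / (2 * s ^+ 2 * r ^+ 2).
    by field; rewrite !gt_eqF.
  have : 0 <= r - (1 + (1 - r ^- 2) / (2 * s ^+ 2) * m) by rewrite subr_ge0 key.
  by rewrite E pmulr_lge0 ?invr_gt0 ?mulr_gt0// subr_ge0.
apply/eqP; rewrite eq_le; apply/andP; split.
  apply: ler_scale_sqr; last exact: ltW.
  move=> r r1; have r0 : 0 < r by lra.
  have := key2 r r0.
  have -> : (r ^+ 2 - 1) * m = (r - 1) * ((r + 1) * m) by ring.
  have -> : 2 * s ^+ 2 * r ^+ 2 * (r - 1) = (r - 1) * (2 * s ^+ 2 * r ^+ 2) by ring.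
  rewrite ler_pM2l ?subr_gt0// => h.
  have h2 : 2 * m <= (r + 1) * m by rewrite ler_wpM2r//; lra.
  have : 2 * m <= 2 * s ^+ 2 * r ^+ 2 by exact: le_trans h2 h.
  lra.
apply: ler_scale_sqr => // r r1; have r0 : 0 < r by lra.
have ri0 : 0 < r^-1 by rewrite invr_gt0.
have ri1 : r^-1 < 1 by rewrite invf_lt1.
have := key2 r^-1 ri0.
set q := r^-1 in ri0 ri1 *.
have rE : r = q^-1 by rewrite invrK.
have -> : (q ^+ 2 - 1) * m = - (1 - q) * ((q + 1) * m) by ring.
have -> : 2 * s ^+ 2 * q ^+ 2 * (q - 1) = - (1 - q) * (2 * s ^+ 2 * q ^+ 2) by ring.
rewrite !mulNr lerN2 ler_pM2l ?subr_gt0// => h.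
rewrite rE exprVn ler_pdivlMr ?exprn_gt0//.
have : (q + 1) * m <= 2 * m by rewrite ler_wpM2r//; lra.
lra.
Qed.

(** Same method with [1 + y + y ^ 2 / 2 <= expR y] for [y = u X ^ 2 >= 0]. Once the second moment is
    inserted, a factor [(r - 1) ^ 2] cancels and [2 r + 1] remains; it tends to 3. *)
Lemma gaussian_mean_quartic : mean P (fun w => X w ^+ 4) <= 3 * s ^+ 4.
Proof.
have aX2 := all_momentsX 2 gaussian_all_moments.
have aX4 := all_momentsX 4 gaussian_all_moments.
set m := mean _ _.
apply: ler_scale_sqr; last by rewrite mulr_ge0// exprn_ge0// ltW.
move=> r r1; have r0 : 0 < r by lra.
pose u := (1 - r ^- 2) / (2 * s ^+ 2).
have r2_1 : 1 < r ^+ 2 by rewrite expr_gt1//; lra.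
have u0 : 0 < u.
  by rewrite divr_gt0 ?mulr_gt0 ?exprn_gt0// subr_gt0 invf_lt1 ?exprn_gt0.
have : 1 + u * s ^+ 2 + u ^+ 2 / 2 * m <= r.
  rewrite -gaussian_mean_sqr -{1}[1](@mean_cst _ _ _ P) -!meanZ// -!meanD; [|by do ?[exact: all_moments_cst|exact: all_momentsZ|apply: all_momentsD]..].
  apply: mean_lt => //.
    by do ?[exact: all_moments_cst|exact: all_momentsZ|apply: all_momentsD].
  move=> w /=; apply: le_trans (expR_ge1Dxn2 _); last by rewrite mulr_ge0 ?sqr_ge0// ltW.
  by rewrite lerD2l /= -/u; lra.
have s20 : 0 < s ^+ 2 by rewrite exprn_gt0.
have -> : u * s ^+ 2 = (r ^+ 2 - 1) / (2 * r ^+ 2).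
  by rewrite /u; field; rewrite !gt_eqF.
have -> : u ^+ 2 / 2 * m = (r - 1) ^+ 2 / (2 * r ^+ 2) * ((r + 1) ^+ 2 * m / (4 * s ^+ 4 * r ^+ 2)).
  by rewrite /u; field; rewrite !gt_eqF.
rewrite -subr_ge0 (_ : r - _ = (r - 1) ^+ 2 / (2 * r ^+ 2) * ((2 * r + 1) - (r + 1) ^+ 2 * m / (4 * s ^+ 4 * r ^+ 2))); last first.
  by field; rewrite !gt_eqF.
rewrite pmulr_rge0 ?divr_gt0 ?mulr_gt0 ?exprn_gt0 ?subr_gt0//.
rewrite subr_ge0 ler_pdivrMr ?mulr_gt0 ?exprn_gt0// => h.
have r11 : 0 < (r + 1) ^+ 2 by rewrite exprn_gt0//; lra.
rewrite -(ler_pM2l r11); apply: (le_trans h).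
rewrite [leLHS](_ : _ = (4 * (2 * r + 1)) * (s ^+ 4 * r ^+ 2)); last by ring.
rewrite [leRHS](_ : _ = (3 * (r + 1) ^+ 2) * (s ^+ 4 * r ^+ 2)); last by ring.
rewrite ler_wpM2r ?mulr_ge0 ?exprn_ge0 ?(ltW s0) ?(ltW r0)//.
nra.
Qed.

End gaussian_moments.

(** * Increments of Brownian motion *)

Section normal_symmetry.
Context {R : realType}.

Lemma normal_prob_sym (s : R) (C : set R) : s != 0 -> measurable C ->
  normal_prob 0 s (-%R @^-1` C) = normal_prob 0 s C.
Proof.
move=> s0 mC; rewrite /normal_prob.
pose f (x : R) := (normal_pdf 0 s x)%:E.
transitivity (\int[lebesgue_measure]_(x in (-%R : R -> measurableTypeR R) @^-1` C)
    ((f \o (-%R : R -> measurableTypeR R)) x))%E.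
  apply: eq_integral => x _; rewrite /f /=.
  by rewrite !normal_pdfE// /normal_fun !subr0 sqrrN.
rewrite -ge0_integral_pushforward//=.
- by apply: eq_measure_integral => //= A mA _; exact: lebesgue_measureN.
- by apply: measurable_funTS; apply/measurable_EFinP; exact: measurable_normal_pdf.
- by move=> x _; rewrite lee_fin normal_pdf_ge0.
Qed.

End normal_symmetry.

Section tuple_boxes.
Context {R : realType} {n : nat}.

Definition box_system : set_system (n.-tuple R) :=
  [set A | exists2 C : 'I_n -> set R, (forall i, measurable (C i)) &
    A = [set v | forall i, C i (tnth v i)]].

Lemma box_measurable : box_system `<=` measurable.
Proof.
move=> _ [C mC ->].
rewrite (_ : [set v | _] = \bigcap_(i in [set: 'I_n]) ((@tnth _ R ^~ i) @^-1` C i)).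
  apply: fin_bigcap_measurable => // i _.
  by rewrite -[_ @^-1` _]setTI; exact: measurable_tnth.
by apply/seteqP; split => [v vC i _|v vC i]; exact: vC.
Qed.

Lemma setI_closed_box : setI_closed box_system.
Proof.
move=> _ _ [C mC ->] [D mD ->]; exists (fun i => C i `&` D i).
  by move=> i; exact: measurableI.
apply/seteqP; split => [v [vC vD] i //|v vCD].
by split=> i; have [] := vCD i.
Qed.

Lemma measurable_tuple_box : (@measurable _ (n.-tuple R)) = <<s box_system >>.
Proof.
apply/seteqP; split; last first.
  by apply: smallest_sub; [exact: sigma_algebra_measurable|exact: box_measurable].
apply: smallest_sub; first exact: smallest_sigma_algebra.
rewrite -bigcup_seq => A [i _ [C mC <-]].
apply: sub_sigma_algebra; exists (fun j => if j == i then C else setT).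
  by move=> j; case: ifP.
apply/seteqP; split => [v [_ vC] j|v vC].
  by case: ifP => // /eqP ->.
by split=> //; have := vC i; rewrite eqxx.
Qed.

End tuple_boxes.

Section brownian_increments.
Context {R : realType} {d : measure_display} {T : measurableType d}.
Variables (P : probability T R) (n : nat) (B : R -> T -> 'rV[R]_n).
Hypothesis bm : brownian_motion P B.

Lemma past_events_measurable (t : R) : t <= 1 -> past_events B t `<=` measurable.
Proof.
move=> t1 A [s]; rewrite /= in_itv/= => /andP[s0 st] [i _ [C mC <-]].
apply: (bm_measurable bm) => //.
by rewrite s0 (le_trans st).
Qed.

Lemma past_sigma_measurable (t : R) : t <= 1 -> <<s past_events B t >> `<=` measurable.
Proof.
move=> t1; apply: smallest_sub; first exact: sigma_algebra_measurable.
exact: past_events_measurable.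
Qed.

Lemma filtration_measurable (t : R) : t <= 1 ->
  <<s filtration_gen P B t >> `<=` measurable.
Proof.
move=> t1; apply: smallest_sub; first exact: sigma_algebra_measurable.
by move=> A [|[]//]; exact: past_events_measurable.
Qed.

Lemma filtration_gen_mono (s t : R) : s <= t ->
  filtration_gen P B s `<=` filtration_gen P B t.
Proof.
move=> st; apply: setSU => A [u]; rewrite /= in_itv/= => /andP[u0 us] uA.
by exists u => //=; rewrite in_itv/= u0 (le_trans us).
Qed.

Lemma G_measurable_mono (G1 G2 : set_system T) (X : T -> R) : G1 `<=` G2 ->
  G_measurable G1 X -> G_measurable G2 X.
Proof.
move=> G12 mX _ A mA; have := mX measurableT A mA.
exact: sub_sigma_algebra2.
Qed.

Lemma adapted_le (s t : R) (X : T -> R) : s <= t ->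
  G_measurable (filtration_gen P B s) X -> G_measurable (filtration_gen P B t) X.
Proof. by move=> st; apply: G_measurable_mono; exact: filtration_gen_mono. Qed.

Lemma brownian_adapted (u t : R) (i : 'I_n) : 0 <= u -> u <= t ->
  G_measurable (filtration_gen P B t) (fun w => B u w ord0 i).
Proof.
move=> u0 ut _ A mA; apply: sub_sigma_algebra; left.
by exists u => /=; [rewrite in_itv/= u0|exists i => //; exists A].
Qed.

Definition incr (s t : R) (i : 'I_n) (w : T) : R := B t w ord0 i - B s w ord0 i.

Lemma incrE (s t : R) (i : 'I_n) (w : T) :
  incr s t i w = B t w ord0 i - B s w ord0 i.
Proof. by []. Qed.

Definition incr_events (s t : R) : set_system T :=
  rv_events (fun w => B t w - B s w).

Lemma incr_adapted (s t u : R) (i : 'I_n) : 0 <= s -> 0 <= t -> s <= u -> t <= u ->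
  G_measurable (filtration_gen P B u) (incr s t i).
Proof.
move=> s0 t0 su tu.
exact: measurable_funB (brownian_adapted _ t0 tu) (brownian_adapted _ s0 su).
Qed.

Lemma incr_G_measurable (s t : R) (i : 'I_n) :
  G_measurable (incr_events s t) (incr s t i).
Proof.
move=> _ A mA; apply: sub_sigma_algebra.
exists i => //; exists A => //; rewrite !setTI.
by apply/seteqP; split => w; rewrite /preimage/= /incr !mxE.
Qed.

Lemma incr_measurable (s t : R) (i : 'I_n) : 0 <= s <= 1 -> 0 <= t <= 1 ->
  measurable_fun setT (incr s t i).
Proof.
by move=> s01 t01; apply: measurable_funB; exact: (bm_measurable bm).
Qed.

Lemma incr_events_measurable (s t : R) : 0 <= s <= 1 -> 0 <= t <= 1 ->
  <<s incr_events s t >> `<=` measurable.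
Proof.
move=> s01 t01; apply: smallest_sub; first exact: sigma_algebra_measurable.
move=> _ [i _ [A mA <-]].
have := incr_measurable i s01 t01 measurableT mA.
by congr measurable; apply/seteqP; split => w; rewrite /preimage/= /incr !mxE.
Qed.

(** Brownian motion is assumed independent of its raw past only. Adding null sets is harmless
    because the finite measures [A |-> P (A & C)] and [P C * P] agree on a pi-system generating the
    completed filtration. *)
Lemma incr_indep (s t : R) : 0 <= s -> s < t -> t <= 1 ->
  forall A C, <<s filtration_gen P B s >> A -> <<s incr_events s t >> C ->
    P (A `&` C) = (P A * P C)%E.
Proof.
move=> s0 st t1 A C mA mC.
have s01 : 0 <= s <= 1 by rewrite s0/= (le_trans (ltW st)).
have t01 : 0 <= t <= 1 by rewrite t1 (le_trans s0 (ltW st)).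
have MC : measurable C by exact: (incr_events_measurable s01 t01).
(* A conull [N], for instance [setT], accounts for the past events, and a null [N] for the added
   null sets. Being null or conull survives intersection. *)
pose G : set_system T := [set A | exists2 E, <<s past_events B s >> E &
  exists N, [/\ measurable N, A = E `&` N & P N = 0 \/ P (~` N) = 0]%E].
have nullI X Y : measurable X -> measurable Y -> P X = 0%E -> P (X `&` Y) = 0%E.
  by move=> mX mY X0; apply: (subset_measure0 _ mX) => //; exact: measurableI.
have GI : setI_closed G.
  move=> _ _ [E mE [N [mN -> N01]]] [F mF [M [mM -> M01]]].
  exists (E `&` F).
    by apply: (@measurableI _ (g_sigma_algebraType (past_events B s))).
  exists (N `&` M); split; [exact: measurableI|by rewrite setIACA|].
  case: N01 => N0; first by left; exact: nullI.
  case: M01 => M0; first by left; rewrite setIC; exact: nullI.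
  by right; rewrite setCI measureU0//; exact: measurableC.
have Gm : G `<=` measurable.
  move=> _ [E mE [N [mN -> _]]]; apply: measurableI => //.
  by apply: (past_sigma_measurable _ mE); exact: (andP s01).2.
have sG : <<s filtration_gen P B s >> `<=` <<s G >>.
  apply: sub_sigma_algebra2 => X [pX|[mX X0]].
    exists X; first exact: sub_sigma_algebra.
    by exists setT; split => //; [rewrite setIT|right; rewrite setCT measure0].
  exists setT; first exact: (@measurableT _ (g_sigma_algebraType (past_events B s))).
  by exists X; split => //; [rewrite setTI|left].
have PC0 : 0 <= fine (P C) by rewrite fine_ge0.
pose m1 := mrestr P MC; pose m2 := mscale (NngNum PC0) P.
have PCE : (fine (P C))%:E = P C by rewrite fineK// fin_num_measure.
have m12 X : G X -> m1 X = m2 X.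
  move=> [E mE [N [mN -> N01]]].
  have mE' := past_sigma_measurable (andP s01).2 mE.
  rewrite /m1 /m2 /mrestr /mscale/= PCE muleC.
  case: N01 => N0.
    rewrite (setIC E) [X in (X * _)%E]nullI// mul0e -setIA nullI//.
    exact: measurableI.
  have PN (X' : set T) : measurable X' -> P (X' `&` N) = P X'.
    move=> mX'; have : P (X' `&` ~` N) = 0%E by rewrite setIC nullI//; exact: measurableC.
    move=> h; transitivity (P (X' `\` N) + P (X' `&` N))%E.
      by rewrite setDE h add0e.
    exact/esym/(measureDI P mX' mN).
  rewrite PN// setIAC PN; first exact: (bm_independent bm s0 st t1 mE mC).
  exact: measurableI.
have m1oo (k : nat) : (m1 setT < +oo)%E.
  by rewrite /m1 /mrestr setTI -ge0_fin_numE// fin_num_measure.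
have GT : G setT.
  exists setT; first exact: (@measurableT _ (g_sigma_algebraType (past_events B s))).
  by exists setT; split => //; [rewrite setTI|right; rewrite setCT measure0].
have cov : \bigcup_(_ in [set: nat]) [set: T] = setT by rewrite bigcup_const.
have e : P (A `&` C) = ((fine (P C))%:E * P A)%E := @g_sigma_algebra_measure_unique _ R T G Gm (fun=> setT) (fun=> GT) cov m1 m2 GI m12 m1oo A (sG _ mA).
by rewrite e PCE muleC.
Qed.

Lemma incr_law (s t : R) (i : 'I_n) : 0 <= s -> s < t -> t <= 1 ->
  forall C, measurable C ->
  P (incr s t i @^-1` C) = normal_prob 0 (Num.sqrt (t - s)) C.
Proof.
move=> s0 st t1 C mC.
have := bm_gaussian bm s0 st t1 (C := fun j => if j == i then C else setT).
rewrite (bigD1 i)//= eqxx big1 ?mule1; last first.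
  by move=> j /negbTE ->; exact: probability_setT.
move=> <-; last by move=> j; case: ifP.
congr (P _); apply/seteqP; split => w; rewrite /preimage /incr/=.
  by move=> wC j; case: ifP => // /eqP ->.
by move=> /(_ i); rewrite eqxx.
Qed.

Lemma sqrt_subr_gt0 (s t : R) : s < t -> 0 < Num.sqrt (t - s).
Proof. by move=> st; rewrite sqrtr_gt0 subr_gt0. Qed.

Section one_increment.
Variables (s t : R).
Hypotheses (s0 : 0 <= s) (st : s < t) (t1 : t <= 1).

Let s01 : 0 <= s <= 1. Proof. by rewrite s0/= (le_trans (ltW st)). Qed.
Let t01 : 0 <= t <= 1. Proof. by rewrite t1 (le_trans s0 (ltW st)). Qed.

Lemma incr_all_moments (i : 'I_n) : all_moments P (incr s t i).
Proof.
apply: (gaussian_all_moments (sqrt_subr_gt0 st)); first exact: incr_measurable.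
by move=> C mC; exact: incr_law.
Qed.

Lemma incr_mean_sqr (i : 'I_n) : mean P (fun w => incr s t i w ^+ 2) = t - s.
Proof.
rewrite (gaussian_mean_sqr (sqrt_subr_gt0 st)).
- by rewrite sqr_sqrtr// subr_ge0 ltW.
- exact: incr_measurable.
- by move=> C mC; exact: incr_law.
Qed.

Lemma incr_mean_quartic (i : 'I_n) :
  mean P (fun w => incr s t i w ^+ 4) <= 3 * (t - s) ^+ 2.
Proof.
apply: le_trans (gaussian_mean_quartic (sqrt_subr_gt0 st) _ _) _.
- exact: incr_measurable.
- by move=> C mC; exact: incr_law.
- by rewrite (exprM _ 2 2) sqr_sqrtr// subr_ge0 ltW.
Qed.

Definition signed_incr (e : 'I_n -> bool) (w : T) : n.-tuple R :=
  [tuple (-1) ^+ e i * incr s t i w | i < n].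

Lemma measurable_signed_incr e : measurable_fun setT (signed_incr e).
Proof.
apply/measurable_fun_tnthP => i.
rewrite (_ : _ \o _ = fun w => (-1) ^+ e i * incr s t i w); last first.
  by apply/funext => w; rewrite /= tnth_mktuple.
by apply: measurable_funM => //; exact: incr_measurable.
Qed.

(** On boxes the law of an increment is a product of symmetric normal laws, so flipping the sign of
    any set of coordinates preserves it. First and mixed moments, and the exponential bound, all
    follow from this symmetry. *)
Lemma integral_signed_incr (e : 'I_n -> bool) (g : n.-tuple R -> \bar R) :
  measurable_fun setT g -> (forall v, 0 <= g v)%E ->
  (\int[P]_w g (signed_incr e w) = \int[P]_w g (signed_incr xpred0 w))%E.
Proof.
move=> mg g0.
pose X e' : {mfun T >-> n.-tuple R} :=
  HB.pack (signed_incr e') (isMeasurableFun.Build _ _ _ _ _ (measurable_signed_incr e')).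
rewrite -(ge0_integral_distribution (X e))// -(ge0_integral_distribution (X xpred0))//.
apply: eq_measure_integral => A mA _.
apply: (measure_unique box_system (fun=> setT)) => //.
- exact: measurable_tuple_box.
- exact: setI_closed_box.
- by move=> _; exists (fun=> setT) => //; apply/seteqP; split.
- by rewrite bigcup_const.
- move=> _ [C mC ->]; rewrite /distribution/= /pushforward.
  transitivity (\prod_(i < n) normal_prob 0 (Num.sqrt (t - s)) (C i))%E; last first.
    rewrite -(bm_gaussian bm s0 st t1 mC); congr (P _).
    apply/seteqP; split => w /= h i; have := h i;
      by rewrite tnth_mktuple expr0 mul1r.
  transitivity (\prod_(i < n) normal_prob 0 (Num.sqrt (t - s))
      (if e i then -%R @^-1` C i else C i))%E.
    rewrite -(bm_gaussian bm s0 st t1); last first.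
      move=> i; case: (e i) => //.
      rewrite -[X in measurable X]setTI.
      by apply: (continuous_measurable_fun _ measurableT) => //; exact: opp_continuous.
    congr (P _); apply/seteqP; split => w /= h i; have := h i;
      rewrite tnth_mktuple; case: (e i); rewrite ?expr1 ?expr0 ?mul1r ?mulN1r//=.
  apply: eq_bigr => i _; case: (e i) => //.
  by rewrite normal_prob_sym// gt_eqF// sqrt_subr_gt0.
- by move=> k; rewrite -ge0_fin_numE// fin_num_measure.
Qed.

(** Sign symmetry is available for nonnegative functions, so it is applied to [(1 + Y) ^ 2]:
    changing the sign of [Y] changes the sign of the linear term only. *)
Lemma incr_mean (i : 'I_n) : mean P (incr s t i) = 0.
Proof.
have aY := incr_all_moments i.
have aN := all_momentsZ (-1) aY.
pose g (v : n.-tuple R) := ((1 + tnth v i) ^+ 2)%:E.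
have /= := @integral_signed_incr xpredT g.
rewrite /g; under eq_integral do rewrite tnth_mktuple expr1.
under [X in _ -> _ -> _ = X]eq_integral do rewrite tnth_mktuple expr0 mul1r.
have aD (Z : T -> R) : all_moments P Z -> all_moments P (fun w => (1 + Z w) ^+ 2).
  by move=> aZ; apply: (all_momentsX 2); apply: all_momentsD => //; exact: all_moments_cst.
have mE (Z : T -> R) : all_moments P Z -> mean P (fun w => (1 + Z w) ^+ 2) = 1 + 2 * mean P Z + mean P (fun w => Z w ^+ 2).
  move=> aZ; have aZ2 := all_momentsX 2 aZ.
  rewrite -[X in X + _ + _](@mean_cst _ _ _ P) -meanZ// -!meanD//.
  - by congr mean; apply/funext => w /=; ring.
  - by apply: all_momentsD; [exact: all_moments_cst|exact: all_momentsZ].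
  - exact: all_moments_cst.
  - exact: all_momentsZ.
rewrite !integral_mean; [|exact: aD..].
rewrite !mE// meanZ//.
have -> : mean P (fun w => (-1 * incr s t i w) ^+ 2) = mean P (fun w => incr s t i w ^+ 2).
  by congr mean; apply/funext => w; ring.
move=> h; suff : ((1 + 2 * (-1 * mean P (incr s t i)) + mean P (fun w => incr s t i w ^+ 2))%:E = (1 + 2 * mean P (incr s t i) + mean P (fun w => incr s t i w ^+ 2))%:E)%E.
  by move=> [h']; lra.
apply: h => //; last by move=> v; rewrite lee_fin sqr_ge0.
by apply/measurable_EFinP; apply: measurable_funX; apply: measurable_funD => //; exact: measurable_tnth.
Qed.

(** Flipping coordinate [i] alone in [(Y_i + Y_j) ^ 2] changes the sign of the cross term. *)
Lemma incr_mean_prod (i j : 'I_n) : i != j ->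
  mean P (fun w => incr s t i w * incr s t j w) = 0.
Proof.
move=> ij.
have aI := incr_all_moments i; have aJ := incr_all_moments j.
pose g (v : n.-tuple R) := ((tnth v i + tnth v j) ^+ 2)%:E.
have /= := @integral_signed_incr (pred1 i) g.
rewrite /g; under eq_integral do rewrite !tnth_mktuple/= eqxx eq_sym (negbTE ij) expr1 expr0 mul1r.
under [X in _ -> _ -> _ = X]eq_integral do rewrite !tnth_mktuple !expr0 !mul1r.
have aIJ := all_momentsM aI aJ.
have aI2 := all_momentsX 2 aI; have aJ2 := all_momentsX 2 aJ.
have mE (c : R) : c ^+ 2 = 1 -> (\int[P]_w ((c * incr s t i w + incr s t j w) ^+ 2)%:E =
   (mean P (fun w => incr s t i w ^+ 2) + 2 * c * mean P (fun w => incr s t i w * incr s t j w) + mean P (fun w => incr s t j w ^+ 2))%:E)%E.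
  move=> c2; rewrite integral_mean; last first.
    by apply: (all_momentsX 2); apply: all_momentsD => //; exact: all_momentsZ.
  have aZ := all_momentsZ (2 * c) aIJ.
  rewrite -(meanZ (2 * c) aIJ) -(meanD aI2 aZ) -(meanD (all_momentsD aI2 aZ) aJ2).
  congr (mean _ _)%:E; apply/funext => w; rewrite sqrrD exprMn c2; ring.
move=> h; have : (\int[P]_w ((-1 * incr s t i w + incr s t j w) ^+ 2)%:E =
   \int[P]_w ((1 * incr s t i w + incr s t j w) ^+ 2)%:E)%E.
  rewrite h//.
  - by apply: eq_integral => w _; rewrite mul1r.
  - by apply/measurable_EFinP; apply: measurable_funX; apply: measurable_funD => //; exact: measurable_tnth.
  - by move=> v; rewrite lee_fin sqr_ge0.
rewrite !mE ?expr1n ?sqrrN ?expr1n// => -[h']; lra.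
Qed.

Lemma incr_mean_mul (i j : 'I_n) :
  mean P (fun w => incr s t i w * incr s t j w) = (t - s) *+ (i == j).
Proof.
case: eqVneq => [->|ij]; last by rewrite incr_mean_prod.
by rewrite mulr1n -(incr_mean_sqr j); congr mean; apply/funext => w; rewrite expr2.
Qed.

Lemma mean_past_incr (X Y : T -> R) :
  G_measurable (filtration_gen P B s) X -> G_measurable (incr_events s t) Y ->
  all_moments P X -> all_moments P Y ->
  mean P (fun w => X w * Y w) = mean P X * mean P Y.
Proof.
apply: (@mean_indep _ _ _ _ (filtration_gen P B s) (incr_events s t)).
- by apply: filtration_measurable; exact: (andP s01).2.
- exact: incr_events_measurable.
- exact: incr_indep.
Qed.

(* By symmetry of the increment, only [cosh] of the exponent survives and
   [cosh y <= expR (y ^ 2 / 2)]. *)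
Lemma exp_incr_le1 (x : 'I_n -> R) :
  (\int[P]_w (expR (\sum_i x i * incr s t i w
     - (\sum_i x i * incr s t i w) ^+ 2 / 2))%:E <= 1)%E.
Proof.
pose L (v : n.-tuple R) := \sum_i x i * tnth v i.
pose g v := (expR (L v - L v ^+ 2 / 2))%:E.
have mL : measurable_fun setT L.
  by apply: measurable_sum => i; apply: measurable_funM => //; exact: measurable_tnth.
have mg : measurable_fun setT g.
  by apply/measurable_EFinP; apply: measurableT_comp => //; apply: measurable_funB => //; apply: measurable_funM => //; exact: measurable_funX.
have g0 v : (0 <= g v)%E by rewrite lee_fin expR_ge0.
have LE w : L (signed_incr xpred0 w) = \sum_i x i * incr s t i w.
  by apply: eq_bigr => i _; rewrite tnth_mktuple expr0 mul1r.
have LN w : L (signed_incr xpredT w) = - L (signed_incr xpred0 w).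
  by rewrite -sumrN; apply: eq_bigr => i _; rewrite !tnth_mktuple expr0 expr1 mul1r mulN1r mulrN.
have -> : (\int[P]_w (expR (\sum_i x i * incr s t i w
     - (\sum_i x i * incr s t i w) ^+ 2 / 2))%:E = \int[P]_w g (signed_incr xpred0 w))%E.
  by apply: eq_integral => w _; rewrite /g LE.
have m0 := measurableT_comp mg (measurable_signed_incr xpred0).
have mT := measurableT_comp mg (measurable_signed_incr xpredT).
have : (\int[P]_w g (signed_incr xpred0 w) + \int[P]_w g (signed_incr xpred0 w) <= 2%:E)%E.
  rewrite -{1}(integral_signed_incr xpredT)// -ge0_integralD//.
  apply: (@le_trans _ _ (\int[P]_w (cst 2%:E w))%E); last first.
    by rewrite integral_cst//= probability_setT mule1.
  apply: ge0_le_integral => //.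
  - by move=> w _; rewrite adde_ge0.
  - exact: emeasurable_funD.
  - move=> w _; rewrite /g LN -EFinD lee_fin sqrrN.
    set y := L _; rewrite !expRD -mulrDl (expRN (y ^+ 2 / 2)) ler_pdivrMr ?expR_gt0//.
    by have := cosh_le_expR y; rewrite addrC expRN.
set I := (\int[P]_w _)%E => h.
have I0 : (0 <= I)%E by exact: integral_ge0.
case: I I0 h => [r||] //=; rewrite -?EFinD ?lee_fin; lra.
Qed.

End one_increment.

End brownian_increments.

(** * Ito isometry for elementary integrands *)

Section interval_overlap.
Context {R : realType}.

(** Length of the intersection of []a, b]] and []c, e]]. *)
Definition overlap (a b c e : R) : R :=
  Num.max 0 (Num.min b e - Num.max a c).

Lemma overlapC (a b c e : R) : overlap a b c e = overlap c e a b.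
Proof. by rewrite /overlap minC (maxC a). Qed.

Lemma itvI_oc (a b c e : R) :
  `]a, b] `&` `]c, e] = `]Num.max a c, Num.min b e]%classic :> set R.
Proof.
apply/seteqP; split => s /=; rewrite !in_itv/= gt_max le_min.
  by move=> [/andP[-> ->] /andP[-> ->]].
by move=> /andP[/andP[-> ->] /andP[-> ->]].
Qed.

Lemma integral_overlap (t a b c e : R) : 0 <= a -> b <= t ->
  (\int[lebesgue_measure]_(s in `[0%R, t])
     (\1_(`]a, b]%classic `&` `]c, e]%classic) s)%:E = (overlap a b c e)%:E)%E.
Proof.
move=> a0 bt; rewrite integral_indic//; last exact: measurableI.
rewrite setIidl; last first.
  move=> s [/=]; rewrite !in_itv/= => /andP[asx sb] _.
  by rewrite (le_trans a0 (ltW asx)) (le_trans sb).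
rewrite itvI_oc; apply: etrans (lebesgue_measure_itv _) _.
rewrite /= lte_fin /overlap.
case: ifPn => [h|].
  have h' : 0 <= Num.min b e - Num.max a c by rewrite subr_ge0 ltW.
  by rewrite (max_r h').
rewrite -leNgt -subr_le0 => h; by rewrite (max_l h).
Qed.

End interval_overlap.

Section isometry.
Context {R : realType} {d : measure_display} {T : measurableType d}.
Variables (P : probability T R) (n : nat) (B : R -> T -> 'rV[R]_n).
Hypothesis bm : brownian_motion P B.

Local Notation Fgen := (filtration_gen P B).
Local Notation incr := (incr B).

Lemma mean_adapted_incr (Z : T -> R) (s t : R) (i : 'I_n) : 0 <= s -> s < t -> t <= 1 ->
  G_measurable (Fgen s) Z -> all_moments P Z ->
  mean P (fun w => Z w * incr s t i w) = 0.
Proof.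
move=> s0 st t1 mZ aZ.
rewrite (mean_past_incr bm s0 st t1 mZ (@incr_G_measurable _ _ _ _ B s t i) aZ); last exact: incr_all_moments.
by rewrite (incr_mean bm)// mulr0.
Qed.

Lemma incr_split (s t u : R) (i : 'I_n) (w : T) :
  incr s u i w = incr s t i w + incr t u i w.
Proof. by rewrite !incrE; ring. Qed.

Lemma incr_all_moments_le (s t : R) (i : 'I_n) : 0 <= s -> s <= t -> t <= 1 ->
  all_moments P (incr s t i).
Proof.
move=> s0; rewrite le_eqVlt => /predU1P[<- _|st t1]; last exact: incr_all_moments.
rewrite (_ : incr s s i = cst 0); first exact: all_moments_cst.
by apply/funext => w; rewrite !incrE subrr.
Qed.

Lemma mean_adapted_incr_le (Z : T -> R) (s t : R) (i : 'I_n) : 0 <= s -> s <= t -> t <= 1 ->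
  G_measurable (Fgen s) Z -> all_moments P Z ->
  mean P (fun w => Z w * incr s t i w) = 0.
Proof.
move=> s0; rewrite le_eqVlt => /predU1P[<- _ _ _|st t1]; last exact: mean_adapted_incr.
rewrite -[RHS](@mean_cst _ _ _ P); congr mean.
by apply/funext => w; rewrite !incrE subrr mulr0.
Qed.

(** Split the longer increment at the end of the shorter one: the later part is centered and
    independent of everything before it, so only the common interval contributes. *)
Lemma mean_adapted_incr2 (U : T -> R) (c b e : R) (l m : 'I_n) :
  0 <= c -> c < b -> b <= 1 -> c < e -> e <= 1 ->
  G_measurable (Fgen c) U -> all_moments P U ->
  mean P (fun w => U w * (incr c b l w * incr c e m w)) =
  mean P U * (Num.min b e - c) *+ (l == m).
Proof.
move=> c0.
wlog be : b e l m / b <= e => [wh|] cb b1 ce e1 mU aU.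
  have [be|eb] : b <= e \/ e <= b by apply/orP; exact: le_total.
    exact: wh.
  have := wh e b m l eb ce e1 cb b1 mU aU; rewrite minC eq_sym => <-.
  by congr mean; apply/funext => w; rewrite (mulrC (incr c b l w)).
have b0 : 0 <= b by rewrite (le_trans c0)// ltW.
have al := incr_all_moments bm c0 cb b1 l.
have am := incr_all_moments bm c0 cb b1 m.
have abe := incr_all_moments_le m b0 be e1.
have mUl : G_measurable (Fgen b) (fun w => U w * incr c b l w).
  apply: measurable_funM; first exact: (adapted_le (ltW cb) mU).
  by apply: incr_adapted => //; exact: ltW.
transitivity (mean P (fun w => U w * (incr c b l w * incr c b m w) +
    (U w * incr c b l w) * incr b e m w)).
  by congr mean; apply/funext => w; rewrite (incr_split c b e); ring.
rewrite meanD; last 2 first.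
- by apply: all_momentsM => //; exact: all_momentsM.
- by apply: all_momentsM => //; exact: all_momentsM.
rewrite mean_adapted_incr_le//; last exact: all_momentsM.
rewrite addr0 (mean_past_incr bm c0 cb b1)//; last 2 first.
- by apply: measurable_funM; exact: incr_G_measurable.
- exact: all_momentsM.
by rewrite (incr_mean_mul bm)// min_l// mulrnAr.
Qed.

(** Two pieces taken from unrelated partitions may overlap in any way. With [a <= c], either
    [b <= c] and conditioning at [c] gives 0, or the first increment is split at [c]: its part
    before [c] contributes nothing and the rest starts at the same time as the second increment. *)
Lemma mean_pieces (X Y : T -> R) (a b c e : R) (l m : 'I_n) :
  0 <= a -> a < b -> b <= 1 -> 0 <= c -> c < e -> e <= 1 ->
  G_measurable (Fgen a) X -> all_moments P X ->
  G_measurable (Fgen c) Y -> all_moments P Y ->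
  mean P (fun w => (X w * incr a b l w) * (Y w * incr c e m w)) =
  mean P (fun w => X w * Y w) * overlap a b c e *+ (l == m).
Proof.
wlog ac : a b c e X Y l m / a <= c => [wh|].
  have [/wh|/ltW /wh] := leP a c; first exact.
  move=> h a0 ab b1 c0 ce e1 mX aX mY aY.
  have := h e b Y X m l c0 ce e1 a0 ab b1 mY aY mX aX.
  rewrite overlapC eq_sym (_ : (fun w => Y w * X w) = (fun w => X w * Y w)); last first.
    by apply/funext => w; rewrite mulrC.
  by move=> <-; congr mean; apply/funext => w; rewrite mulrC.
move=> a0 ab b1 c0 ce e1 mX aX mY aY.
have mXc := adapted_le ac mX.
have aab := incr_all_moments bm a0 ab b1 l.
have ace := incr_all_moments bm c0 ce e1 m.
have [bc|cb] := leP b c.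
  rewrite /overlap max_l; last first.
    by rewrite subr_le0 ge_min le_max bc orbT.
  rewrite mulr0 mul0rn.
  rewrite (_ : (fun w => _) = fun w => (X w * incr a b l w * Y w) * incr c e m w); last first.
    by apply/funext => w; ring.
  rewrite mean_adapted_incr//; last by do 2 apply: all_momentsM => //.
  apply: measurable_funM => //; apply: measurable_funM => //.
  by apply: incr_adapted => //; exact: (ltW (le_lt_trans a0 ab)).
have aac := incr_all_moments_le l a0 ac (ltW (lt_le_trans cb b1)).
have acb := incr_all_moments bm c0 cb b1 l.
transitivity (mean P (fun w => (X w * incr a c l w * Y w) * incr c e m w +
   (X w * Y w) * (incr c b l w * incr c e m w))).
  by congr mean; apply/funext => w; rewrite (incr_split a c b); ring.
rewrite meanD; last 2 first.
- by do 3 apply: all_momentsM => //.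
- by do 2 apply: all_momentsM => //.
rewrite mean_adapted_incr//; last 2 first.
- apply: measurable_funM => //; apply: measurable_funM => //.
  exact: incr_adapted.
- by do 2 apply: all_momentsM => //.
rewrite add0r mean_adapted_incr2//; last 2 first.
- exact: measurable_funM.
- exact: all_momentsM.
rewrite /overlap (max_r ac) max_r// subr_ge0 le_min (ltW cb)/=; exact: ltW.
Qed.

Section elementary.
Variables (I : finType) (a b : I -> R) (X : I -> T -> 'rV[R]_n).

(** The index set is any finite type and the intervals may overlap, so sums and differences of
    integrals over different partitions keep this form and no common refinement is ever built. *)
Definition elem_int (w : T) : R := \sum_i dotv (X i w) (B (b i) w - B (a i) w).

Definition elem_eval (s : R) (w : T) : 'rV[R]_n :=
  \sum_(i | a i < s <= b i) X i w.

Definition elem_energy (w : T) : R :=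
  \sum_(p : I * I) overlap (a p.1) (b p.1) (a p.2) (b p.2) *
    dotv (X p.1 w) (X p.2 w).

Lemma sqnorm_elem_eval (s : R) (w : T) : sqnormv (elem_eval s w) =
  \sum_(p : I * I) dotv (X p.1 w) (X p.2 w) *
     \1_(`]a p.1, b p.1]%classic `&` `]a p.2, b p.2]%classic) s.
Proof.
rewrite -(pair_big xpredT xpredT (fun i j => dotv (X i w) (X j w) *
     \1_(`]a i, b i]%classic `&` `]a j, b j]%classic) s))/=.
rewrite /sqnormv /dotv.
under [RHS]eq_bigr => i _ do under eq_bigr => j _ do rewrite mulr_suml.
under [RHS]eq_bigr do rewrite exchange_big/=.
rewrite exchange_big/=; apply: eq_bigr => l _.
rewrite /elem_eval !summxE big_mkcond/= mulr_suml; apply: eq_bigr => i _.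
rewrite [in LHS]big_mkcond/= mulr_sumr; apply: eq_bigr => j _.
rewrite indicI/= !indicE !mem_setE/= !in_itv/=.
by do 2 case: ifP => _ /=; ring.
Qed.

Variable t : R.
Hypothesis t1 : t <= 1.
Hypothesis ab : forall i, [/\ 0 <= a i, a i < b i & b i <= t].
Hypothesis mX : forall i l, G_measurable (Fgen (a i)) (fun w => X i w ord0 l).
Hypothesis aX : forall i l, all_moments P (fun w => X i w ord0 l).

Lemma integral_elem_eval (w : T) :
  (\int[lebesgue_measure]_(s in `[0%R, t]) (sqnormv (elem_eval s w))%:E =
   (elem_energy w)%:E)%E.
Proof.
under eq_integral do rewrite sqnorm_elem_eval -sumEFin.
have i1 (p : I * I) : (@lebesgue_measure R : {measure set (measurableTypeR R) -> \bar R}).-integrable `[0, t]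
    (EFin \o \1_(`]a p.1, b p.1]%classic `&` `]a p.2, b p.2]%classic)).
  apply: measurable_bounded_integrable => //.
  - by rewrite /= lebesgue_measure_itv/=; case: ifP => _; rewrite ?ltry// -EFinB ltry.
  - by apply: measurable_indic; exact: measurableI.
  - exists 1; split => // M M1 x _ /=; apply: le_trans (ltW M1).
    by rewrite indicE; case: (_ \in _); rewrite ?normr1 ?normr0.
rewrite integral_sum//; last first.
  move=> p.
  exact: (integrableZl _ (dotv (X p.1 w) (X p.2 w)) (i1 p)).

rewrite /elem_energy -sumEFin; apply: eq_bigr => -[i j] _ /=.
under eq_integral do rewrite EFinM.
rewrite integralZl//; last exact: (i1 (i, j)).
have [ai aib bi] := ab i.
by rewrite integral_overlap// -EFinM mulrC.
Qed.

Lemma elem_int_all_moments : all_moments P elem_int.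
Proof.
apply: all_moments_sum => i _; apply: all_moments_sum => l _.
under eq_fun do rewrite !mxE.
apply: all_momentsM => //.
have [ai aib bi] := ab i.
by apply: (incr_all_moments bm) => //; exact: le_trans t1.
Qed.

Lemma elem_energy_all_moments : all_moments P elem_energy.
Proof.
apply: all_moments_sum => p _; apply: all_momentsZ.
by apply: all_moments_sum => l _; exact: all_momentsM.
Qed.

(** Indexed by pairs (interval, coordinate), the integral is a single sum of scalar pieces. Pieces
    in distinct coordinates are uncorrelated, and those in equal coordinates give the overlaps. *)
Lemma mean_elem_int_sqr : mean P (fun w => elem_int w ^+ 2) = mean P elem_energy.
Proof.
pose Y (q : I * 'I_n) w := X q.1 w ord0 q.2 * incr (a q.1) (b q.1) q.2 w.
have aY q : all_moments P (Y q).
  apply: all_momentsM => //; have [ai aib bi] := ab q.1.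
  by apply: (incr_all_moments bm) => //; exact: le_trans t1.
have IE w : elem_int w = \sum_q Y q w.
  rewrite /elem_int -(pair_big xpredT xpredT (fun i l => Y (i, l) w))/=.
  apply: eq_bigr => i _; apply: eq_bigr => l _.
  by rewrite /Y /= !incrE !mxE.
transitivity (mean P (fun w => \sum_q \sum_r Y q w * Y r w)).
  by congr mean; apply/funext => w; rewrite IE expr2 mulr_suml; apply: eq_bigr => q _; rewrite mulr_sumr.
rewrite mean_sum; last by move=> q _; apply: all_moments_sum => r _; exact: all_momentsM.
rewrite /elem_energy mean_sum; last first.
  move=> p _; apply: all_momentsZ; apply: all_moments_sum => l _.
  exact: all_momentsM.
rewrite -[RHS](pair_big xpredT xpredT (fun i j => mean P (fun w => overlap (a i) (b i) (a j) (b j) * dotv (X i w) (X j w))))/=.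
rewrite -[LHS](pair_big xpredT xpredT (fun i l => mean P (fun w => \sum_r Y (i, l) w * Y r w)))/=.
apply: eq_bigr => i _.
transitivity (\sum_l \sum_j mean P (fun w => X i w ord0 l * X j w ord0 l) * overlap (a i) (b i) (a j) (b j)).
  apply: eq_bigr => l _.
  rewrite mean_sum; last by move=> r _; exact: all_momentsM.
  rewrite -[LHS](pair_big xpredT xpredT (fun j m => mean P (fun w => Y (i, l) w * Y (j, m) w)))/=.
  apply: eq_bigr => j _; rewrite (bigD1 l)//= big1 ?addr0; last first.
    move=> m ml; have [ai aib bi] := ab i; have [aj ajb bj] := ab j.
    rewrite mean_pieces//; [|exact: le_trans t1..].
    by rewrite eq_sym (negbTE ml) mulr0n.
  have [ai aib bi] := ab i; have [aj ajb bj] := ab j.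
  rewrite mean_pieces//; [|exact: le_trans t1..].
  by rewrite eqxx mulr1n.
rewrite exchange_big/=; apply: eq_bigr => j _.
rewrite meanZ; last by apply: all_moments_sum => l _; exact: all_momentsM.
rewrite /dotv mean_sum; last by move=> l _; exact: all_momentsM.
by rewrite [RHS]mulrC mulr_suml.
Qed.

Lemma ito_isometry_elem :
  (\int[P]_w (elem_int w ^+ 2)%:E = \int[P]_w \int[lebesgue_measure]_(s in `[0%R, t])
     (sqnormv (elem_eval s w))%:E)%E.
Proof.
under [RHS]eq_integral do rewrite integral_elem_eval.
rewrite !integral_mean ?mean_elem_int_sqr//.
- exact: elem_energy_all_moments.
- by apply: (all_momentsX 2); exact: elem_int_all_moments.
Qed.

End elementary.

End isometry.

(** * Joint measurability in time and chance, and Tonelli bounds *)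

Section joint_measurability.
Context {R : realType} {d : measure_display} {T : measurableType d}.

(** Projects time onto [[0, b]], so that a process controlled there can be treated as a function on
    the whole product space. *)
Definition clamp (b s : R) : R := Num.max 0 (Num.min s b).

Lemma clamp_itv (b s : R) : 0 <= b -> 0 <= clamp b s <= b.
Proof. by move=> b0; rewrite /clamp le_max lexx/= ge_max b0 ge_min lexx orbT. Qed.

Lemma clamp_id (b s : R) : 0 <= s <= b -> clamp b s = s.
Proof. by move=> /andP[s0 sb]; rewrite /clamp min_l// max_r. Qed.

Lemma measurable_clamp (b : R) : measurable_fun setT (clamp b).
Proof. by apply: measurable_maxr => //; exact: measurable_minr. Qed.

(* Approximate the path by its values at the times [m / (k + 1)]. *)
Lemma measurable_continuous_path (b : R) (F : R -> T -> R) : 0 <= b ->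
  (forall s, 0 <= s <= b -> measurable_fun setT (F s)) ->
  (forall w, {within `[0, b], continuous (fun s => F s w)}) ->
  measurable_fun setT (fun p : measurableTypeR R * T => F (clamp b p.1) p.2).
Proof.
move=> b0 mF cF.
pose r (k : nat) (s : R) : nat := Num.truncn (k.+1%:R * clamp b s).
pose G k (p : measurableTypeR R * T) := F (clamp b ((r k p.1)%:R / k.+1%:R)) p.2.
apply: (@measurable_fun_cvg _ _ _ setT G).
  move=> k _ C mC; rewrite setTI.
  have -> : G k @^-1` C = \bigcup_m ((fun s : R => k.+1%:R * clamp b s) @^-1` `[m%:R, m.+1%:R[
     `*` (F (clamp b (m%:R / k.+1%:R)) @^-1` C)).
    apply/seteqP; split => [[s w] /= GC|[s w] [m _ [/= + FC]]].
      exists (r k s) => //; split => //=.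
      rewrite in_itv/=; apply: truncn_itv.
      by rewrite mulr_ge0//; have /andP[] := clamp_itv s b0.
    rewrite in_itv/= => /andP[h1 h2]; rewrite /G /r /=.
    by rewrite (_ : Num.truncn _ = m)//; apply/eqP; rewrite truncn_eq ?h1 ?h2//; rewrite mulr_ge0//; have /andP[] := clamp_itv s b0.
  apply: bigcupT_measurable => m; apply: measurableX.
    rewrite -[X in measurable X]setTI.
    have : measurable_fun setT (fun s : R => k.+1%:R * clamp b s).
      by apply: measurable_funM => //; exact: measurable_clamp.
    by apply.
  by rewrite -[X in measurable X]setTI; apply: mF => //; exact: clamp_itv.
move=> [s w] _; rewrite /G /=.
have cb := clamp_itv s b0; have /andP[c0 cb'] := cb.
have /subspace_continuousP/(_ (clamp b s)) := cF w.
rewrite /= in_itv/= => /(_ cb) h.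
apply: (cvg_comp _ _ _ h).
move=> A /= [e /= e0 eA]; near=> k; apply: eA => /=; last first.
  by rewrite in_itv/=; exact: clamp_itv.
have k0 : 0 < k.+1%:R :> R by [].
have c0' : 0 <= k.+1%:R * clamp b s by rewrite mulr_ge0.
have /andP[l1 l2] := truncn_itv c0'.
rewrite -/(r k s) in l1 l2.
have l1' : (r k s)%:R / k.+1%:R <= clamp b s by rewrite ler_pdivrMr// mulrC.
rewrite (@clamp_id _ ((r k s)%:R / k.+1%:R)); last first.
  by rewrite divr_ge0//=; exact: le_trans cb'.
rewrite ger0_norm ?subr_ge0// -(ltr_pM2l k0) mulrBr mulrCA divff ?gt_eqF// mulr1.
have l3 : k.+1%:R * clamp b s - (r k s)%:R < 1 by move: l2; rewrite -natr1; lra.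
apply: (lt_trans l3).
rewrite -ltr_pdivrMl// mulr1.
by near: k; exact: (near_infty_natSinv_lt (PosNum e0)).
Unshelve. all: by end_near. Qed.

End joint_measurability.

Section tonelli_bounds.
Context {R : realType} {d : measure_display} {T : measurableType d}.
Variable P : probability T R.
Local Notation leb := (@lebesgue_measure R).

Lemma measurable_integral_section (D : set R) (G : measurableTypeR R * T -> \bar R) :
  measurable D -> measurable_fun setT G -> (forall p, 0 <= G p)%E ->
  measurable_fun setT (fun w => \int[leb]_(s in D) G (s, w))%E.
Proof.
move=> mD mG G0.
pose G' := G \_ (D `*` setT).
have mG' : measurable_fun setT G'.
  by apply/(measurable_restrictT _ _).1; [exact: measurableX|exact: measurable_funTS].
have G'0 p : (0 <= G' p)%E by apply: erestrict_ge0 => q _.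
have := measurable_fun_fubini_tonelli_G (m1 := leb) G' mG' G'0.
congr measurable_fun; apply/funext => w; rewrite /fubini_G [RHS]integral_mkcond.
apply: eq_integral => s _; rewrite /G' !patchE.
by rewrite in_setX in_setT andbT.
Qed.

Lemma integral_section_le (D : set R) (G : measurableTypeR R * T -> \bar R) (e : \bar R) :
  measurable D -> measurable_fun setT G -> (forall p, 0 <= G p)%E -> (0 <= e)%E ->
  (forall s, D s -> \int[P]_w G (s, w) <= e)%E ->
  (\int[P]_w \int[leb]_(s in D) G (s, w) <= e * leb D)%E.
Proof.
move=> mD mG G0 e0 Ge.
pose G' := G \_ (D `*` setT).
have mG' : measurable_fun setT G'.
  by apply/(measurable_restrictT _ _).1; [exact: measurableX|exact: measurable_funTS].
have G'0 p : (0 <= G' p)%E by apply: erestrict_ge0 => q _.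
rewrite (_ : (\int[P]_w _)%E = (\int[P]_w \int[leb]_s G' (s, w))%E); last first.
  apply: eq_integral => w _; rewrite integral_mkcond.
  by apply: eq_integral => s _; rewrite /G' !patchE in_setX in_setT andbT.
rewrite -(fubini_tonelli (m1 := leb) (m2 := P) G')//.
rewrite -integral_cst// [leRHS]integral_mkcond.
apply: ge0_le_integral => //.
- by move=> s _; exact: integral_ge0.
- exact: (measurable_fun_fubini_tonelli_F G').
- apply/(measurable_restrictT _ _).1 => //.
- move=> s _; rewrite patchE; case: ifPn => sD.
    apply: le_trans (Ge s (set_mem sD)).
    rewrite le_eqVlt; apply/orP; left; apply/eqP; apply: eq_integral => w _.
    by rewrite /G' patchE in_setX in_setT sD.
  rewrite integral0_eq// => w _.
  by rewrite /G' patchE in_setX (negbTE sD).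
Qed.

(** The integral of a nonnegative function is a supremum over the simple functions below it, hence
    monotone as such. This matters because time integrals involving [H] itself are not known to be
    measurable in [w]. *)
Lemma ge0_le_integral_nonmeasurable (f g : T -> \bar R) :
  (forall w, 0 <= f w)%E -> (forall w, f w <= g w)%E ->
  (\int[P]_w f w <= \int[P]_w g w)%E.
Proof.
move=> f0 fg; have g0 w : (0 <= g w)%E by exact: le_trans (fg w).
rewrite !ge0_integralTE//; apply: le_ereal_sup => _ [h /= hf <-].
by exists h => //= w; exact: le_trans (fg w).
Qed.

End tonelli_bounds.

Section squared_norm.
Context {R : realType} {n : nat}.
Implicit Types u v : 'rV[R]_n.

Lemma sqnormv_ge0 u : 0 <= sqnormv u.
Proof. by apply: sumr_ge0 => i _; rewrite -expr2 sqr_ge0. Qed.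

Lemma sqr_add3 (x y z : R) :
  (x + y + z) * (x + y + z) <= 3 * (x * x + y * y + z * z).
Proof.
rewrite -subr_ge0 (_ : _ - _ = (x - y) ^+ 2 + (x - z) ^+ 2 + (y - z) ^+ 2); last by ring.
by rewrite !addr_ge0 ?sqr_ge0.
Qed.

Lemma sqr_add2 (x y : R) : (x + y) * (x + y) <= 2 * (x * x + y * y).
Proof.
rewrite -subr_ge0 (_ : _ - _ = (x - y) ^+ 2); last by ring.
exact: sqr_ge0.
Qed.

Lemma sqnormv_add3 u v (x : 'rV[R]_n) : sqnormv (u + v + x) <= 3 * (sqnormv u + sqnormv v + sqnormv x).
Proof.
rewrite /sqnormv /dotv -!big_split/= mulr_sumr; apply: ler_sum => i _.
by rewrite 2!mxE; exact: sqr_add3.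
Qed.

Lemma sqnormvZ (c : R) u : sqnormv (c *: u) = c ^+ 2 * sqnormv u.
Proof.
rewrite /sqnormv /dotv mulr_sumr; apply: eq_bigr => i _.
by rewrite !mxE; ring.
Qed.

Lemma sqnormvN u : sqnormv (- u) = sqnormv u.
Proof. by rewrite -scaleN1r sqnormvZ sqrrN expr1n mul1r. Qed.

Lemma dotvNl u v : dotv (- u) v = - dotv u v.
Proof. by rewrite /dotv -sumrN; apply: eq_bigr => i _; rewrite mxE mulNr. Qed.

Lemma measurable_sqnormv d (S : measurableType d) (V : S -> 'rV[R]_n) :
  (forall i, measurable_fun setT (fun s => V s ord0 i)) ->
  measurable_fun setT (fun s => sqnormv (V s)).
Proof. by move=> mV; apply: measurable_sum => i; exact: measurable_funM. Qed.

End squared_norm.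

Section combine_elementary.
Context {R : realType} {d : measure_display} {T : measurableType d} {n : nat}.
Variables (B : R -> T -> 'rV[R]_n).

Definition sum_case (I J : Type) (S : Type) (f : I -> S) (g : J -> S) (x : I + J) : S :=
  match x with inl i => f i | inr j => g j end.

Lemma elem_int_sum (I J : finType) (a b : I -> R) X (a' b' : J -> R) X' (w : T) :
  elem_int B (sum_case a a') (sum_case b b') (sum_case X X') w =
  elem_int B a b X w + elem_int B a' b' X' w.
Proof. by rewrite /elem_int big_sumType. Qed.

Lemma elem_eval_sum (I J : finType) (a b : I -> R) X (a' b' : J -> R) X' (s : R) (w : T) :
  elem_eval (sum_case a a') (sum_case b b') (sum_case X X') s w =
  elem_eval a b X s w + elem_eval a' b' X' s w :> 'rV[R]_n.
Proof. by rewrite /elem_eval big_sumType. Qed.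

Lemma elem_int_opp (I : finType) (a b : I -> R) X (w : T) :
  elem_int B a b (fun i w => - X i w) w = - elem_int B a b X w.
Proof. by rewrite /elem_int -sumrN; apply: eq_bigr => i _; rewrite dotvNl. Qed.

Lemma elem_eval_opp (I : finType) (a b : I -> R) X (s : R) (w : T) :
  elem_eval a b (fun i w => - X i w) s w = - elem_eval a b X s w :> 'rV[R]_n.
Proof. by rewrite /elem_eval -sumrN. Qed.

Lemma elem_eval_out (I : finType) (a b : I -> R) X (s : R) (w : T) :
  (forall i, ~~ (a i < s <= b i)) -> elem_eval a b X s w = 0 :> 'rV[R]_n.
Proof. by move=> h; rewrite /elem_eval big_pred0// => i; exact/negbTE. Qed.

Lemma measurable_elem_eval (I : finType) (a b : I -> R) (X : I -> T -> 'rV[R]_n) (l : 'I_n) :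
  (forall i, measurable_fun setT (fun w => X i w ord0 l)) ->
  measurable_fun setT (fun p : measurableTypeR R * T => elem_eval a b X p.1 p.2 ord0 l).
Proof.
move=> mX.
rewrite (_ : (fun p => _) = fun p : measurableTypeR R * T =>
    \sum_i \1_(`]a i, b i]%classic) p.1 * X i p.2 ord0 l); last first.
  apply/funext => p; rewrite /elem_eval summxE big_mkcond/=; apply: eq_bigr => i _.
  by rewrite indicE mem_setE/= in_itv/=; case: ifP; rewrite ?mul1r ?mul0r.
apply: measurable_sum => i; apply: measurable_funM.
  apply: (measurableT_comp _ measurable_fst).
  by apply: measurable_indic.
exact: (measurableT_comp (mX i) measurable_snd).
Qed.

End combine_elementary.

(** * Comparing increments of the Ito integral with elementary integrals *)

Section ito_bounds.
Context {R : realType} {d : measure_display} {T : measurableType d}.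
Variables (P : probability T R) (n : nat) (B : R -> T -> 'rV[R]_n).
Hypothesis bm : brownian_motion P B.
Local Notation leb := (@lebesgue_measure R).

Lemma part_pt_bounds (t : R) (s : seq R) (k : nat) : itv_partition 0 t s ->
  (k < size s)%N ->
  [/\ 0 <= part_pt s k, part_pt s k < part_pt s k.+1 & part_pt s k.+1 <= t].
Proof.
move=> pt ks; have ptE j : (j < (size s).+1)%N -> part_pt s j = nth t (0 :: s) j.
  by move=> js; rewrite /part_pt; apply: set_nth_default.
split.
- by rewrite ptE ?(ltn_trans ks)//; apply: (itv_partition_nth_ge _ pt); rewrite ltnS ltnW.
- by have [/pathP - /(_ 0 k ks)] := pt.
- by rewrite ptE//; exact: (itv_partition_nth_le _ pt).
Qed.

Section simple.
Variables (t : R) (phi : simple_integrand P B t).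
Hypothesis t1 : t <= 1.
Let I := 'I_(size (si_part phi)).
Definition si_left (k : I) : R := part_pt (si_part phi) k.
Definition si_right (k : I) : R := part_pt (si_part phi) k.+1.
Definition si_coef (k : I) : T -> 'rV[R]_n := si_val phi k.

Lemma simple_integralE w : simple_integral phi w = elem_int B si_left si_right si_coef w.
Proof. by []. Qed.

Lemma simple_evalE s w : simple_eval phi s w = elem_eval si_left si_right si_coef s w.
Proof. by []. Qed.

Lemma si_bounds k : [/\ 0 <= si_left k, si_left k < si_right k & si_right k <= t].
Proof. exact: (part_pt_bounds (si_partition phi)). Qed.

Lemma si_coef_adapted k l : G_measurable (filtration_gen P B (si_left k)) (fun w => si_coef k w ord0 l).
Proof. exact: (si_measurable (ltn_ord k)). Qed.

Lemma si_coef_measurable k l : measurable_fun setT (fun w => si_coef k w ord0 l).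
Proof.
apply: G_measurable_fun (@si_coef_adapted k l).
apply: (filtration_measurable bm).
by have [_ /ltW h1 h2] := si_bounds k; rewrite (le_trans h1)// (le_trans h2).
Qed.

Lemma si_coef_all_moments k l : all_moments P (fun w => si_coef k w ord0 l).
Proof.
have [c cb] := si_bounded (ltn_ord k).
apply: (@all_moments_bounded _ _ _ _ _ c).
  exact: si_coef_measurable.
by move=> w; exact: cb.
Qed.

Lemma measurable_simple_eval l :
  measurable_fun setT (fun p : measurableTypeR R * T => simple_eval phi p.1 p.2 ord0 l).
Proof.
exact: (measurable_elem_eval si_left si_right (fun k => si_coef_measurable k l)).
Qed.

End simple.

Lemma cvg_ereal_small (u : nat -> \bar R) (e : R) : 0 < e -> u @ \oo --> 0%E ->
  \forall k \near \oo, (u k < e%:E)%E.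
Proof. by move=> e0 h; apply: (h _ (open_ereal_lt' _)); rewrite lte_fin. Qed.

Lemma ereal_3bound (L x y v a1 a2 a3 : \bar R) (q c : R) :
  (L <= 3%:E * (x + y + v) -> v <= 3%:E * (a1 + a2 + a3) ->
   x < q%:E -> y < q%:E -> a1 < q%:E -> a2 < q%:E -> a3 <= c%:E ->
   L <= (24 * q + 9 * c)%:E)%E.
Proof.
move=> hL hv /ltW hx /ltW hy /ltW h1 /ltW h2 h3.
apply: (le_trans hL).
apply: (@le_trans _ _ (3%:E * (q%:E + q%:E + 3%:E * (q%:E + q%:E + c%:E)))%E).
  rewrite lee_pmul2l//; apply: (leeD (leeD hx hy)); apply: (le_trans hv).
  by rewrite lee_pmul2l//; exact: (leeD (leeD h1 h2) h3).
rewrite -!(EFinD, EFinM) lee_fin; lra.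
Qed.

Lemma integral_null_le (A : set T) (f g : T -> \bar R) : measurable A -> P A = 0%E ->
  measurable_fun setT f -> (forall w, 0 <= f w)%E -> (forall w, 0 <= g w)%E ->
  (forall w, ~ A w -> f w <= g w)%E -> (\int[P]_w f w <= \int[P]_w g w)%E.
Proof.
move=> mA A0 mf f0 g0 fg.
rewrite (ge0_negligible_integral mA)// integral_mkcond.
apply: ge0_le_integral_nonmeasurable.
  by move=> w; apply: erestrict_ge0.
move=> w; rewrite patchE; case: ifPn => // /set_mem[_ nA].
exact: fg.
Qed.

Variables (H : R -> T -> 'rV[R]_n) (N : R -> T -> R).
Hypothesis mH : forall s i, 0 <= s < 1 -> measurable_fun setT (fun w => H s w ord0 i).
Hypothesis cH : {ae P, forall w, forall i, {within `[0, 1[, continuous (fun s => H s w ord0 i)}}.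
Hypothesis N_ito : ito_integral P B H N.

(** Paths are continuous almost surely, whereas [measurable_continuous_path] asks for it at every
    [w]. Setting the process to 0 on a measurable null set repairs this. *)
Lemma continuous_version : exists A, exists Ht : R -> T -> 'rV[R]_n,
  [/\ measurable A, P A = 0%E, (forall s w, ~ A w -> Ht s w = H s w),
   (forall s i, 0 <= s < 1 -> measurable_fun setT (fun w => Ht s w ord0 i)) &
   (forall w i, {within `[0, 1[, continuous (fun s => Ht s w ord0 i)})].
Proof.
have [A [mA A0 AH]] := cH.
exists A, (fun s w => \1_(~` A) w *: H s w); split => //.
- by move=> s w nA; rewrite indicE mem_set// scale1r.
- move=> s i s01; under eq_fun do rewrite mxE.
  apply: measurable_funM; last exact: mH.
  by apply: measurable_indic; exact: measurableC.
- move=> w i.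
  have -> : (fun s => (\1_(~` A) w *: H s w) ord0 i) =
      (fun s => \1_(~` A) w * H s w ord0 i) by apply/funext => s; rewrite mxE.
  have [Aw|nAw] := pselect (A w).
    rewrite indicE memNset; last by move=> /(_ Aw).
    rewrite (_ : (fun s => _) = cst 0); first by move=> x; exact: cvg_cst.
    by apply/funext => s; rewrite mul0r.
  rewrite indicE mem_set// (_ : (fun s => _) = fun s => H s w ord0 i); last first.
    by apply/funext => s; rewrite mul1r.
  by apply: contrapT => nc; apply: nAw; apply: AH => /= /(_ i).
Qed.

Lemma N_measurable (t : R) : 0 <= t < 1 -> measurable_fun setT (N t).
Proof.
move=> t01; apply: (G_measurable_fun _ (ito_adapted N_ito t01)).
by apply: (filtration_measurable bm); have /andP[_ /ltW] := t01.
Qed.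

(** [N b] and [N a] come with unrelated approximating sequences. The simple integral for [b], minus
    the one for [a], minus the given elementary integral, is again elementary, so the isometry
    applies to it. On [[0, a]] both simple integrands are close to [H]; on []a, b]] only the first
    and [X] remain. The constant 9 comes from two uses of [(x + y + z) ^ 2 <= 3 (x ^ 2 + y ^ 2 + z ^
    2)]. *)
Lemma ito_elem_bound (a b e : R) (I : finType) (al be : I -> R) (X : I -> T -> 'rV[R]_n) :
  0 <= a -> a < b -> b < 1 -> 0 <= e ->
  (forall i, [/\ a <= al i, al i < be i & be i <= b]) ->
  (forall i l, G_measurable (filtration_gen P B (al i)) (fun w => X i w ord0 l)) ->
  (forall i l, all_moments P (fun w => X i w ord0 l)) ->
  (forall s, a < s <= b ->
    (\int[P]_w (sqnormv (H s w - elem_eval al be X s w))%:E <= e%:E)%E) ->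
  (\int[P]_w ((N b w - N a w - elem_int B al be X w) ^+ 2)%:E <= (9 * e * (b - a))%:E)%E.
Proof.
move=> a0 ab b1 e0 albe mX aX He.
have b0 : 0 <= b by rewrite (le_trans a0)// ltW.
have a01 : 0 <= a < 1 by rewrite a0 (lt_trans ab).
have b01 : 0 <= b < 1 by rewrite b0.
have [A [Ht [mA A0 HtH mHt cHt]]] := continuous_version.
have [pb [pb1 pb2]] := ito_approx N_ito b01.
have [pa [pa1 pa2]] := ito_approx N_ito a01.
pose Hc (p : measurableTypeR R * T) : 'rV[R]_n := Ht (clamp b p.1) p.2.
have mHc i : measurable_fun setT (fun p => Hc p ord0 i).
  apply: (measurable_continuous_path (F := fun s w => Ht s w ord0 i)) => //.
    by move=> s /andP[s0 sb]; apply: mHt; rewrite s0 (le_lt_trans sb).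
  move=> w; apply: continuous_subspaceW (cHt w i) => s /=.
  by rewrite !in_itv/= => /andP[-> sb]; rewrite (le_lt_trans sb).
have mX' i l : measurable_fun setT (fun w => X i w ord0 l) by have [] := aX i l.
pose g1 k (p : measurableTypeR R * T) := (sqnormv (simple_eval (pb k) p.1 p.2 - Hc p))%:E.
pose g2 k (p : measurableTypeR R * T) := (sqnormv (simple_eval (pa k) p.1 p.2 - Hc p))%:E.
pose g3 (p : measurableTypeR R * T) := (sqnormv (Hc p - elem_eval al be X p.1 p.2))%:E.
have sub_meas (V W : measurableTypeR R * T -> 'rV[R]_n) :
   (forall i, measurable_fun setT (fun p => V p ord0 i)) ->
   (forall i, measurable_fun setT (fun p => W p ord0 i)) ->
   measurable_fun setT (fun p => (sqnormv (V p - W p))%:E).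
  move=> mV mW; apply/measurable_EFinP; apply: measurable_sqnormv => i.
  by under eq_fun do rewrite !mxE; exact: measurable_funB.
have mg1 k : measurable_fun setT (g1 k).
  apply: (sub_meas (fun p => simple_eval (pb k) p.1 p.2)) => // i.
  exact: measurable_simple_eval (ltW b1) i.
have mg2 k : measurable_fun setT (g2 k).
  apply: (sub_meas (fun p => simple_eval (pa k) p.1 p.2)) => // i.
  by apply: measurable_simple_eval; have /andP[_ /ltW] := a01.
have mg3 : measurable_fun setT g3.
  apply: (sub_meas Hc (fun p => elem_eval al be X p.1 p.2)) => // i.
  exact: measurable_elem_eval.
have g0 (x : 'rV[R]_n) : (0 <= (sqnormv x)%:E)%E by rewrite lee_fin sqnormv_ge0.
pose A1 k w : \bar R := (\int[leb]_(s in `[0%R, b]) g1 k (s, w))%E.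
pose A2 k w : \bar R := (\int[leb]_(s in `[0%R, a]) g2 k (s, w))%E.
pose A3 w : \bar R := (\int[leb]_(s in `]a, b]) g3 (s, w))%E.
have mA1 k : measurable_fun setT (A1 k) by apply: measurable_integral_section => // p; exact: g0.
have mA2 k : measurable_fun setT (A2 k) by apply: measurable_integral_section => // p; exact: g0.
have mA3 : measurable_fun setT A3 by apply: measurable_integral_section => // p; exact: g0.
have A1H k : (\int[P]_w A1 k w <= \int[P]_w \int[leb]_(s in `[0%R, b])
    (sqnormv (simple_eval (pb k) s w - H s w))%:E)%E.
  apply: (integral_null_le mA) => //.
  - by move=> w; apply: integral_ge0 => s _; exact: g0.
  - by move=> w; apply: integral_ge0 => s _; exact: g0.
  - move=> w nA; rewrite le_eqVlt; apply/orP; left; apply/eqP.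
    apply: eq_integral => s; rewrite inE/= in_itv/= => sb.
    by rewrite /g1 /Hc /= clamp_id// HtH.
have A2H k : (\int[P]_w A2 k w <= \int[P]_w \int[leb]_(s in `[0%R, a])
    (sqnormv (simple_eval (pa k) s w - H s w))%:E)%E.
  apply: (integral_null_le mA) => //.
  - by move=> w; apply: integral_ge0 => s _; exact: g0.
  - by move=> w; apply: integral_ge0 => s _; exact: g0.
  - move=> w nA; rewrite le_eqVlt; apply/orP; left; apply/eqP.
    apply: eq_integral => s; rewrite inE/= in_itv/= => /andP[s0 sa].
    by rewrite /g2 /Hc /= clamp_id ?HtH// s0 (le_trans sa)// ltW.
have A3e : (\int[P]_w A3 w <= (e * (b - a))%:E)%E.
  apply: (le_trans (@integral_section_le _ _ _ P _ g3 e%:E _ mg3 _ _ _)) => //.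
  - by move=> p; exact: g0.
  - move=> s /=; rewrite in_itv/= => /[dup] sab /andP[as' sb].
    apply: le_trans (He s sab); apply: (integral_null_le mA) => //.
    - by apply: (measurableT_comp mg3); apply: measurable_fun_pair.
    - by move=> w; exact: g0.
    - move=> w nA; rewrite /g3 /Hc /= clamp_id ?HtH//.
      by rewrite sb (le_trans a0 (ltW as')).
  by rewrite lebesgue_measure_itv/= lte_fin ab -EFinB -EFinM.
(* The three elementary integrands concatenated over a disjoint union of index types, with signs
   carried by the coefficients. *)
pose U k := sum_case (@si_left b (pb k)) (sum_case (@si_left a (pa k)) al).
pose V k := sum_case (@si_right b (pb k)) (sum_case (@si_right a (pa k)) be).
pose Y k := sum_case (@si_coef b (pb k))
  (sum_case (fun i w => - @si_coef a (pa k) i w) (fun i w => - X i w)).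
have IU k w : elem_int B (U k) (V k) (Y k) w =
    simple_integral (pb k) w - simple_integral (pa k) w - elem_int B al be X w.
  by rewrite !elem_int_sum !elem_int_opp !simple_integralE addrA.
have EU k s w : elem_eval (U k) (V k) (Y k) s w =
    simple_eval (pb k) s w - simple_eval (pa k) s w - elem_eval al be X s w.
  by rewrite !elem_eval_sum !elem_eval_opp !simple_evalE addrA.
have isoU k : (\int[P]_w (elem_int B (U k) (V k) (Y k) w ^+ 2)%:E =
   \int[P]_w \int[leb]_(s in `[0%R, b]) (sqnormv (elem_eval (U k) (V k) (Y k) s w))%:E)%E.
  apply: (ito_isometry_elem bm) => //; first exact: ltW.
  - case=> [i|[i|i]] /=; first exact: si_bounds.
    + have [h1 h2 h3] := si_bounds i; split => //.
      by rewrite (le_trans h3)// ltW.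
    + by have [h1 h2 h3] := albe i; split => //; rewrite (le_trans a0).
  - case=> [i|[i|i]] l /=; first exact: si_coef_adapted.
    + under eq_fun do rewrite mxE.
      by apply: measurable_funN; exact: si_coef_adapted.
    + by under eq_fun do rewrite mxE; apply: measurable_funN; exact: mX.
  - have nm Z : all_moments P Z -> all_moments P (fun w => - Z w).
      by move=> /(all_momentsZ (-1)); under eq_fun do rewrite mulN1r.
    case=> [i|[i|i]] l /=; first by apply: si_coef_all_moments; exact: ltW.
    + under eq_fun do rewrite mxE; apply: nm; apply: si_coef_all_moments.
      by have /andP[_ /ltW] := a01.
    + by under eq_fun do rewrite mxE; exact: nm.
have sec (g : measurableTypeR R * T -> \bar R) (w : T) : measurable_fun setT g -> measurable_fun setT (fun s : measurableTypeR R => g (s, w) : \bar R).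
  by move=> mg; by apply: (measurableT_comp mg); apply: measurable_fun_pair.
have UA k w : (\int[leb]_(s in `[0%R, b]) (sqnormv (elem_eval (U k) (V k) (Y k) s w))%:E
    <= 3%:E * (A1 k w + A2 k w + A3 w))%E.
  have -> : A2 k w = (\int[leb]_(s in `[0%R, b]) (((fun s => g2 k (s, w)) \_ `[0%R, a]) s))%E.
    rewrite -integral_mkcondr setIidr// => s /=.
    by rewrite !in_itv/= => /andP[-> sa]; rewrite (le_trans sa)// ltW.
  have -> : A3 w = (\int[leb]_(s in `[0%R, b]) (((fun s => g3 (s, w)) \_ `]a, b]) s))%E.
    rewrite -integral_mkcondr setIidr// => s /=.
    by rewrite !in_itv/= => /andP[as' ->]; rewrite (le_trans a0 (ltW as')).
  have m2 : measurable_fun setT ((fun s => g2 k (s, w)) \_ `[0%R, a]).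
    by apply/(measurable_restrictT _ _).1 => //; apply: measurable_funTS; exact: sec.
  have m3 : measurable_fun setT ((fun s => g3 (s, w)) \_ `]a, b]).
    by apply/(measurable_restrictT _ _).1 => //; apply: measurable_funTS; exact: sec.
  have p2 s : (0 <= ((fun s => g2 k (s, w)) \_ `[0%R, a]) s)%E.
    by apply: erestrict_ge0 => ? _; exact: g0.
  have p3 s : (0 <= ((fun s => g3 (s, w)) \_ `]a, b]) s)%E.
    by apply: erestrict_ge0 => ? _; exact: g0.
  have m1 : measurable_fun setT (fun s : measurableTypeR R => g1 k (s, w)) by exact: sec.
  rewrite -ge0_integralD//; last 2 first.
  - exact: measurable_funTS.
  - exact: measurable_funTS.
  rewrite -ge0_integralD//; last 3 first.
  - by move=> s _; rewrite adde_ge0// g0.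
  - by apply: measurable_funTS; exact: emeasurable_funD.
  - exact: measurable_funTS.
  rewrite -ge0_integralZl//; last 2 first.
  - by apply: measurable_funTS; do 2 apply: emeasurable_funD => //.
  - by move=> s _; rewrite !adde_ge0// g0.
  apply: ge0_le_integral => //.
  - have : measurable_fun setT (fun p : measurableTypeR R * T => (sqnormv (elem_eval (U k) (V k) (Y k) p.1 p.2))%:E).
      apply/measurable_EFinP; apply: measurable_sqnormv => l.
      under eq_fun do rewrite EU !mxE.
      apply: measurable_funB; last exact: measurable_elem_eval.
      apply: measurable_funB; apply: measurable_simple_eval; first exact: ltW.
      by have /andP[_ /ltW] := a01.
    by move=> /(sec _ w)/measurable_funTS; exact.
  - by apply: measurable_funTS; apply: measurable_funeM; do 2 apply: emeasurable_funD => //.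
  move=> s /=; rewrite in_itv/= => /andP[s0 sb].
  rewrite !patchE !mem_setE !in_itv/= s0 sb andbT/= /g1 /g2 /g3 /=.
  rewrite EU; set x := simple_eval (pb k) s w; set y := simple_eval (pa k) s w; set h := Hc _.
  (* Before [a] the pieces of [X] have not started; after [a] those of [pa] are over. Either way
     only two differences from [H] are left. *)
  have [sa|as'] := leP s a; rewrite /= ?adde0 -!EFinD -EFinM lee_fin.
    have -> : elem_eval al be X s w = 0.
      apply: elem_eval_out => i; have [h1 _ _] := albe i.
      by rewrite negb_and -leNgt (le_trans sa h1).
    have := sqnormv_add3 (x - h) (- (y - h)) 0.
    rewrite (_ : x - h + - (y - h) + 0 = x - y - 0); last first.
      by rewrite addr0 subr0 opprB addrA subrK.
    by rewrite sqnormvN {4}/sqnormv /dotv big1 ?addr0// => i _; rewrite mxE mul0r.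
  have -> : y = 0.
    rewrite /y simple_evalE elem_eval_out// => i; have [_ _ h3] := si_bounds i.
    by rewrite negb_and -!ltNge orbC (le_lt_trans h3 as').
  set z := elem_eval _ _ _ _ _.
  have := sqnormv_add3 (x - h) (h - z) 0.
  rewrite (_ : x - h + (h - z) + 0 = x - 0 - z); last first.
    by rewrite addr0 subr0 addrA subrK.
  by rewrite {4}/sqnormv /dotv big1 ?addr0// => i _; rewrite mxE mul0r.
  by move=> s _; exact: g0.
have iA k : (\int[P]_w (elem_int B (U k) (V k) (Y k) w ^+ 2)%:E <=
   3%:E * (\int[P]_w A1 k w + \int[P]_w A2 k w + \int[P]_w A3 w))%E.
  have A10 k' w : (0 <= A1 k' w)%E by apply: integral_ge0 => s _; exact: g0.
  have A20 k' w : (0 <= A2 k' w)%E by apply: integral_ge0 => s _; exact: g0.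
  have A30 w : (0 <= A3 w)%E by apply: integral_ge0 => s _; exact: g0.
  rewrite isoU -!ge0_integralD//; last 2 first.
  - by move=> w _; rewrite adde_ge0.
  - exact: emeasurable_funD.
  rewrite -ge0_integralZl//; last 2 first.
  - by do 2 apply: emeasurable_funD => //.
  - by move=> w _; apply: adde_ge0; [apply: adde_ge0|]; [exact: A10|exact: A20|exact: A30].
  apply: ge0_le_integral_nonmeasurable => w; last exact: UA.
  by apply: integral_ge0 => s _; exact: g0.
have mI (J : finType) (u v : J -> R) (Z : J -> T -> 'rV[R]_n) :
    (forall j, 0 <= u j <= 1) -> (forall j, 0 <= v j <= 1) ->
    (forall j l, measurable_fun setT (fun w => Z j w ord0 l)) ->
    measurable_fun setT (elem_int B u v Z).
  move=> u01 v01 mZ; apply: measurable_sum => j; apply: measurable_sum => l.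
  under eq_fun do rewrite !mxE.
  by apply: measurable_funM => //; apply: measurable_funB; exact: (bm_measurable bm).
have msi (t : R) (phi : simple_integrand P B t) : t <= 1 -> measurable_fun setT (simple_integral phi).
  move=> t1; apply: mI => [j|j|j l]; last exact: si_coef_measurable.
    by have [h1 /ltW h2 h3] := si_bounds j; rewrite h1 (le_trans h2)// (le_trans h3).
  by have [h1 /ltW h2 h3] := si_bounds j; rewrite (le_trans h1 h2) (le_trans h3).
have mNb := N_measurable b01; have mNa := N_measurable a01.
have msb k := msi _ (pb k) (ltW b1).
have msa k : measurable_fun setT (simple_integral (pa k)).
  by apply: msi; have /andP[_ /ltW] := a01.
have mIX : measurable_fun setT (elem_int B al be X).
  apply: mI => // j.
    by have [h1 /ltW h2 h3] := albe j; rewrite (le_trans a0 h1) (le_trans h2)// (le_trans h3)// ltW.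
  by have [h1 /ltW h2 h3] := albe j; rewrite (le_trans (le_trans a0 h1) h2) (le_trans h3)// ltW.
have fin k : (\int[P]_w ((N b w - N a w - elem_int B al be X w) ^+ 2)%:E <=
  3%:E * (\int[P]_w ((simple_integral (pb k) w - N b w) ^+ 2)%:E +
          \int[P]_w ((simple_integral (pa k) w - N a w) ^+ 2)%:E +
          \int[P]_w (elem_int B (U k) (V k) (Y k) w ^+ 2)%:E))%E.
  have mq1 : measurable_fun setT (fun w => ((simple_integral (pb k) w - N b w) ^+ 2)%:E).
    by apply/measurable_EFinP; apply: measurable_funX; exact: measurable_funB.
  have mq2 : measurable_fun setT (fun w => ((simple_integral (pa k) w - N a w) ^+ 2)%:E).
    by apply/measurable_EFinP; apply: measurable_funX; exact: measurable_funB.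
  have mq3 : measurable_fun setT (fun w => (elem_int B (U k) (V k) (Y k) w ^+ 2)%:E).
    apply/measurable_EFinP; apply: measurable_funX.
    rewrite (_ : elem_int _ _ _ _ = fun w => simple_integral (pb k) w - simple_integral (pa k) w - elem_int B al be X w); last first.
      by apply/funext => w; exact: IU.
    by apply: measurable_funB => //; exact: measurable_funB.
  have q0 (r : R) : (0 <= (r ^+ 2)%:E)%E by rewrite lee_fin sqr_ge0.
  rewrite -ge0_integralD//.
  rewrite -ge0_integralD//; [|by move=> w _; apply: adde_ge0; exact: q0|exact: emeasurable_funD].
  rewrite -ge0_integralZl//; [|by do 2 apply: emeasurable_funD => //|by move=> w _; do 2 apply: adde_ge0 => //].
  apply: ge0_le_integral => //.
  - apply/measurable_EFinP; apply: measurable_funX.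
    by apply: measurable_funB => //; exact: measurable_funB.
  - by apply: measurable_funeM; do 2 apply: emeasurable_funD => //.
  move=> w _; rewrite -!EFinD -EFinM lee_fin IU.
  have := sqr_add3 (- (simple_integral (pb k) w - N b w)) (simple_integral (pa k) w - N a w)
    (simple_integral (pb k) w - simple_integral (pa k) w - elem_int B al be X w).
  rewrite -!expr2 sqrrN; congr (_ ^+ 2 <= _); ring.
apply/lee_addgt0Pr => dl dl0.
(* Four approximation errors below [q], two weighted by 3 and two by 9, add up to [24 q]. *)
pose q := dl / 24.
have q0 : 0 < q by rewrite divr_gt0.
have F := filterI (filterI (cvg_ereal_small q0 pb2) (cvg_ereal_small q0 pa2))
  (filterI (cvg_ereal_small q0 pb1) (cvg_ereal_small q0 pa1)).
have [k [[/= h1 h2] [/= h3' h4']]] := filter_ex (F _ _ _).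
have h3 := le_lt_trans (A1H k) h3'.
have h4 := le_lt_trans (A2H k) h4'.
apply: (le_trans (ereal_3bound (fin k) (iA k) h1 h2 h3 h4 A3e)).
rewrite -EFinD lee_fin.
have -> : dl = 24 * q by rewrite /q mulrC divfK.
lra.
Qed.

End ito_bounds.

(** * The Brownian bridge along a uniform grid *)

Section bridge_path.
Context {R : realType}.
Local Notation leb := (@lebesgue_measure R).

Lemma continuous_inv1m_within (A : set R) : (forall s, A s -> s < 1) ->
  {within A, continuous (fun s : R => (1 - s)^-1)}.
Proof.
move=> A1; apply/subspace_continuousP => s /A1 s1; apply: cvg_within_filter.
apply: cvgV; first by rewrite gt_eqF// subr_gt0.
by apply: cvgB; [exact: cvg_cst|exact: cvg_id].
Qed.

Lemma within_continuousM (A : set R) (f g : R -> R) :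
  {within A, continuous f} -> {within A, continuous g} ->
  {within A, continuous (fun s => f s * g s)}.
Proof. by move=> cf cg x; apply: continuousM; [exact: cf|exact: cg]. Qed.

Lemma within_continuous_sqr (A : set R) (f : R -> R) :
  {within A, continuous f} -> {within A, continuous (fun s => f s ^+ 2)}.
Proof.
move=> cf; rewrite (_ : (fun s => _) = (fun s => f s * f s)).
  exact: within_continuousM.
by apply/funext => s; rewrite expr2.
Qed.

Lemma within_continuousB (A : set R) (f g : R -> R) :
  {within A, continuous f} -> {within A, continuous g} ->
  {within A, continuous (fun s => f s - g s)}.
Proof. by move=> cf cg x; apply: continuousB; [exact: cf|exact: cg]. Qed.

Lemma continuous_integrable_itv (a c : R) (f : R -> R) :
  {within `[a, c], continuous f} ->
  (leb : {measure set (measurableTypeR R) -> \bar R}).-integrable `[a, c] (EFin \o f).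
Proof. by move=> cf; apply: continuous_compact_integrable => //; exact: segment_compact. Qed.

Variables (b z : R -> R).
Hypothesis cb : {within `[0, 1], continuous b}.
Hypothesis cz : {within `[0, 1[, continuous z}.
Hypothesis zE : forall t, 0 <= t < 1 ->
  z t = b t - \int[leb]_(s in `[0, t]) (z s / (1 - s)).

(* [(b t - z t) / (1 - t)] has derivative [b t / (1 - t) ^ 2]. *)
Lemma bridge_increment (s t : R) : 0 <= s -> s < t -> t < 1 ->
  z t / (1 - t) - z s / (1 - s) - (b t - b s) / (1 - s) =
  \int[leb]_(r in `[s, t]) ((b t - b r) / (1 - r) ^+ 2).
Proof.
move=> s0 st t1.
have [u tu u1] : exists2 u, t < u & u < 1 by exists ((t + 1) / 2); lra.
have sub_itv (A : set R) : A `<=` `[0, 1[ -> forall r, A r -> r < 1.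
  by move=> h r /h /=; rewrite in_itv/= => /andP[].
pose k r := z r / (1 - r).
have sub0u : `[0, u]%classic `<=` (`[0, 1[%classic : set R).
  by move=> r /=; rewrite !in_itv/= => /andP[-> ru]; rewrite (le_lt_trans ru).
have subst : `[s, t]%classic `<=` (`[0, u]%classic : set R).
  by move=> r /=; rewrite !in_itv/= => /andP[sr rt]; rewrite (le_trans s0)//= (le_trans rt)// ltW.
have ck : {within `[0, u], continuous k}.
  apply: within_continuousM.
    exact: continuous_subspaceW sub0u cz.
  by apply: continuous_inv1m_within; exact: sub_itv.
have ik := continuous_integrable_itv ck.
pose Z r := \int[leb]_(v in `[0, r]) k v.
have u0 : 0 <= u by rewrite (le_trans s0)// ltW// (lt_trans st).
have cZ : {within `[0, u], continuous Z} by exact: parameterized_integral_continuous.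
have ZE r : 0 <= r < 1 -> Z r = b r - z r by move=> r01; rewrite (zE r01) opprB addrC subrK.
(* Here [Z = b - z]. Starting from the constant [b t] turns the derivative into
   [(b t - b r) / (1 - r) ^ 2], which is small for [r] near [t], and makes [F t - F s] the wanted
   left side. *)
pose F r := (b t - Z r) * (1 - r)^-1.
have cF : {within `[s, t], continuous F}.
  apply: within_continuousM.
    apply: within_continuousB; first by move=> ?; exact: cvg_cst.
    exact: continuous_subspaceW subst cZ.
  apply: continuous_inv1m_within; apply: sub_itv.
  exact: subset_trans subst sub0u.
have dF r : r \in `]s, t[ -> is_derive r 1 F ((b t - b r) / (1 - r) ^+ 2).
  rewrite in_itv/= => /andP[sr rt].
  have r0 : 0 < r by exact: le_lt_trans sr.
  have ru : r < u by exact: lt_trans tu.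
  have r1 : r < 1 by exact: lt_trans u1.
  have ckr : {for r, continuous k}.
    have /(continuous_within_itvP _ (lt_trans r0 ru))[h _ _] := ck.
    by apply: h; rewrite in_itv/= r0.
  have [dZ Z'] := continuous_FTC1_closed ru ik r0 ckr.
  have DZ : is_derive r 1 Z (k r).
    exact: (DeriveDef dZ (etrans (esym (derive1E _ _)) Z')).
  have D1 : is_derive r 1 (fun r : R => (1 - r)^-1) ((1 - r) ^- 2).
    have h : is_derive r 1 (fun r : R => 1 - r) (-1).
      by apply: (is_derive_eq (is_deriveB (is_derive_cst (1 : R) r (1 : R)) (is_derive_id r (1 : R)))); rewrite sub0r.
    have r10 : 1 - r != 0 by rewrite gt_eqF// subr_gt0.
    have h3 := @is_deriveV R (fun r : R => 1 - r) r (-1) 1 r10 h.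
    by apply: (is_derive_eq h3); rewrite scalerN scaleNr opprK scaler1.
  have D2 : is_derive r 1 (fun r => b t - Z r) (- k r).
    by apply: (is_derive_eq (is_deriveB (is_derive_cst (b t) r (1 : R)) DZ)); rewrite sub0r.
  apply: (is_derive_eq (is_deriveM D2 D1)).
  have r10 : 1 - r != 0 by rewrite gt_eqF// subr_gt0.
  rewrite ZE ?(ltW r0)//= /k /GRing.scale/=.
  by field.
have cf : {within `[s, t], continuous (fun r => (b t - b r) / (1 - r) ^+ 2)}.
  rewrite (_ : (fun r => _) = (fun r => ((b t - b r) * (1 - r)^-1) * (1 - r)^-1)); last first.
    by apply/funext => r; rewrite expr2 invfM mulrA.
  have st1 : forall r, `[s, t]%classic r -> r < 1.
    by apply: sub_itv; exact: subset_trans subst sub0u.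
  apply: within_continuousM; last exact: continuous_inv1m_within.
  apply: within_continuousM; last exact: continuous_inv1m_within.
  apply: within_continuousB; first by move=> ?; exact: cvg_cst.
  apply: continuous_subspaceW cb => r /=.
  by rewrite !in_itv/= => /andP[sr rt]; rewrite (le_trans s0)//= (le_trans rt)// ltW.
have dF' : derivable_oo_LRcontinuous F s t.
  have /(continuous_within_itvP _ st)[_ h1 h2] := cF.
  by split => // r /dF [].
have dF'' : {in `]s, t[, F^`()%classic =1 (fun r => (b t - b r) / (1 - r) ^+ 2)}.
  by move=> r /dF [_ <-]; rewrite derive1E.
rewrite /Rintegral (continuous_FTC2 st cf dF' dF'')/=.
have t01 : 0 <= t < 1 by rewrite t1 (le_trans s0 (ltW st)).
have s01 : 0 <= s < 1 by rewrite s0 (lt_trans st).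
rewrite /F !ZE//; field.
by rewrite !subr_eq0 !gt_eqF// (lt_trans st).
Qed.

(** Cauchy-Schwarz, obtained by integrating [(g - m) ^ 2 >= 0] with [m] the average of [g]. *)
Lemma sqr_Rintegral_le (g : R -> R) (s t : R) : s < t ->
  {within `[s, t], continuous g} ->
  (\int[leb]_(r in `[s, t]) g r) ^+ 2 <= (t - s) * \int[leb]_(r in `[s, t]) (g r ^+ 2).
Proof.
move=> st cg.
have L0 : 0 < t - s by rewrite subr_gt0.
set I := \int[leb]_(r in _) g r.
pose m := I / (t - s).
have cg2 : {within `[s, t], continuous (fun r => g r ^+ 2)}.
  exact: within_continuous_sqr.
have ig := continuous_integrable_itv cg.
have ig2 := continuous_integrable_itv cg2.
have cc (c : R) : (leb : {measure set (measurableTypeR R) -> \bar R}).-integrable `[s, t] (EFin \o cst c).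
  by apply: continuous_integrable_itv => ?; exact: cvg_cst.
have c2g : {within `[s, t], continuous (fun r => 2 * m * g r)}.
  by apply: within_continuousM => //; move=> ?; exact: cvg_cst.
have icg := continuous_integrable_itv c2g.
have igg := continuous_integrable_itv (within_continuousB cg2 c2g).
have : 0 <= \int[leb]_(r in `[s, t]) ((g r ^+ 2 - 2 * m * g r) + m ^+ 2).
  apply: Rintegral_ge0 => r _.
  by rewrite (_ : _ + _ = (g r - m) ^+ 2) ?sqr_ge0//; ring.
rewrite (RintegralD _ igg (cc (m ^+ 2)))// (RintegralB _ ig2 icg)//.
rewrite RintegralZl// Rintegral_cst//.
rewrite (_ : fine _ = t - s); last first.
  by apply: (etrans (congr1 fine (lebesgue_measure_itv _))); rewrite /= lte_fin st.
rewrite -/I.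
set J := \int[leb]_(r in _) _.
rewrite -(pmulr_rge0 _ L0).
suff -> : (t - s) * (J - 2 * m * I + m ^+ 2 * (t - s)) = (t - s) * J - I ^+ 2.
  by rewrite subr_ge0.
by rewrite /m; field; rewrite gt_eqF.
Qed.

(** Cauchy-Schwarz on the remainder, with [1 / (1 - r)] replaced by its largest value
    [1 / (1 - t)]. *)
Lemma bridge_increment_sqr (s t : R) : 0 <= s -> s < t -> t < 1 ->
  (((z t / (1 - t) - z s / (1 - s) - (b t - b s) / (1 - s)) ^+ 2)%:E <=
   \int[leb]_(r in `[s, t]) ((t - s) / (1 - t) ^+ 4 * (b t - b r) ^+ 2)%:E)%E.
Proof.
move=> s0 st t1.
have t10 : 0 < 1 - t by rewrite subr_gt0.
rewrite bridge_increment//.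
have cbt : {within `[s, t], continuous (fun r => b t - b r)}.
  apply: within_continuousB; first by move=> ?; exact: cvg_cst.
  apply: continuous_subspaceW cb => r /=.
  by rewrite !in_itv/= => /andP[sr rt]; rewrite (le_trans s0)//= (le_trans rt)// ltW.
have ci : {within `[s, t], continuous (fun r : R => (1 - r)^-1)}.
  by apply: continuous_inv1m_within => r /=; rewrite in_itv/= => /andP[_ rt]; exact: le_lt_trans t1.
have cf : {within `[s, t], continuous (fun r => (b t - b r) / (1 - r) ^+ 2)}.
  rewrite (_ : (fun r => _) = (fun r => ((b t - b r) * (1 - r)^-1) * (1 - r)^-1)); last first.
    by apply/funext => r; rewrite expr2 invfM mulrA.
  by do 2 apply: within_continuousM => //.
have cq : {within `[s, t], continuous (fun r => (t - s) / (1 - t) ^+ 4 * (b t - b r) ^+ 2)}.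
  apply: within_continuousM; first by move=> ?; exact: cvg_cst.
  exact: within_continuous_sqr.
have iq := continuous_integrable_itv cq.
rewrite -[leRHS]fineK; last exact: integrable_fin_num.
rewrite lee_fin -/(Rintegral _ _ _).
apply: (le_trans (sqr_Rintegral_le st cf)).
rewrite -RintegralZl//; last first.
  apply: continuous_integrable_itv.
  exact: within_continuous_sqr.
apply: le_Rintegral => //.
  apply: continuous_integrable_itv.
  apply: within_continuousM; first by move=> ?; exact: cvg_cst.
  exact: within_continuous_sqr.
move=> r /=; rewrite in_itv/= => /andP[sr rt].
rewrite -mulrA; apply: ler_wpM2l; first by rewrite subr_ge0 ltW.
rewrite [leRHS]mulrC expr_div_n; apply: ler_wpM2l; first exact: sqr_ge0.
rewrite -exprM lef_pV2 ?posrE ?exprn_gt0// ?subr_gt0 ?(le_lt_trans rt)//.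
by apply: lerXn2r; rewrite ?nnegrE ?subr_ge0 ?(ltW t1) ?(le_trans rt (ltW t1))// lerB.
Qed.

End bridge_path.

Lemma sqr_sum_le (R : realDomainType) (m : nat) (x : 'I_m -> R) :
  (\sum_(k < m) x k) ^+ 2 <= m%:R * \sum_(k < m) x k ^+ 2.
Proof.
elim: m x => [|[|m] IH] x; first by rewrite !big_ord0 expr0n mul0r.
  by rewrite !big_ord_recr !big_ord0/= !add0r mul1r.
rewrite big_ord_recr [in leRHS]big_ord_recr/=.
have := IH (fun k => x (widen_ord (leqnSn m.+1) k)).
set S := \sum_(k < m.+1) _; set Q := \sum_(k < m.+1) _; set y := x _ => IH'.
have m1 : 0 < m.+1%:R :> R by rewrite ltr0n.
rewrite -[m.+2%:R]natr1 -(ler_pM2l m1).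
have : 0 <= (S - m.+1%:R * y) ^+ 2 by exact: sqr_ge0.
have Q0 : m.+1%:R * S ^+ 2 <= m.+1%:R * (m.+1%:R * Q) by rewrite ler_pM2l.
nra.
Qed.

Section grid.
Context {R : realType}.

Definition grid (t : R) (K j : nat) : R := t * j%:R / K%:R.

Variables (t : R) (K : nat).
Hypotheses (t0 : 0 < t) (K0 : (0 < K)%N).

Let KR0 : 0 < K%:R :> R. Proof. by rewrite ltr0n. Qed.

Lemma grid0 : grid t K 0 = 0.
Proof. by rewrite /grid mulr0 mul0r. Qed.

Lemma gridK : grid t K K = t.
Proof. by rewrite /grid mulfK// gt_eqF. Qed.

Lemma grid_step j : grid t K j.+1 - grid t K j = t / K%:R.
Proof. by rewrite /grid -natr1; field; rewrite gt_eqF. Qed.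

Lemma grid_ltE j k : (grid t K j < grid t K k) = (j < k)%N.
Proof. by rewrite /grid ltr_pM2r ?invr_gt0// ltr_pM2l// ltr_nat. Qed.

Lemma grid_leE j k : (grid t K j <= grid t K k) = (j <= k)%N.
Proof. by rewrite !leNgt grid_ltE -ltnNge ltnS leqNgt. Qed.

Lemma grid_ge0 j : 0 <= grid t K j.
Proof. by rewrite -grid0 grid_leE. Qed.

Lemma grid_le j : (j <= K)%N -> grid t K j <= t.
Proof. by move=> jK; rewrite -[leRHS]gridK grid_leE. Qed.

End grid.

Section bridge_grid.
Context {R : realType} {d : measure_display} {T : measurableType d}.
Variables (P : probability T R) (n : nat) (B z : R -> T -> 'rV[R]_n).
Hypothesis bm : brownian_motion P B.
Hypothesis bb : brownian_bridge P B z.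
Local Notation leb := (@lebesgue_measure R).

Definition scaled_bridge (s : R) (i : 'I_n) (w : T) : R := z s w ord0 i / (1 - s).

(** The error made over one step when the increment of [z / (1 - t)] is replaced by the
    corresponding step of the walk. *)
Definition bridge_rho (s t : R) (i : 'I_n) (w : T) : R :=
  scaled_bridge t i w - scaled_bridge s i w - incr B s t i w / (1 - s).

Lemma bridge_measurable (s : R) (i : 'I_n) : 0 <= s < 1 ->
  measurable_fun setT (fun w => z s w ord0 i).
Proof.
move=> s01; apply: (G_measurable_fun _ (bb_adapted bb s01 i)).
by apply: (filtration_measurable bm); have /andP[_ /ltW] := s01.
Qed.

Lemma scaled_bridge_measurable (s : R) (i : 'I_n) : 0 <= s < 1 ->
  measurable_fun setT (scaled_bridge s i).
Proof. by move=> s01; apply: measurable_funM => //; exact: bridge_measurable. Qed.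

Lemma bridge_good_set : exists A, [/\ measurable A, P A = 0%E &
  forall w, ~ A w -> forall i : 'I_n,
   [/\ B 0 w ord0 i = 0, {within `[0, 1], continuous (fun t => B t w ord0 i)},
    {within `[0, 1[, continuous (fun t => z t w ord0 i)} &
    forall t, 0 <= t < 1 -> z t w ord0 i = B t w ord0 i -
        \int[leb]_(s in `[0, t]) (z s w ord0 i / (1 - s))]].
Proof.
have [A1 [mA1 A10 h1]] := bm_start bm.
have [A2 [mA2 A20 h2]] := bm_continuous bm.
have [A3 [mA3 A30 h3]] := bb_continuous bb.
have [A4 [mA4 A40 h4]] := bb_equation bb.
exists (A1 `|` A2 `|` (A3 `|` A4)); split.
- by apply: measurableU; exact: measurableU.
- have mU X Y : measurable X -> measurable Y -> P X = 0%E -> P Y = 0%E -> P (X `|` Y) = 0%E.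
    by move=> mX mY X0 Y0; rewrite measureU0.
  have U1 := mU _ _ mA1 mA2 A10 A20; have U2 := mU _ _ mA3 mA4 A30 A40.
  by apply: (mU _ _ _ _ U1 U2); exact: measurableU.
move=> w nA i.
have n1 : ~ A1 w by move=> h; apply: nA; left; left.
have n2 : ~ A2 w by move=> h; apply: nA; left; right.
have n3 : ~ A3 w by move=> h; apply: nA; right; left.
have n4 : ~ A4 w by move=> h; apply: nA; right; right.
split.
- have -> : B 0 w = 0 by apply: contrapT => h; apply: n1; exact: h1.
  by rewrite mxE.
- by apply: contrapT => h; apply: n2; apply: h2 => /= /(_ i).
- by apply: contrapT => h; apply: n3; apply: h3 => /= /(_ i).
- move=> t t01; apply: contrapT => h; apply: n4; apply: h4 => /= /(_ t t01 i).
  exact: h.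
Qed.

Lemma integral_incr_sqr (s t : R) (i : 'I_n) : 0 <= s -> s < t -> t <= 1 ->
  (\int[P]_w (incr B s t i w ^+ 2)%:E = (t - s)%:E)%E.
Proof.
move=> s0 st t1; rewrite integral_mean ?(incr_mean_sqr bm)//.
by apply: (all_momentsX 2); exact: incr_all_moments.
Qed.

Lemma bridge_rho_measurable (s t : R) (i : 'I_n) : 0 <= s -> s < t -> t < 1 ->
  measurable_fun setT (bridge_rho s t i).
Proof.
move=> s0 st t1.
have s01 : 0 <= s < 1 by rewrite s0 (lt_trans st).
have t01 : 0 <= t < 1 by rewrite t1 (le_trans s0 (ltW st)).
apply: measurable_funB.
  by apply: measurable_funB; exact: scaled_bridge_measurable.
apply: measurable_funM => //; apply: (incr_measurable bm).
  by rewrite s0 ltW// (lt_trans st).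
by rewrite (le_trans s0 (ltW st)) ltW.
Qed.

(** One factor [t - s] comes from Cauchy-Schwarz, one from the variance of [B t - B r], one from the
    length of the interval. The third power is essential: at most [K] such errors are added, at the
    price of a factor [K ^ 2], and the total still vanishes with the mesh. *)
Lemma bridge_rho_bound (s t : R) (i : 'I_n) : 0 <= s -> s < t -> t < 1 ->
  (\int[P]_w (bridge_rho s t i w ^+ 2)%:E <= ((t - s) ^+ 3 / (1 - t) ^+ 4)%:E)%E.
Proof.
move=> s0 st t1; have t0 : 0 <= t by rewrite (le_trans s0 (ltW st)).
have st0 : 0 < t - s by rewrite subr_gt0.
have t10 : 0 < 1 - t by rewrite subr_gt0.
have [A [mA A0 Ah]] := bridge_good_set.
have mB s' i' : 0 <= s' < 1 -> measurable_fun setT (fun w => B s' w ord0 i').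
  by move=> /andP[s'0 s'1]; apply: (bm_measurable bm); rewrite s'0 ltW.
have cB : {ae P, forall w, forall i, {within `[0, 1[, continuous (fun s => B s w ord0 i)}}.
  exists A; split => // w /= h; apply: contrapT => nA; apply: h => j.
  have [_ h2 _ _] := Ah w nA j; apply: continuous_subspaceW h2 => r /=.
  by rewrite !in_itv/= => /andP[-> /ltW].
have [A' [Bt [mA' A'0 BtB mBt cBt]]] := continuous_version mB cB.
pose c := (t - s) / (1 - t) ^+ 4.
have c0 : 0 <= c by rewrite divr_ge0 ?exprn_ge0// ltW.
pose G (p : measurableTypeR R * T) := (c * (Bt t p.2 ord0 i - Bt (clamp t p.1) p.2 ord0 i) ^+ 2)%:E.
have mG : measurable_fun setT G.
  apply/measurable_EFinP; apply: measurable_funM => //; apply: measurable_funX.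
  apply: measurable_funB.
    by apply: (measurableT_comp (mBt t i _) measurable_snd); rewrite t0.
  apply: (measurable_continuous_path (F := fun s w => Bt s w ord0 i)) => //.
    by move=> r /andP[r0 rt]; apply: mBt; rewrite r0 (le_lt_trans rt).
  move=> w; apply: continuous_subspaceW (cBt w i) => r /=.
  by rewrite !in_itv/= => /andP[-> rt]; rewrite (le_lt_trans rt).
have G0 p : (0 <= G p)%E by rewrite lee_fin mulr_ge0 ?sqr_ge0.
apply: (@le_trans _ _ (\int[P]_w \int[leb]_(r in `[s, t]) G (r, w))%E).
  apply: (@integral_null_le _ _ _ _ (A `|` A')).
  - exact: measurableU.
  - by rewrite measureU0.
  - by apply/measurable_EFinP; apply: measurable_funX; exact: bridge_rho_measurable.
  - by move=> w; rewrite lee_fin sqr_ge0.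
  - by move=> w; exact: integral_ge0.
  move=> w /not_orP[nA nA'].
  have [_ h2 h3 h4] := Ah w nA i.
  have := bridge_increment_sqr h2 h3 h4 s0 st t1.
  rewrite /bridge_rho /scaled_bridge incrE; congr (_ <= _)%E.
  apply: eq_integral => r; rewrite inE/= in_itv/= => /andP[sr rt].
  by rewrite /G /= clamp_id ?BtB// rt (le_trans s0).
apply: (le_trans (@integral_section_le _ _ _ P _ G (c * (t - s))%:E _ mG G0 _ _)) => //.
- by rewrite lee_fin mulr_ge0// ltW.
- move=> r /=; rewrite in_itv/= => /andP[sr rt].
  have r0 : 0 <= r by exact: le_trans sr.
  have mBr : measurable_fun setT (fun w => Bt r w ord0 i) by apply: mBt; rewrite r0 (le_lt_trans rt).
  have mBt' : measurable_fun setT (fun w => Bt t w ord0 i) by apply: mBt; rewrite t0.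
  apply: (@le_trans _ _ (\int[P]_w (c * incr B r t i w ^+ 2)%:E)%E).
    apply: (integral_null_le mA') => //.
    + by apply: (measurableT_comp mG); apply: measurable_fun_pair.
    + by move=> w; rewrite lee_fin mulr_ge0 ?sqr_ge0.
    + by move=> w nA'; rewrite /G /= clamp_id ?BtB ?incrE// r0.
  have [->|rt'] := eqVneq r t.
    rewrite integral0_eq; first by rewrite lee_fin mulr_ge0// ltW.
    by move=> w _; rewrite incrE subrr expr0n mulr0.
  have rlt : r < t by rewrite lt_neqAle rt'.
  have ai := incr_all_moments bm r0 rlt (ltW t1) i.
  under eq_integral do rewrite EFinM.
  rewrite ge0_integralZl//; last 2 first.
  + apply/measurable_EFinP; apply: measurable_funX; by case: ai.
  + by move=> w _; rewrite lee_fin sqr_ge0.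
  rewrite (@integral_incr_sqr r t i r0 rlt (ltW t1)) -EFinM lee_fin ler_wpM2l//.
  by rewrite lerB.
- rewrite lebesgue_measure_itv/= lte_fin st -EFinB -EFinM lee_fin /c.
  by rewrite (_ : _ * (t - s) * (t - s) = (t - s) ^+ 3 / (1 - t) ^+ 4)//; ring.
Qed.

(** Left-point sum for the stochastic integral of [1 / (1 - s)] against [B], which is the exact
    value of the scaled bridge. *)
Definition grid_walk (t : R) (K j : nat) (i : 'I_n) (w : T) : R :=
  \sum_(k < j) incr B (grid t K k) (grid t K k.+1) i w / (1 - grid t K k).

Variables (t : R) (K : nat).
Hypotheses (t0 : 0 < t) (t1 : t < 1) (K0 : (0 < K)%N).
Local Notation dlt := (t / K%:R).

Let KR0 : 0 < K%:R :> R. Proof. by rewrite ltr0n. Qed.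
Let dlt0 : 0 < dlt. Proof. by rewrite divr_gt0. Qed.
Let dlt1 : dlt <= 1.
Proof. by rewrite ler_pdivrMr// mul1r (le_trans (ltW t1))// ler1n. Qed.
Let t10 : 0 < 1 - t. Proof. by rewrite subr_gt0. Qed.

Lemma grid_lt1 j : (j <= K)%N -> 0 <= grid t K j < 1.
Proof. by move=> jK; rewrite grid_ge0//= (le_lt_trans (grid_le t0 K0 jK)). Qed.

Lemma grid_walk_measurable j i : (j <= K)%N -> measurable_fun setT (grid_walk t K j i).
Proof.
move=> jK; apply: measurable_sum => k; apply: measurable_funM => //.
have kK : (k < K)%N by exact: leq_trans jK.
have /andP[h1 /ltW h2] := grid_lt1 (ltnW kK); have /andP[h3 /ltW h4] := grid_lt1 kK.
by apply: (incr_measurable bm); rewrite ?h1 ?h3.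
Qed.

Lemma grid_walk_error j i : (j <= K)%N ->
  (\int[P]_w ((scaled_bridge (grid t K j) i w - grid_walk t K j i w) ^+ 2)%:E <=
   (dlt / (1 - t) ^+ 4)%:E)%E.
Proof.
move=> jK.
have [A [mA A0 Ah]] := bridge_good_set.
pose rho k w := bridge_rho (grid t K k) (grid t K k.+1) i w.
have gk k : (k < j)%N -> [/\ 0 <= grid t K k, grid t K k < grid t K k.+1, grid t K k.+1 <= t & grid t K k.+1 < 1].
  move=> kj; have kK : (k < K)%N by exact: leq_trans jK.
  by have := grid_le t0 K0 kK; rewrite grid_ge0// grid_ltE// ltnS leqnn => h; rewrite (le_lt_trans h).
have mrho k : (k < j)%N -> measurable_fun setT (rho k).
  by move=> /gk[h1 h2 h3 h4]; exact: bridge_rho_measurable.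
have brho k : (k < j)%N -> (\int[P]_w (rho k w ^+ 2)%:E <= (dlt ^+ 3 / (1 - t) ^+ 4)%:E)%E.
  move=> /gk[h1 h2 h3 h4]; apply: (le_trans (bridge_rho_bound i h1 h2 h4)).
  rewrite lee_fin grid_step// ler_wpM2l ?exprn_ge0 ?(ltW dlt0)//.
  rewrite lef_pV2 ?posrE ?exprn_gt0// ?subr_gt0//.
  by apply: lerXn2r; rewrite ?nnegrE ?subr_ge0 ?(ltW t1) ?(ltW h4)// lerB.
apply: (@le_trans _ _ (\int[P]_w (j%:R%:E * \sum_(k < j) (rho k w ^+ 2)%:E))%E).
  apply: (integral_null_le mA) => //.
  - apply/measurable_EFinP; apply: measurable_funX; apply: measurable_funB; last exact: grid_walk_measurable.
    by apply: scaled_bridge_measurable; exact: grid_lt1.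
  - by move=> w; rewrite lee_fin sqr_ge0.
  - by move=> w; rewrite mule_ge0// sume_ge0// => k _; rewrite lee_fin sqr_ge0.
  move=> w nA; rewrite sumEFin -EFinM lee_fin.
  (* Off the null set the one-step errors telescope, both sides starting from 0 since
     [z 0 = B 0 = 0]. *)
  suff -> : scaled_bridge (grid t K j) i w - grid_walk t K j i w = \sum_(k < j) rho k w.
    exact: (sqr_sum_le (fun k : 'I_j => rho k w)).
  have [B0 _ _ zE] := Ah w nA i.
  have z0 : z 0 w ord0 i = 0.
    by rewrite zE ?lexx ?ltr01// B0 set_itv1 Rintegral_set1 subr0.
  elim: j {jK gk mrho brho} => [|j IH].
    by rewrite /grid_walk !big_ord0 subr0 grid0 /scaled_bridge z0 mul0r.
  rewrite big_ord_recr/= -IH /grid_walk big_ord_recr/= /rho /bridge_rho; ring.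
rewrite ge0_integralZl//; last 2 first.
- by apply: emeasurable_sum => k; apply/measurable_EFinP; apply: measurable_funX; exact: mrho.
- by move=> w _; rewrite sume_ge0// => k _; rewrite lee_fin sqr_ge0.
rewrite ge0_integral_sum//; last 2 first.
- by move=> k; apply/measurable_EFinP; apply: measurable_funX; exact: mrho.
- by move=> k w _; rewrite lee_fin sqr_ge0.
apply: (@le_trans _ _ (j%:R%:E * \sum_(k < j) (dlt ^+ 3 / (1 - t) ^+ 4)%:E)%E).
  by rewrite lee_wpmul2l// lee_sum// => k _; exact: brho.
rewrite sumEFin -EFinM lee_fin big_const_ord iter_addr_0 -mulr_natl.
have jK' : j%:R * j%:R <= K%:R * K%:R :> R by rewrite ler_pM ?ler_nat.
rewrite [leLHS](_ : _ = (j%:R * j%:R * dlt ^+ 2) * (dlt / (1 - t) ^+ 4)); last by ring.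
have D0 : 0 <= dlt / (1 - t) ^+ 4 by apply: divr_ge0; rewrite ?exprn_ge0 ?(ltW t10) ?(ltW dlt0).
rewrite -[leRHS]mul1r ler_wpM2r//.
apply: (@le_trans _ _ (K%:R * K%:R * dlt ^+ 2)); first by rewrite ler_wpM2r ?sqr_ge0.
rewrite (_ : _ * _ = t ^+ 2); last by field; rewrite gt_eqF.
by rewrite expr_le1 ?(ltW t0)// ltW.
Qed.

(** From the grid point [t_j] to [s] there is one more Brownian increment and one more remainder.
    Each of the three errors is at most [dlt / (1 - t) ^ 4], and squaring a sum of three terms costs
    a factor 3. *)
Lemma bridge_grid_error j i s : (j < K)%N -> grid t K j < s <= grid t K j.+1 ->
  (\int[P]_w ((scaled_bridge s i w - grid_walk t K j i w) ^+ 2)%:E <=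
   (9 * dlt / (1 - t) ^+ 4)%:E)%E.
Proof.
move=> jK /andP[gs sg].
have g0 := grid_ge0 t0 K0 j.
have gt := grid_le t0 K0 jK.
have st : s <= t by exact: le_trans gt.
have s1 : s < 1 by exact: le_lt_trans t1.
have s0 : 0 <= s by rewrite (le_trans g0)// ltW.
have g1 : grid t K j < 1 by exact: lt_trans s1.
have sd : s - grid t K j <= dlt by rewrite -(grid_step t K0 j) lerB.
have sd0 : 0 < s - grid t K j by rewrite subr_gt0.
have m1 : measurable_fun setT (fun w => ((incr B (grid t K j) s i w) ^+ 2)%:E).
  by apply/measurable_EFinP; apply: measurable_funX; apply: (incr_measurable bm); rewrite ?g0 ?s0 ltW.
have m2 : measurable_fun setT (fun w => ((bridge_rho (grid t K j) s i w) ^+ 2)%:E).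
  by apply/measurable_EFinP; apply: measurable_funX; exact: bridge_rho_measurable.
have m3 : measurable_fun setT (fun w => ((scaled_bridge (grid t K j) i w - grid_walk t K j i w) ^+ 2)%:E).
  apply/measurable_EFinP; apply: measurable_funX; apply: measurable_funB.
    by apply: scaled_bridge_measurable; rewrite g0.
  by apply: grid_walk_measurable; exact: ltnW.
have q0 (x : R) : (0 <= (x ^+ 2)%:E)%E by rewrite lee_fin sqr_ge0.
pose c := (1 - grid t K j) ^- 2.
have c0 : 0 <= c by rewrite invr_ge0 sqr_ge0.
apply: (@le_trans _ _ (3%:E * ((c%:E * \int[P]_w (incr B (grid t K j) s i w ^+ 2)%:E) +
   \int[P]_w (bridge_rho (grid t K j) s i w ^+ 2)%:E +
   \int[P]_w ((scaled_bridge (grid t K j) i w - grid_walk t K j i w) ^+ 2)%:E))%E).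
  rewrite -ge0_integralZl//.
  have m1' := measurable_funeM c%:E m1.
  have p1 w : (0 <= c%:E * (incr B (grid t K j) s i w ^+ 2)%:E)%E by rewrite mule_ge0// lee_fin.
  rewrite -ge0_integralD//.
  have m12 := emeasurable_funD m1' m2.
  rewrite -ge0_integralD//; last by move=> w _; rewrite adde_ge0.
  rewrite -ge0_integralZl//; last 2 first.
  - exact: emeasurable_funD.
  - by move=> w _; do 2 rewrite adde_ge0//.
  apply: ge0_le_integral_nonmeasurable => [w|w]; first exact: q0.
  rewrite -(EFinM c) -!EFinD -(EFinM 3) lee_fin /c -exprVn -exprMn.
  have := sqr_add3 (incr B (grid t K j) s i w / (1 - grid t K j)) (bridge_rho (grid t K j) s i w)
    (scaled_bridge (grid t K j) i w - grid_walk t K j i w).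
  rewrite -!expr2 [_^-1 * _]mulrC; apply: le_trans.
  by rewrite le_eqVlt; apply/orP; left; apply/eqP; congr (_ ^+ 2); rewrite /bridge_rho; ring.
have e1 := integral_incr_sqr i g0 gs (ltW s1).
have e2 := bridge_rho_bound i g0 gs s1.
have e3 := grid_walk_error i (ltnW jK).
rewrite e1 -EFinM.
have D0 : 0 <= dlt / (1 - t) ^+ 4 by rewrite divr_ge0 ?exprn_ge0 ?(ltW t10) ?(ltW dlt0).
have t1s : 1 - t <= 1 - grid t K j by rewrite lerB// (le_trans (ltW gs)).
have t1s' : 1 - t <= 1 - s by rewrite lerB.
have le1 : c * (s - grid t K j) <= dlt / (1 - t) ^+ 4.
  rewrite mulrC ler_pM ?(ltW sd0)//.
  rewrite /c lef_pV2 ?posrE ?exprn_gt0// ?subr_gt0//.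
  apply: (@le_trans _ _ ((1 - t) ^+ 2)).
    by rewrite (exprD _ 2 2) ler_piMr ?sqr_ge0// expr_le1 ?(ltW t10)// lerBlDr lerDl ltW.
  by apply: lerXn2r; rewrite ?nnegrE ?(ltW t10) ?subr_ge0 ?(ltW g1).
have le2 : (s - grid t K j) ^+ 3 / (1 - s) ^+ 4 <= dlt / (1 - t) ^+ 4.
  apply: ler_pM; rewrite ?exprn_ge0 ?invr_ge0 ?exprn_ge0 ?(ltW sd0) ?subr_ge0 ?(ltW s1)//.
    rewrite (le_trans _ sd)// (exprS _ 2) ler_piMr ?(ltW sd0)// expr_le1 ?(ltW sd0)//.
    exact: le_trans dlt1.
  rewrite lef_pV2 ?posrE ?exprn_gt0// ?subr_gt0//.
  by apply: lerXn2r; rewrite ?nnegrE ?(ltW t10) ?subr_ge0 ?(ltW s1).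
apply: (@le_trans _ _ (3%:E * ((dlt / (1 - t) ^+ 4)%:E + (dlt / (1 - t) ^+ 4)%:E + (dlt / (1 - t) ^+ 4)%:E))%E).
  rewrite lee_pmul2l//; apply: leeD; last exact: e3.
  by apply: leeD; [rewrite lee_fin|apply: (le_trans e2); rewrite lee_fin].
rewrite -!EFinD -EFinM lee_fin; lra.
Qed.

End bridge_grid.

(** * Moments of the grid walk *)

Section orthogonality.
Context {R : realType} {d : measure_display} {T : measurableType d}.
Variables (P : probability T R) (n : nat) (B : R -> T -> 'rV[R]_n).
Hypothesis bm : brownian_motion P B.
Local Notation Fgen := (filtration_gen P B).

Variables (u : nat -> R) (Z xi : nat -> T -> R).

Let S m w := \sum_(j < m) Z j w * xi j w.

(** The terms are martingale differences: [Z j] belongs to the past of [u j], and [xi j] is centered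
    and independent of it. The induction also carries adaptedness and moments of the partial sums,
    needed to cancel the cross term. *)
Lemma mean_sqr_orthogonal m :
  (forall j, (j < m)%N -> [/\ 0 <= u j, u j < u j.+1 & u j.+1 <= 1]) ->
  (forall j, (j < m)%N -> G_measurable (Fgen (u j)) (Z j) /\ all_moments P (Z j)) ->
  (forall j, (j < m)%N -> [/\ G_measurable (incr_events B (u j) (u j.+1)) (xi j),
     G_measurable (Fgen (u j.+1)) (xi j), all_moments P (xi j) & mean P (xi j) = 0]) ->
  mean P (fun w => (\sum_(j < m) Z j w * xi j w) ^+ 2) =
  \sum_(j < m) mean P (fun w => Z j w ^+ 2) * mean P (fun w => xi j w ^+ 2).
Proof.
move=> hu hZ hx.
suff [] : [/\ G_measurable (Fgen (u m)) (S m), all_moments P (S m) & mean P (fun w => S m w ^+ 2) =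
  \sum_(j < m) mean P (fun w => Z j w ^+ 2) * mean P (fun w => xi j w ^+ 2)] by [].
elim: m hu hZ hx => [|m IH] hu hZ hx.
  rewrite big_ord0; split.
  - by rewrite /S; under eq_fun do rewrite big_ord0; exact: measurable_cst.
  - by rewrite /S; under eq_fun do rewrite big_ord0; exact: all_moments_cst.
  - rewrite -[RHS](@mean_cst _ _ _ P); congr mean; apply/funext => w.
    by rewrite /S big_ord0 expr0n.
have [mS aS eS] := IH (fun j h => hu j (ltnW h)) (fun j h => hZ j (ltnW h)) (fun j h => hx j (ltnW h)).
have [u0 um u1] := hu m (ltnSn m).
have [mZ aZ] := hZ m (ltnSn m).
have [ix mx ax x0] := hx m (ltnSn m).
have SE w : S m.+1 w = S m w + Z m w * xi m w by rewrite /S big_ord_recr.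
have aZx := all_momentsM aZ ax.
split.
- rewrite (_ : S m.+1 = fun w => S m w + Z m w * xi m w); last by apply/funext.
  apply: measurable_funD; first by apply: adapted_le mS; exact: ltW.
  by apply: measurable_funM => //; apply: adapted_le mZ; exact: ltW.
- rewrite (_ : S m.+1 = fun w => S m w + Z m w * xi m w); last by apply/funext.
  exact: all_momentsD.
rewrite big_ord_recr/= -eS.
rewrite (_ : (fun w => _) = (fun w => (S m w ^+ 2 + (2 * (S m w * Z m w)) * xi m w) + Z m w ^+ 2 * xi m w ^+ 2)); last first.
  by apply/funext => w; rewrite SE; ring.
have aS2 := all_momentsX 2 aS; have aZ2 := all_momentsX 2 aZ; have ax2 := all_momentsX 2 ax.
have aSZ := all_momentsZ 2 (all_momentsM aS aZ).
have aSZx := all_momentsM aSZ ax; have aZx2 := all_momentsM aZ2 ax2.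
rewrite meanD//; last exact: all_momentsD.
rewrite meanD// (mean_past_incr bm u0 um u1 _ ix aSZ ax); last first.
  by apply: measurable_funM => //; exact: measurable_funM.
rewrite x0 mulr0 addr0 (mean_past_incr bm u0 um u1 _ _ aZ2 ax2)//.
  exact: measurable_funX.
exact: measurable_funX.
Qed.

End orthogonality.

Section walk_moments.
Context {R : realType} {d : measure_display} {T : measurableType d}.
Variables (P : probability T R) (n : nat) (B : R -> T -> 'rV[R]_n).
Hypothesis bm : brownian_motion P B.
Local Notation Fgen := (filtration_gen P B).

Variables (t : R) (K : nat).
Hypotheses (t0 : 0 < t) (t1 : t < 1) (K0 : (0 < K)%N).
Local Notation dlt := (t / K%:R).
Local Notation tt := (grid t K).
Local Notation Y j i := (incr B (tt j) (tt j.+1) i).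
Local Notation S := (grid_walk B t K).

Let KR0 : 0 < K%:R :> R. Proof. by rewrite ltr0n. Qed.
Let dlt0 : 0 < dlt. Proof. by rewrite divr_gt0. Qed.
Let dltK : dlt * K%:R = t. Proof. by rewrite divfK// gt_eqF. Qed.
Let t10 : 0 < 1 - t. Proof. by rewrite subr_gt0. Qed.

Lemma grid_itv j : (j < K)%N -> [/\ 0 <= tt j, tt j < tt j.+1 & tt j.+1 <= 1].
Proof.
move=> jK; split; [exact: grid_ge0|by rewrite grid_ltE|].
by rewrite (le_trans (grid_le t0 K0 jK))// ltW.
Qed.

Let gap_gt0 j : (j <= K)%N -> 0 < 1 - tt j.
Proof. by move=> jK; rewrite subr_gt0 (le_lt_trans (grid_le t0 K0 jK)). Qed.

(** The variance of each coordinate of the walk, a Riemann sum for the integral of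
    [1 / (1 - s) ^ 2]. *)
Definition walk_var j : R := \sum_(k < j) dlt / (1 - tt k) ^+ 2.

Lemma grid_incr_all_moments j i : (j < K)%N -> all_moments P (Y j i).
Proof. by move=> /grid_itv[h1 h2 h3]; exact: incr_all_moments. Qed.

Lemma grid_incr_adapted j i : (j < K)%N -> G_measurable (Fgen (tt j.+1)) (Y j i).
Proof.
move=> /grid_itv[h1 h2 h3]; apply: incr_adapted => //; last exact: ltW.
by rewrite (le_trans h1)// ltW.
Qed.

Lemma grid_walkS j i w : S j.+1 i w = S j i w + (1 - tt j)^-1 * Y j i w.
Proof. by rewrite /grid_walk big_ord_recr/= [_^-1 * _]mulrC. Qed.

Lemma grid_walk_adapted j i : (j <= K)%N -> G_measurable (Fgen (tt j)) (S j i).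
Proof.
elim: j => [|j IH] jK.
  rewrite (_ : S 0 i = cst 0); first exact: measurable_cst.
  by apply/funext => w; rewrite /grid_walk big_ord0.
rewrite (_ : S j.+1 i = fun w => S j i w + (1 - tt j)^-1 * Y j i w); last first.
  by apply/funext => w; exact: grid_walkS.
apply: measurable_funD.
  by apply: adapted_le (IH (ltnW jK)); have [_ /ltW] := grid_itv jK.
by apply: measurable_funM => //; exact: grid_incr_adapted.
Qed.

Lemma grid_walk_all_moments j i : (j <= K)%N -> all_moments P (S j i).
Proof.
move=> jK; apply: all_moments_sum => k _; under eq_fun do rewrite mulrC.
by apply: all_momentsZ; apply: grid_incr_all_moments; exact: leq_trans jK.
Qed.

Lemma grid_walk_mean j i : (j <= K)%N -> mean P (S j i) = 0.
Proof.
elim: j => [|j IH] jK.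
  rewrite (_ : S 0 i = cst 0); first exact: mean_cst.
  by apply/funext => w; rewrite /grid_walk big_ord0.
rewrite (_ : S j.+1 i = fun w => S j i w + (1 - tt j)^-1 * Y j i w); last first.
  by apply/funext => w; exact: grid_walkS.
have aS := grid_walk_all_moments i (ltnW jK); have aY := grid_incr_all_moments i jK.
have [h1 h2 h3] := grid_itv jK.
by rewrite meanD ?meanZ ?IH ?(incr_mean bm) ?mulr0 ?addr0//; [exact: ltnW|exact: all_momentsZ].
Qed.

Lemma grid_incr_mean_sqr j i : (j < K)%N -> mean P (fun w => Y j i w ^+ 2) = dlt.
Proof. by move=> jK; have [h1 h2 h3] := grid_itv jK; rewrite (incr_mean_sqr bm)// grid_step. Qed.

Lemma grid_incr_mean_quartic j i : (j < K)%N -> mean P (fun w => Y j i w ^+ 4) <= 3 * dlt ^+ 2.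
Proof. by move=> jK; have [h1 h2 h3] := grid_itv jK; rewrite -(grid_step t K0 j); exact: incr_mean_quartic. Qed.

Lemma grid_walk_mean_sqr j i : (j <= K)%N -> mean P (fun w => S j i w ^+ 2) = walk_var j.
Proof.
elim: j => [|j IH] jK.
  rewrite /walk_var big_ord0 -[RHS](@mean_cst _ _ _ P); congr mean.
  by apply/funext => w; rewrite /grid_walk big_ord0 expr0n.
set a := (1 - tt j)^-1.
rewrite (_ : (fun w => _) = fun w => S j i w ^+ 2 + ((2 * a) * S j i w * Y j i w + a ^+ 2 * Y j i w ^+ 2)); last first.
  by apply/funext => w; rewrite grid_walkS -/a; ring.
have aS := grid_walk_all_moments i (ltnW jK); have aY := grid_incr_all_moments i jK.
have aS2 := all_momentsX 2 aS; have aY2 := all_momentsX 2 aY.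
have aS' := all_momentsZ (2 * a) aS.
have aSY := all_momentsM aS' aY; have aY2' := all_momentsZ (a ^+ 2) aY2.
rewrite meanD//; last exact: all_momentsD.
rewrite meanD// meanZ// grid_incr_mean_sqr// IH ?(ltnW jK)//.
have [h1 h2 h3] := grid_itv jK.
rewrite (mean_adapted_incr bm i h1 h2 h3 _ aS'); last first.
  by apply: measurable_funM => //; apply: grid_walk_adapted; exact: ltnW.
by rewrite add0r /walk_var big_ord_recr/= [a ^+ 2 * _]mulrC exprVn.
Qed.

Lemma walk_var_ge0 j : 0 <= walk_var j.
Proof. by apply: sumr_ge0 => k _; rewrite divr_ge0 ?sqr_ge0// ltW. Qed.

(** In the expansion of [(S + a Y) ^ 4] the term with [Y] vanishes since [Y] is centered, and the
    term with [Y ^ 3] since [S] is, so no third moment is computed. What is left matches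
    [3 (v + a ^ 2 dlt) ^ 2]. *)
Lemma grid_walk_mean_quartic j i : (j <= K)%N ->
  mean P (fun w => S j i w ^+ 4) <= 3 * walk_var j ^+ 2.
Proof.
elim: j => [|j IH] jK.
  rewrite (_ : (fun w => _) = cst 0); first by rewrite mean_cst mulr_ge0 ?sqr_ge0.
  by apply/funext => w; rewrite /grid_walk big_ord0 expr0n.
set a := (1 - tt j)^-1.
rewrite (_ : (fun w => _) = fun w => S j i w ^+ 4 + (4 * a * S j i w ^+ 3 * Y j i w + ((6 * a ^+ 2) * S j i w ^+ 2 * Y j i w ^+ 2 + (4 * a ^+ 3 * S j i w * Y j i w ^+ 3 + a ^+ 4 * Y j i w ^+ 4)))); last first.
  by apply/funext => w; rewrite grid_walkS -/a; ring.
have jK' := ltnW jK; have mS := grid_walk_adapted i jK'.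
have [h1 h2 h3] := grid_itv jK.
have mY := @incr_G_measurable _ _ _ _ B (tt j) (tt j.+1) i.
have aS := grid_walk_all_moments i jK'; have aY := grid_incr_all_moments i jK.
have aSk k := all_momentsX k aS; have aYk k := all_momentsX k aY.
have a31 := all_momentsM (all_momentsZ (4 * a) (aSk 3)) aY.
have a22 := all_momentsM (all_momentsZ (6 * a ^+ 2) (aSk 2)) (aYk 2).
have a13 := all_momentsM (all_momentsZ (4 * a ^+ 3) aS) (aYk 3).
have a04 := all_momentsZ (a ^+ 4) (aYk 4).
rewrite meanD//; last by do 3 (apply: all_momentsD => //).
rewrite meanD//; last by do 2 (apply: all_momentsD => //).
rewrite meanD//; last by (apply: all_momentsD => //).
rewrite meanD// meanZ//.
rewrite (mean_adapted_incr bm i h1 h2 h3)//; last 2 first.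
- by apply: measurable_funM => //; exact: measurable_funX.
- exact: all_momentsZ.
have mS2 : G_measurable (Fgen (tt j)) (fun w => 6 * a ^+ 2 * S j i w ^+ 2).
  by apply: measurable_funM => //; exact: measurable_funX.
have mS1 : G_measurable (Fgen (tt j)) (fun w => 4 * a ^+ 3 * S j i w).
  exact: measurable_funM.
have mYk k : G_measurable (incr_events B (tt j) (tt j.+1)) (fun w => Y j i w ^+ k) by exact: measurable_funX.
rewrite (mean_past_incr bm h1 h2 h3 mS2 (mYk 2) (all_momentsZ _ (aSk 2)) (aYk 2)).
rewrite (mean_past_incr bm h1 h2 h3 mS1 (mYk 3) (all_momentsZ _ aS) (aYk 3)).
rewrite !meanZ// grid_walk_mean// grid_incr_mean_sqr// grid_walk_mean_sqr// mulr0 mul0r !add0r.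
have := IH jK'; have := grid_incr_mean_quartic i jK.
set q4 := mean P _; set s4 := mean P _ => hq hs.
rewrite /walk_var big_ord_recr/= -/(walk_var j); set v := walk_var j in hs *.
have : a ^+ 4 * q4 <= a ^+ 4 * (3 * dlt ^+ 2).
  by rewrite ler_wpM2l// exprn_ge0// invr_ge0 ltW// gap_gt0.
rewrite [dlt / (1 - tt j) ^+ 2](_ : _ = dlt * a ^+ 2); last by rewrite -exprVn.
by have := hs; lra.
Qed.

(** Left-point sums of an increasing function lie below its integral; termwise, [dlt] is the
    difference of two consecutive gaps [1 - t_j]. *)
Lemma walk_var_le j : (j <= K)%N -> walk_var j <= (1 - tt j)^-1.
Proof.
move=> jK; suff : walk_var j <= (1 - tt j)^-1 - 1 by lra.
elim: j jK => [|j IH] jK; first by rewrite /walk_var big_ord0 grid0 subr0 invr1 subrr.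
rewrite /walk_var big_ord_recr/= -/(walk_var j).
have := IH (ltnW jK).
have g0 := gap_gt0 (ltnW jK); have g1 := gap_gt0 jK.
have e : dlt = (1 - tt j) - (1 - tt j.+1) by rewrite -(grid_step t K0 j); ring.
suff : dlt / (1 - tt j) ^+ 2 <= (1 - tt j.+1)^-1 - (1 - tt j)^-1 by lra.
rewrite [leRHS](_ : _ = dlt / ((1 - tt j) * (1 - tt j.+1))); last first.
  by rewrite e; field; rewrite !gt_eqF.
apply: ler_wpM2l; first exact: ltW.
by rewrite lef_pV2 ?posrE ?exprn_gt0 ?mulr_gt0// expr2 ler_wpM2l ?(ltW g0)//; move: dlt0; lra.
Qed.

Lemma walk_var_leT j : (j <= K)%N -> walk_var j <= (1 - t)^-1.
Proof.
move=> jK; apply: (le_trans (walk_var_le jK)).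
by rewrite lef_pV2 ?posrE ?gap_gt0// lerB// grid_le.
Qed.

(** A mesh of at most [1 - t] keeps consecutive gaps within a factor 2 of each other, so the
    left-point sum is at least half of the integral. *)
Lemma walk_var_ge j : dlt <= 1 - t -> (j <= K)%N -> (1 - tt j)^-1 - 1 <= 2 * walk_var j.
Proof.
move=> dt; elim: j => [|j IH] jK; first by rewrite /walk_var big_ord0 grid0 subr0 invr1 subrr mulr0.
rewrite /walk_var big_ord_recr/= -/(walk_var j).
have := IH (ltnW jK).
have g0 := gap_gt0 (ltnW jK); have g1 := gap_gt0 jK.
have e : dlt = (1 - tt j) - (1 - tt j.+1) by rewrite -(grid_step t K0 j); ring.
suff : (1 - tt j.+1)^-1 - (1 - tt j)^-1 <= 2 * (dlt / (1 - tt j) ^+ 2) by lra.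
rewrite [leLHS](_ : _ = dlt / ((1 - tt j) * (1 - tt j.+1))); last first.
  by rewrite e; field; rewrite !gt_eqF.
rewrite mulrCA; apply: ler_wpM2l; first exact: ltW.
rewrite ler_pdivlMr ?exprn_gt0// [leLHS](_ : _ = (1 - tt j) / (1 - tt j.+1)); last by field; rewrite !gt_eqF.
rewrite ler_pdivrMr//.
have := grid_le t0 K0 jK; lra.
Qed.

(** Source of the logarithmic divergence. The 4 is one factor 2 from [walk_var_ge] times another
    from comparing [1 / (1 - t_(j+1))] with [1 / (1 - t_j)]; the loss 1/2 comes from the subtracted
    1 in [walk_var_ge]. *)
Lemma walk_var_sum_ge : dlt <= 1 - t ->
  - ln (1 - t) / 4 - 1 / 2 <= dlt * \sum_(j < K) walk_var j.
Proof.
move=> dt.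
suff h j : (j <= K)%N -> - ln (1 - tt j) / 4 - tt j / 2 <= dlt * \sum_(k < j) walk_var k.
  by have := h K (leqnn K); rewrite gridK//; set L := ln _; set s := _ * _; move: t1; lra.
elim: j => [|j IH] jK; first by rewrite big_ord0 grid0 subr0 ln1; lra.
rewrite big_ord_recr/=.
have := IH (ltnW jK); have := walk_var_ge dt (ltnW jK).
have g0 := gap_gt0 (ltnW jK); have g1 := gap_gt0 jK.
have e : tt j.+1 = tt j + dlt by rewrite -(grid_step t K0 j); ring.
have x0 : 0 < (1 - tt j) / (1 - tt j.+1) by rewrite divr_gt0.
have : ln ((1 - tt j) / (1 - tt j.+1)) <= dlt / (1 - tt j.+1).
  rewrite [leRHS](_ : _ = (1 - tt j) / (1 - tt j.+1) - 1); last by rewrite -(grid_step t K0 j); field; rewrite gt_eqF.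
  set x := _ / _ in x0 *; have := @le_ln1Dx R (x - 1).
  by rewrite (_ : 1 + (x - 1) = x); [apply; move: x0; lra|ring].
rewrite ln_div ?posrE//.
have : dlt / (1 - tt j.+1) <= 2 * (dlt / (1 - tt j)).
  rewrite mulrCA ler_wpM2l ?(ltW dlt0)// -[leLHS]div1r ler_pdivrMr// mulrAC ler_pdivlMr// mul1r.
  have := grid_le t0 K0 jK; move: e dt; lra.
set l1 := ln _; set l2 := ln _; set s := \sum_(k < j) _.
move=> h1 h2 h3 h4.
have h5 : dlt * ((1 - tt j)^-1 - 1) <= dlt * (2 * walk_var j) by rewrite ler_wpM2l// ltW.
move: h1 h2 h4 h5; rewrite e; lra.
Qed.

(** At most [K - k] indices contribute and [dlt (K - k) = t - t_k]. In the variance of the energy,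
    this weight compensates the factor [1 / (1 - t_k)] of the increments of the walk. *)
Lemma sum_after_le k (b : nat -> R) : (k <= K)%N -> (forall j, 0 <= b j <= 1) ->
  0 <= dlt * \sum_(j < K | (k < j)%N) b j <= 1 - tt k.
Proof.
move=> kK b01; apply/andP; split.
  by rewrite mulr_ge0 ?(ltW dlt0)// sumr_ge0// => j _; have /andP[] := b01 j.
have h m : (k <= m)%N -> \sum_(j < m | (k < j)%N) b j <= (m - k)%:R.
  elim: m => [|m IH]; first by rewrite leqn0 => /eqP ->; rewrite big_ord0.
  rewrite leq_eqVlt => /predU1P[->|km].
    by rewrite big1 ?subnn// => i /= h; have := ltn_trans h (ltn_ord i); rewrite ltnn.
  rewrite big_mkcond big_ord_recr/= -big_mkcond/= subSn// -natr1 lerD//; first exact: IH.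
  by case: ifP => // _; have /andP[] := b01 m.
apply: (@le_trans _ _ (dlt * (K - k)%:R)); first by rewrite ler_wpM2l ?(ltW dlt0) ?h.
rewrite natrB// mulrBr dltK /grid [t * k%:R / _]mulrAC; move: t1; lra.
Qed.

End walk_moments.

(** * The discrete exponential supermartingale *)

Section exponential_supermartingale.
Context {R : realType} {d : measure_display} {T : measurableType d}.
Variables (P : probability T R) (n : nat) (B : R -> T -> 'rV[R]_n).
Hypothesis bm : brownian_motion P B.
Local Notation Fgen := (filtration_gen P B).

Variables (u : nat -> R) (X : nat -> 'I_n -> T -> R).
Let D j w := \sum_i X j i w * incr B (u j) (u j.+1) i w.
Let E m w := \sum_(j < m) D j w - (\sum_(j < m) D j w ^+ 2) / 2.

(** [decoupling] freezes the past, so the coefficients of the last increment become constants and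
    [exp_incr_le1] bounds the inner integral by 1. Everything is an integral of a nonnegative
    function, so integrability of the exponential is never an issue. *)
Lemma exp_martingale_le1 m :
  (forall j, (j < m)%N -> [/\ 0 <= u j, u j < u j.+1 & u j.+1 <= 1]) ->
  (forall j i, (j < m)%N -> G_measurable (Fgen (u j)) (X j i)) ->
  (\int[P]_w (expR (\sum_(j < m) (\sum_i X j i w * incr B (u j) (u j.+1) i w)
    - (\sum_(j < m) (\sum_i X j i w * incr B (u j) (u j.+1) i w) ^+ 2) / 2))%:E <= 1)%E.
Proof.
move=> hu hX; suff [] : G_measurable (Fgen (u m)) (E m) /\
  (\int[P]_w (expR (E m w))%:E <= 1)%E by [].
elim: m hu hX => [|m IH] hu hX.
  split; first by rewrite /E; under eq_fun do rewrite !big_ord0 mul0r subr0; exact: measurable_cst.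
  rewrite (eq_integral (cst 1%E)); last by move=> w _; rewrite /E !big_ord0 mul0r subr0 expR0.
  by rewrite integral_cst//= probability_setT mule1.
have [mE iE] := IH (fun j h => hu j (ltnW h)) (fun j i h => hX j i (ltnW h)).
have [u0 um u1] := hu m (ltnSn m); have mX i := hX m i (ltnSn m).
have u1' : u m <= 1 by rewrite (le_trans (ltW um)).
have EE w : E m.+1 w = E m w + (D m w - D m w ^+ 2 / 2).
  by rewrite /E !big_ord_recr/=; ring.
split.
  rewrite (_ : E m.+1 = fun w => E m w + (D m w - D m w ^+ 2 / 2)); last by apply/funext.
  have mD : G_measurable (Fgen (u m.+1)) (D m).
    apply: measurable_sum => i; apply: measurable_funM; first by apply: adapted_le (mX i); exact: ltW.
    by apply: incr_adapted => //; [rewrite (le_trans u0)// ltW|exact: ltW].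
  apply: measurable_funD; first by apply: adapted_le mE; exact: ltW.
  by apply: measurable_funB => //; apply: measurable_funM => //; exact: measurable_funX.
have mG1 := filtration_measurable bm u1'.
have u01 : 0 <= u m <= 1 by rewrite u0.
have u11 : 0 <= u m.+1 <= 1 by rewrite u1 (le_trans u0)// ltW.
have mG2 := incr_events_measurable bm u01 u11.
pose L (p : g_sigma_algebraType (Fgen (u m)) * g_sigma_algebraType (incr_events B (u m) (u m.+1))) :=
  \sum_i X m i p.1 * incr B (u m) (u m.+1) i p.2.
pose g (p : g_sigma_algebraType (Fgen (u m)) * g_sigma_algebraType (incr_events B (u m) (u m.+1))) :=
  (expR (E m p.1 + (L p - L p ^+ 2 / 2)))%:E.
have mL : measurable_fun setT L.
  apply: measurable_sum => i; apply: measurable_funM.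
    exact: (measurableT_comp (mX i) measurable_fst).
  exact: (measurableT_comp (@incr_G_measurable _ _ _ _ B (u m) (u m.+1) i) measurable_snd).
have mg : measurable_fun setT g.
  apply/measurable_EFinP; apply: measurableT_comp => //; apply: measurable_funD.
    exact: (measurableT_comp mE measurable_fst).
  by apply: measurable_funB => //; apply: measurable_funM => //; exact: measurable_funX.
have g0 p : (0 <= g p)%E by rewrite lee_fin expR_ge0.
rewrite (_ : (\int[P]_w _ = \int[P]_w g (w, w))%E); last by apply: eq_integral => w _; rewrite EE.
rewrite (decoupling mG1 mG2 (incr_indep bm u0 um u1) mg g0); apply: le_trans iE.
apply: ge0_le_integral_nonmeasurable => w; first exact: integral_ge0.
have mL' : measurable_fun [set: T] (fun w' : T => L (w, w')).
  rewrite (_ : (fun w' => _) = fun w' => \sum_i X m i w * incr B (u m) (u m.+1) i w')//.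
  apply: measurable_sum => i; apply: measurable_funM => //.
  exact: (G_measurable_fun mG2 (@incr_G_measurable _ _ _ _ B (u m) (u m.+1) i)).
rewrite (_ : (\int[P]_w' g (w, w') =
    (expR (E m w))%:E * \int[P]_w' (expR (L (w, w') - L (w, w') ^+ 2 / 2))%:E)%E); last first.
  rewrite -ge0_integralZl//.
  - by apply: eq_integral => w' _; rewrite /g expRD EFinM.
  - by apply/measurable_EFinP; apply: measurableT_comp => //; apply: measurable_funB => //;
      apply: measurable_funM => //; exact: measurable_funX.
rewrite -[leRHS]mule1 lee_wpmul2l ?lee_fin ?expR_ge0//.
exact: (exp_incr_le1 bm u0 um u1 (fun i => X m i w)).
Qed.

End exponential_supermartingale.

(** * Concentration of the energy and of the squared drift terms *)

Section walk_energy.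
Context {R : realType} {d : measure_display} {T : measurableType d}.
Variables (P : probability T R) (n : nat) (B : R -> T -> 'rV[R]_n).
Hypothesis bm : brownian_motion P B.

Variables (t : R) (K : nat).
Hypotheses (t0 : 0 < t) (t1 : t < 1) (K0 : (0 < K)%N).
Local Notation dlt := (t / K%:R).
Local Notation tt := (grid t K).
Local Notation Y j i := (incr B (tt j) (tt j.+1) i).
Local Notation S := (grid_walk B t K).
Local Notation v := (walk_var t K).

Let KR0 : 0 < K%:R :> R. Proof. by rewrite ltr0n. Qed.
Let dlt0 : 0 < dlt. Proof. by rewrite divr_gt0. Qed.
Let dltK : K%:R * dlt = t. Proof. by rewrite mulrC divfK// gt_eqF. Qed.
Let t10 : 0 < 1 - t. Proof. by rewrite subr_gt0. Qed.
Let gap_gt0 j : (j <= K)%N -> 0 < 1 - tt j.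
Proof. by move=> jK; rewrite subr_gt0 (le_lt_trans (grid_le t0 K0 jK)). Qed.

(* [S_j ^+ 2 - v_j] is a sum of martingale differences, so that the weighted
   sum over [j] is again one, with the weight [c_k] on the [k]-th difference. *)
Lemma walk_energy_variance i (b : nat -> R) : dlt <= 1 - t ->
  (forall j, 0 <= b j <= 1) ->
  mean P (fun w => (dlt * \sum_(j < K) b j * S j i w ^+ 2
     - dlt * \sum_(j < K) b j * v j) ^+ 2) <=
  8 * (dlt * \sum_(j < K) v j) + 16.
Proof.
move=> dt b01.
pose a k := (1 - tt k)^-1.
pose c k := dlt * \sum_(j < K | (k < j)%N) b j.
pose Z1 k w := 2 * (c k * a k) * S k i w.
pose Z2 k (w : T) := c k * a k ^+ 2.
pose xi k w := Y k i w ^+ 2 - dlt.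
have eta j w : S j i w ^+ 2 - v j = \sum_(k < j) (2 * a k * S k i w * Y k i w + a k ^+ 2 * xi k w).
  elim: j => [|j IH]; first by rewrite /grid_walk /walk_var !big_ord0 expr0n subr0.
  have vE : v j.+1 = v j + dlt * a j ^+ 2 by rewrite /walk_var big_ord_recr/= /a exprVn.
  by rewrite big_ord_recr/= -IH grid_walkS vE -/(a j) /xi; ring.
have split_sum w : dlt * \sum_(j < K) b j * S j i w ^+ 2 - dlt * \sum_(j < K) b j * v j =
    \sum_(k < K) Z1 k w * Y k i w + \sum_(k < K) Z2 k w * xi k w.
  rewrite -mulrBr -sumrB -big_split/=.
  transitivity (dlt * \sum_(j < K) \sum_(k < K | (k < j)%N) b j * (2 * a k * S k i w * Y k i w + a k ^+ 2 * xi k w)).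
    congr (_ * _); apply: eq_bigr => j _; rewrite -mulrBr eta mulr_sumr.
    by rewrite (big_ord_widen K (fun k => b j * (2 * a k * S k i w * Y k i w + a k ^+ 2 * xi k w)))// ltnW.
  rewrite (exchange_big_dep predT)//= mulr_sumr; apply: eq_bigr => k _.
  by rewrite -mulr_suml /Z1 /Z2 /c; ring.
have aS k : (k < K)%N -> all_moments P (S k i).
  by move=> /ltnW; exact: grid_walk_all_moments.
have aY k : (k < K)%N -> all_moments P (Y k i) by exact: grid_incr_all_moments.
have axi k : (k < K)%N -> all_moments P (xi k).
  by move=> kK; apply: all_momentsB; [exact: (all_momentsX 2 (aY k kK))|exact: all_moments_cst].
have aZ1 k : (k < K)%N -> all_moments P (Z1 k) by move=> kK; apply: all_momentsZ; exact: aS.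
have mYk k : G_measurable (incr_events B (tt k) (tt k.+1)) (Y k i) by exact: incr_G_measurable.
have aA1 : all_moments P (fun w => \sum_(k < K) Z1 k w * Y k i w).
  by apply: all_moments_sum => k _; apply: all_momentsM; [exact: aZ1|exact: aY].
have aA2 : all_moments P (fun w => \sum_(k < K) Z2 k w * xi k w).
  by apply: all_moments_sum => k _; apply: all_momentsZ; exact: axi.
(* The tail weight [c k] is at most [1 - t_k], the inverse of [a k]; this is what keeps the variance
   comparable to the mean. *)
have ca k : (k < K)%N -> 0 <= c k * a k <= 1.
  move=> kK; have /andP[h1 h2] := sum_after_le t0 t1 K0 (ltnW kK) b01.
  have g0 := gap_gt0 (ltnW kK).
  by rewrite mulr_ge0 ?invr_ge0 ?(ltW g0)//= ler_pdivrMr// mul1r.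
have ca2 k : (k < K)%N -> (c k * a k) ^+ 2 <= 1.
  by move=> /ca /andP[h1 h2]; rewrite expr_le1.
have E1 : mean P (fun w => (\sum_(k < K) Z1 k w * Y k i w) ^+ 2) <= 4 * (dlt * \sum_(j < K) v j).
  rewrite (mean_sqr_orthogonal bm (u := tt) (Z := Z1) (xi := fun k => Y k i)).
  - rewrite mulrCA !mulr_sumr; apply: ler_sum => k _.
    rewrite grid_incr_mean_sqr// [leLHS]mulrC ler_wpM2l ?(ltW dlt0)//.
    rewrite (_ : (fun w => _) = fun w => 4 * (c k * a k) ^+ 2 * S k i w ^+ 2); last first.
      by apply/funext => w; rewrite /Z1; ring.
    rewrite meanZ; last by apply: (all_momentsX 2); exact: aS.
    rewrite grid_walk_mean_sqr//; last exact: ltnW.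
    by rewrite ler_wpM2r ?walk_var_ge0// -[leRHS]mulr1 ler_wpM2l// ca2.
  - by move=> j jK; exact: grid_itv.
  - move=> j jK; split; last exact: aZ1.
    by apply: measurable_funM => //; apply: grid_walk_adapted => //; exact: ltnW.
  - move=> j jK; have [h1 h2 h3] := grid_itv t0 t1 K0 jK; split; [by []|exact: grid_incr_adapted|exact: aY|exact: incr_mean].
have xi2 k : (k < K)%N -> mean P (fun w => xi k w ^+ 2) <= 8 * dlt ^+ 2.
  move=> kK; have aY4 := all_momentsX 4 (aY k kK).
  apply: (@le_trans _ _ (mean P (fun w => 2 * Y k i w ^+ 4 + 2 * dlt ^+ 2))).
    apply: mean_le.
    - by apply: (all_momentsX 2); exact: axi.
    - by apply: all_momentsD; [exact: all_momentsZ|exact: all_moments_cst].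
    - by move=> w; rewrite /xi (exprM _ 2 2); have := sqr_ge0 (Y k i w ^+ 2 + dlt); nra.
  rewrite meanD; [|exact: all_momentsZ|exact: all_moments_cst].
  by rewrite meanZ// mean_cst; have := grid_incr_mean_quartic bm t0 t1 K0 i kK; lra.
have E2 : mean P (fun w => (\sum_(k < K) Z2 k w * xi k w) ^+ 2) <= 8.
  rewrite (mean_sqr_orthogonal bm (u := tt) (Z := Z2) (xi := xi)).
  - apply: (@le_trans _ _ (\sum_(k < K) 8 * dlt * (dlt / (1 - tt k) ^+ 2))).
      apply: ler_sum => k _; rewrite /Z2 mean_cst.
      apply: (@le_trans _ _ (a k ^+ 2 * (8 * dlt ^+ 2))).
        apply: ler_pM; [exact: sqr_ge0|by apply: mean_ge0 => w; exact: sqr_ge0| |exact: xi2].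
        by rewrite [leLHS](_ : _ = (c k * a k) ^+ 2 * a k ^+ 2); [rewrite ler_piMl ?sqr_ge0// ca2|ring].
      by rewrite /a exprVn; rewrite le_eqVlt; apply/orP; left; apply/eqP; ring.
    rewrite -mulr_sumr -/(v K).
    have := walk_var_leT t0 t1 K0 (leqnn K) => hv.
    apply: (@le_trans _ _ (8 * (dlt / (1 - t)))); first by rewrite -mulrA ler_wpM2l// ler_wpM2l ?(ltW dlt0).
    by rewrite -[leRHS]mulr1 ler_wpM2l// ler_pdivrMr// mul1r.
  - by move=> j jK; exact: grid_itv.
  - by move=> j jK; split; [exact: measurable_cst|exact: all_moments_cst].
  - move=> j jK; have [h1 h2 h3] := grid_itv t0 t1 K0 jK; split; last 2 first.
    + exact: axi.
    + rewrite /xi meanB; [|by apply: (all_momentsX 2); exact: aY|exact: all_moments_cst].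
      by rewrite grid_incr_mean_sqr// mean_cst subrr.
    + by apply: measurable_funB; [apply: measurable_funX; exact: mYk|exact: measurable_cst].
    + by apply: measurable_funB => //; apply: measurable_funX; exact: grid_incr_adapted.
(* [(x + y) ^ 2 <= 2 x ^ 2 + 2 y ^ 2] avoids the covariance of the two martingale sums; [E1] and
   [E2] then give 8 times the mean energy plus 16. *)
apply: (@le_trans _ _ (mean P (fun w => 2 * (\sum_(k < K) Z1 k w * Y k i w) ^+ 2 + 2 * (\sum_(k < K) Z2 k w * xi k w) ^+ 2))).
  apply: mean_le.
  - under eq_fun do rewrite split_sum; apply: (all_momentsX 2); exact: all_momentsD.
  - by apply: all_momentsD; apply: all_momentsZ; exact: (all_momentsX 2).
  - by move=> w; rewrite split_sum; have := sqr_ge0 (\sum_(k < K) Z1 k w * Y k i w - \sum_(k < K) Z2 k w * xi k w); lra.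
have a1 := all_momentsX 2 aA1; have a2 := all_momentsX 2 aA2.
by rewrite meanD ?meanZ//; [lra|exact: all_momentsZ..].
Qed.

(** For each pair of coordinates, [Y_l Y_m - dlt [l = m]] is centered and independent of the past,
    so the error is a double sum of orthogonal sums [Q l m] with variance of order [dlt]. The 24 is
    3 from fourth moments of the walk times 8 from those of the increments; [n ^ 4] comes from
    applying [sqr_sum_le] to both sums. *)
Lemma drift_square_error (G : nat -> R) (C : R) :
  (forall j, (j < K)%N -> `|G j| <= C) ->
  mean P (fun w => (\sum_(j < K) (\sum_i G j * S j i w * Y j i w) ^+ 2
     - dlt * \sum_(j < K) \sum_i (G j * S j i w) ^+ 2) ^+ 2) <=
  24 * n%:R ^+ 4 * C ^+ 4 / (1 - t) ^+ 2 * dlt.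
Proof.
move=> GC.
have C40 : 0 <= C ^+ 4 by rewrite (exprM _ 2 2) sqr_ge0.
pose Z l m j w := G j ^+ 2 * (S j l w * S j m w).
pose xi l m j w := Y j l w * Y j m w - dlt *+ (l == m).
pose Q l m w := \sum_(j < K) Z l m j w * xi l m j w.
have split_sum w : \sum_(j < K) (\sum_i G j * S j i w * Y j i w) ^+ 2
     - dlt * \sum_(j < K) \sum_i (G j * S j i w) ^+ 2 = \sum_l \sum_m Q l m w.
  transitivity (\sum_(j < K) \sum_l \sum_m Z l m j w * xi l m j w).
    rewrite mulr_sumr -sumrB; apply: eq_bigr => j _.
    rewrite expr2 big_distrlr/= mulr_sumr -sumrB; apply: eq_bigr => l _.
    transitivity (\sum_m (G j * S j l w * Y j l w * (G j * S j m w * Y j m w) - G j ^+ 2 * (S j l w * S j m w) * (dlt *+ (l == m)))).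
      rewrite sumrB; congr (_ - _); rewrite (bigD1 l)//= eqxx mulr1n big1 ?addr0; last first.
        by move=> m /negbTE; rewrite eq_sym => ->; rewrite mulr0n mulr0.
      by ring.
    by apply: eq_bigr => m _; rewrite /Z /xi; ring.
  by rewrite exchange_big/=; apply: eq_bigr => l _; rewrite exchange_big.
have aS j i : (j < K)%N -> all_moments P (S j i).
  by move=> /ltnW; exact: grid_walk_all_moments.
have aY j i : (j < K)%N -> all_moments P (Y j i) by exact: grid_incr_all_moments.
have axi l m j : (j < K)%N -> all_moments P (xi l m j).
  by move=> jK; apply: all_momentsB; [apply: all_momentsM; exact: aY|exact: all_moments_cst].
have aZ l m j : (j < K)%N -> all_moments P (Z l m j).
  by move=> jK; apply: all_momentsZ; apply: all_momentsM; exact: aS.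
have aQ l m : all_moments P (Q l m).
  by apply: all_moments_sum => j _; apply: all_momentsM; [exact: aZ|exact: axi].
pose v2 := (1 - t) ^- 2.
have prod4 (x y : R) : x ^+ 2 * y ^+ 2 <= (x ^+ 4 + y ^+ 4) / 2.
  by rewrite !(exprM _ 2 2); have := sqr_ge0 (x ^+ 2 - y ^+ 2); lra.
have EZ l m j : (j < K)%N -> mean P (fun w => Z l m j w ^+ 2) <= C ^+ 4 * (3 * v2).
  move=> jK.
  have a4l := all_momentsX 4 (aS j l jK); have a4m := all_momentsX 4 (aS j m jK).
  apply: (@le_trans _ _ (mean P (fun w => C ^+ 4 * (2^-1 * (S j l w ^+ 4 + S j m w ^+ 4))))).
    apply: mean_le; first by apply: (all_momentsX 2); exact: aZ.
      by do 2 apply: all_momentsZ; exact: all_momentsD.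
    move=> w; rewrite /Z exprMn -exprM; apply: ler_pM; rewrite ?sqr_ge0//.
    - by rewrite (exprM _ 2 2) sqr_ge0.
    - have -> : G j ^+ (2 * 2) = `|G j| ^+ 4 by rewrite -normrX ger0_norm// (exprM _ 2 2) sqr_ge0.
      apply: lerXn2r; rewrite ?nnegrE//; last exact: GC.
      exact: le_trans (GC j jK).
    - by rewrite exprMn; have := prod4 (S j l w) (S j m w); lra.
  rewrite meanZ; last by apply: all_momentsZ; exact: all_momentsD.
  rewrite meanZ; last exact: all_momentsD.
  rewrite meanD//.
  rewrite ler_wpM2l//.
  have hv : v j ^+ 2 <= v2.
    rewrite /v2 -exprVn; apply: lerXn2r; rewrite ?nnegrE ?walk_var_ge0 ?invr_ge0 ?(ltW t10)//.
    by apply: walk_var_leT => //; exact: ltnW.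
  have := grid_walk_mean_quartic bm t0 t1 K0 l (ltnW jK).
  have := grid_walk_mean_quartic bm t0 t1 K0 m (ltnW jK).
  by move: hv; lra.
have Exi l m j : (j < K)%N -> mean P (fun w => xi l m j w ^+ 2) <= 8 * dlt ^+ 2.
  move=> jK.
  have a4l := all_momentsX 4 (aY j l jK); have a4m := all_momentsX 4 (aY j m jK).
  apply: (@le_trans _ _ (mean P (fun w => (Y j l w ^+ 4 + Y j m w ^+ 4) + 2 * dlt ^+ 2))).
    apply: mean_le; first by apply: (all_momentsX 2); exact: axi.
      by apply: all_momentsD; [exact: all_momentsD|exact: all_moments_cst].
    move=> w; have := prod4 (Y j l w) (Y j m w); rewrite -exprMn /xi.
    set x := Y j l w * Y j m w.
    have := sqr_ge0 (x + dlt); have := sqr_ge0 x; have := sqr_ge0 dlt.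
    by case: (l == m); rewrite ?mulr1n ?mulr0n; nra.
  rewrite meanD; [|exact: all_momentsD|exact: all_moments_cst].
  rewrite meanD// mean_cst.
  have := grid_incr_mean_quartic bm t0 t1 K0 l jK.
  by have := grid_incr_mean_quartic bm t0 t1 K0 m jK; lra.
have EQ l m : mean P (fun w => Q l m w ^+ 2) <= 24 * C ^+ 4 * v2 * dlt.
  rewrite (mean_sqr_orthogonal bm (u := tt)).
  - apply: (@le_trans _ _ (\sum_(j < K) C ^+ 4 * (3 * v2) * (8 * dlt ^+ 2))).
      apply: ler_sum => j _; apply: ler_pM; [..|exact: EZ|exact: Exi];
        by apply: mean_ge0 => w; exact: sqr_ge0.
    rewrite sumr_const card_ord -[leLHS]mulr_natl.
    rewrite [leLHS](_ : _ = 24 * C ^+ 4 * v2 * dlt * (K%:R * dlt)); last by ring.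
    rewrite dltK -[leRHS]mulr1 ler_wpM2l ?(ltW t1)//.
    apply: mulr_ge0 (ltW dlt0); apply: mulr_ge0; first exact: mulr_ge0.
    by rewrite invr_ge0 sqr_ge0.
  - by move=> j jK; exact: grid_itv.
  - move=> j jK; split; last exact: aZ.
    apply: measurable_funM => //.
    by apply: measurable_funM; apply: grid_walk_adapted => //; exact: ltnW.
  - move=> j jK; have [h1 h2 h3] := grid_itv t0 t1 K0 jK; split; last 2 first.
    + exact: axi.
    + rewrite /xi meanB; [|by apply: all_momentsM; exact: aY|exact: all_moments_cst].
      by rewrite (incr_mean_mul bm)// grid_step// mean_cst subrr.
    + by apply: measurable_funB => //; apply: measurable_funM; exact: incr_G_measurable.
    + by apply: measurable_funB => //; apply: measurable_funM; exact: grid_incr_adapted.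
apply: (@le_trans _ _ (mean P (fun w => n%:R * \sum_l (n%:R * \sum_m Q l m w ^+ 2)))).
  apply: mean_le.
  - under eq_fun do rewrite split_sum; apply: (all_momentsX 2).
    by apply: all_moments_sum => l _; apply: all_moments_sum.
  - apply: all_momentsZ; apply: all_moments_sum => l _; apply: all_momentsZ.
    by apply: all_moments_sum => m _; exact: (all_momentsX 2).
  - move=> w; rewrite split_sum; apply: (le_trans (sqr_sum_le _)).
    by rewrite ler_wpM2l// ler_sum// => l _; exact: sqr_sum_le.
have aQ2 l m := all_momentsX 2 (aQ l m).
have aQs l : all_moments P (fun w => \sum_m Q l m w ^+ 2) by apply: all_moments_sum.
rewrite meanZ; last by apply: all_moments_sum => l _; exact: all_momentsZ.
rewrite mean_sum; last by move=> l _; exact: all_momentsZ.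
apply: (@le_trans _ _ (n%:R * \sum_(l < n) n%:R * \sum_(m < n) 24 * C ^+ 4 * v2 * dlt)).
  rewrite ler_wpM2l// ler_sum// => l _; rewrite meanZ// ler_wpM2l// mean_sum//.
  by rewrite ler_sum.
have sumc (x : R) : \sum_(l < n) x = n%:R * x by rewrite sumr_const card_ord mulr_natl.
rewrite !sumc -/v2.
by rewrite le_eqVlt; apply/orP; left; apply/eqP; ring.
Qed.

End walk_energy.

Lemma segment_uniform_continuity (R : realType) (t : R) (g : R -> R) :
  {within `[0, t], continuous g} -> forall e, 0 < e ->
  exists2 r, 0 < r & forall x y, 0 <= x <= t -> 0 <= y <= t -> `|x - y| < r ->
    `|g x - g y| <= e.
Proof.
move=> cg e e0.
have /compact_near_coveringP cov := @segment_compact R 0 t.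
have /cov h : forall x : R, `[0, t]%classic x -> \forall x' \near x & r \near (0 : R)^'+,
    0 <= x' <= t -> forall y, 0 <= y <= t -> `|x' - y| < r -> `|g x' - g y| <= e.
  move=> x xt; have e20 : 0 < e / 2 by rewrite divr_gt0.
  have /subspace_continuousP/(_ x xt)/cvgrPdist_lt/(_ _ e20)[r /= r0 hr] := cg.
  have r20 : 0 < r / 2 by rewrite divr_gt0.
  exists (ball x (r / 2), [set i | i < r / 2]) => /=.
    by split; [exact: nbhsx_ballx|exact: nbhs_right_lt].
  move=> [x' i] [/= bx' ir] x't y yt x'y.
  have cx' : `|g x - g x'| < e / 2.
    by apply: hr => //=; rewrite (lt_trans bx')// gtr_pMr// invf_lt1// ltr1n.
  have cy : `|g x - g y| < e / 2.
    apply: hr; last by rewrite /= in_itv.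
    by rewrite /=; have := ler_distD x' x y; move: bx' ir x'y; rewrite /ball/=; lra.
  by have := ler_distD (g x) (g x') (g y); rewrite (distrC (g x') (g x)); move: cx' cy; lra.
have [r [hr r0]] := filter_ex (filterI h (nbhs_right_gt (0 : R))).
by exists r => // x y xt yt; apply: hr => //=; rewrite in_itv.
Qed.

(** * Discretization of [N] on the grid *)

Section grid_approximation.
Context {R : realType} {d : measure_display} {T : measurableType d}.
Variables (P : probability T R) (n : nat) (B z : R -> T -> 'rV[R]_n).
Hypothesis bm : brownian_motion P B.
Hypothesis bb : brownian_bridge P B z.
Variables (g : R -> R) (H : R -> T -> 'rV[R]_n) (N : R -> T -> R).
Hypothesis cg : {within `[0, 1[, continuous g}.
Hypothesis HE : forall s w i, 0 <= s < 1 -> H s w ord0 i = g s * scaled_bridge z s i w.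
Hypothesis N_ito : ito_integral P B H N.

Lemma integrand_measurable s i : 0 <= s < 1 -> measurable_fun setT (fun w => H s w ord0 i).
Proof.
move=> s01; under eq_fun do rewrite HE//.
by apply: measurable_funM => //; exact: (scaled_bridge_measurable bm bb i s01).
Qed.

Lemma integrand_continuous :
  {ae P, forall w, forall i, {within `[0, 1[, continuous (fun s => H s w ord0 i)}}.
Proof.
have [A [mA A0 Ah]] := bridge_good_set bm bb.
exists A; split => // w /= h; apply: contrapT => nA; apply: h => i.
have [_ _ cz _] := Ah w nA i.
apply: (@subspace_eq_continuous _ _ _ (fun s => g s * (z s w ord0 i * (1 - s)^-1))).
  by move=> s; rewrite inE/= in_itv/= => s01; rewrite -[RHS]/(H s w ord0 i) HE.
apply: within_continuousM => //; apply: within_continuousM => //.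
by apply: continuous_inv1m_within => s /=; rewrite in_itv/= => /andP[].
Qed.

Variables (t : R) (K : nat).
Hypotheses (t0 : 0 < t) (t1 : t < 1) (K0 : (0 < K)%N).
Local Notation dlt := (t / K%:R).
Local Notation tt := (grid t K).
Local Notation Y j i := (incr B (tt j) (tt j.+1) i).
Local Notation S := (grid_walk B t K).

Let KR0 : 0 < K%:R :> R. Proof. by rewrite ltr0n. Qed.
Let dlt0 : 0 < dlt. Proof. by rewrite divr_gt0. Qed.
Let t10 : 0 < 1 - t. Proof. by rewrite subr_gt0. Qed.

Definition grid_integrand (j : nat) (w : T) : 'rV[R]_n := \row_i (g (tt j) * S j i w).

Definition grid_drift (j : nat) (w : T) : R := \sum_i g (tt j) * S j i w * Y j i w.

(** Split [g s W - g t_j S] as [g s (W - S) + (g s - g t_j) S]: the first term is the bridge error,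
    the second uses the modulus of continuity of [g] and the variance bound [1 / (1 - t)]. The 18 is
    2 times the 9 of [bridge_grid_error]. *)
Lemma grid_integrand_error j s (C e : R) : (j < K)%N -> tt j < s <= tt j.+1 ->
  `|g s| <= C -> `|g s - g (tt j)| <= e ->
  (\int[P]_w (sqnormv (H s w - grid_integrand j w))%:E <=
   (n%:R * (18 * C ^+ 2 * dlt / (1 - t) ^+ 4 + 2 * e ^+ 2 / (1 - t)))%:E)%E.
Proof.
move=> jK sj gC ge.
have j0 := grid_ge0 t0 K0 j; have jt := grid_le t0 K0 jK.
have s01 : 0 <= s < 1.
  by case/andP: sj => h1 h2; rewrite (le_trans j0 (ltW h1)) (le_lt_trans (le_trans h2 jt)).
pose F1 i w := ((scaled_bridge z s i w - S j i w) ^+ 2)%:E.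
pose F2 i w := (S j i w ^+ 2)%:E.
have mF1 i : measurable_fun setT (F1 i).
  apply/measurable_EFinP; apply: measurable_funX; apply: measurable_funB.
    exact: (scaled_bridge_measurable bm bb i s01).
  by apply: (grid_walk_measurable bm) => //; exact: ltnW.
have aS i : all_moments P (S j i) by apply: grid_walk_all_moments => //; exact: ltnW.
have mF2 i : measurable_fun setT (F2 i).
  by apply/measurable_EFinP; apply: measurable_funX; case: (aS i).
have c10 : (0 <= (2 * C ^+ 2)%:E)%E by rewrite lee_fin mulr_ge0 ?sqr_ge0.
have c20 : (0 <= (2 * e ^+ 2)%:E)%E by rewrite lee_fin mulr_ge0 ?sqr_ge0.
have F10 i w : (0 <= F1 i w)%E by rewrite lee_fin sqr_ge0.
have F20 i w : (0 <= F2 i w)%E by rewrite lee_fin sqr_ge0.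
have cF1 i : measurable_fun setT (fun w => (2 * C ^+ 2)%:E * F1 i w)%E by exact: measurable_funeM.
have cF2 i : measurable_fun setT (fun w => (2 * e ^+ 2)%:E * F2 i w)%E by exact: measurable_funeM.
have cF10 i w : (0 <= (2 * C ^+ 2)%:E * F1 i w)%E by rewrite mule_ge0.
have cF20 i w : (0 <= (2 * e ^+ 2)%:E * F2 i w)%E by rewrite mule_ge0.
apply: (@le_trans _ _ (\int[P]_w \sum_(i < n) ((2 * C ^+ 2)%:E * F1 i w + (2 * e ^+ 2)%:E * F2 i w))%E).
  apply: ge0_le_integral_nonmeasurable => w; first by rewrite lee_fin sqnormv_ge0.
  rewrite /sqnormv /dotv sumEFin lee_fin; apply: ler_sum => i _.
  rewrite !mxE HE// -expr2.
  set W := scaled_bridge _ _ _ _; set x := S j i w.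
  have -> : g s * W - g (tt j) * x = g s * (W - x) + (g s - g (tt j)) * x by ring.
  have h1 : (g s * (W - x)) ^+ 2 <= C ^+ 2 * (W - x) ^+ 2.
    rewrite exprMn ler_wpM2r ?sqr_ge0// -real_normK ?num_real//.
    by apply: lerXn2r; rewrite ?nnegrE// (le_trans _ gC).
  have h2 : ((g s - g (tt j)) * x) ^+ 2 <= e ^+ 2 * x ^+ 2.
    rewrite exprMn ler_wpM2r ?sqr_ge0// -real_normK ?num_real//.
    by apply: lerXn2r; rewrite ?nnegrE// (le_trans _ ge).
  have := sqr_add2 (g s * (W - x)) ((g s - g (tt j)) * x).
  by rewrite -!expr2; move: h1 h2; lra.
rewrite ge0_integral_sum//; last 2 first.
- by move=> i; exact: emeasurable_funD.
- by move=> i w _; rewrite adde_ge0.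
apply: (@le_trans _ _ (\sum_(i < n) (18 * C ^+ 2 * dlt / (1 - t) ^+ 4 + 2 * e ^+ 2 / (1 - t))%:E)%E); last first.
  by rewrite sumEFin sumr_const card_ord -[X in (X%:E <= _)%E]mulr_natl.
apply: lee_sum => i _; rewrite ge0_integralD// !ge0_integralZl// EFinD; apply: leeD.
  rewrite (_ : 18 * _ * _ / _ = 2 * C ^+ 2 * (9 * dlt / (1 - t) ^+ 4)); last by ring.
  by rewrite (EFinM (2 * C ^+ 2)) lee_wpmul2l//; exact: bridge_grid_error.
rewrite (EFinM (2 * e ^+ 2)) lee_wpmul2l// integral_mean; last exact: (all_momentsX 2 (aS i)).
by rewrite grid_walk_mean_sqr ?(ltnW jK)// lee_fin; apply: walk_var_leT => //; exact: ltnW.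
Qed.

Let grid_adapted j l : (j <= K)%N ->
  G_measurable (filtration_gen P B (tt j)) (fun w => grid_integrand j w ord0 l).
Proof.
move=> jK; under eq_fun do rewrite mxE.
by apply: measurable_funM => //; exact: grid_walk_adapted.
Qed.

Let grid_moments j l : (j <= K)%N -> all_moments P (fun w => grid_integrand j w ord0 l).
Proof.
move=> jK; under eq_fun do rewrite mxE.
by apply: all_momentsZ; exact: grid_walk_all_moments.
Qed.

Lemma dotv_grid_incr j w :
  dotv (grid_integrand j w) (B (tt j.+1) w - B (tt j) w) = grid_drift j w.
Proof. by apply: eq_bigr => i _; rewrite !mxE. Qed.

Lemma grid_drift_measurable j : (j < K)%N -> measurable_fun setT (grid_drift j).
Proof.
move=> jK; apply: measurable_sum => i; apply: measurable_funM.
  by apply: measurable_funM => //; apply: (grid_walk_measurable bm) => //; exact: ltnW.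
by have [] := grid_incr_all_moments bm t0 t1 K0 i jK.
Qed.

Lemma grid_cell s : 0 < s -> s <= t -> exists2 j, (j < K)%N & tt j < s <= tt j.+1.
Proof.
move=> s0 st; have ex : exists k, s <= tt k by exists K; rewrite gridK.
have h := ex_minnP ex; case: h => -[|j]; first by rewrite grid0 leNgt s0.
move=> sj jmin; exists j; last first.
  by rewrite sj andbT ltNge; apply/negP => /jmin; rewrite ltnn.
by apply: jmin; rewrite gridK.
Qed.

Lemma elem_eval_grid s j w : (j < K)%N -> tt j < s <= tt j.+1 ->
  elem_eval (fun k : 'I_K => tt k) (fun k : 'I_K => tt k.+1) (fun k : 'I_K => grid_integrand k) s w =
  grid_integrand j w.
Proof.
move=> jK /andP[js sj]; rewrite /elem_eval (big_pred1 (Ordinal jK))// => k /=.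
apply/andP/eqP => [[ks sk]|->]; last by [].
have := lt_le_trans ks sj; rewrite grid_ltE// ltnS => kj.
have := lt_le_trans js sk; rewrite grid_ltE// ltnS => jk.
by apply/val_inj/eqP; rewrite /= eqn_leq kj.
Qed.

Variable eta : R.
Hypothesis eta0 : 0 <= eta.
Hypothesis approx : forall j s, (j < K)%N -> tt j < s <= tt j.+1 ->
  (\int[P]_w (sqnormv (H s w - grid_integrand j w))%:E <= eta%:E)%E.

Lemma ito_grid_error :
  (\int[P]_w ((N t w - N 0 w - \sum_(j < K) grid_drift j w) ^+ 2)%:E <= (9 * eta)%:E)%E.
Proof.
have := @ito_elem_bound _ _ _ _ _ _ bm _ _ integrand_measurable integrand_continuous N_ito
  0 t eta 'I_K (fun k => tt k) (fun k => tt k.+1) (fun k => grid_integrand k)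
  (lexx _) t0 t1 eta0.
rewrite subr0 => h; apply: (@le_trans _ _ (9 * eta * t)%:E); last first.
  by rewrite lee_fin ler_piMr ?mulr_ge0// ltW.
apply: le_trans (h _ _ _ _).
- rewrite le_eqVlt; apply/orP; left; apply/eqP; apply: eq_integral => w _.
  by congr ((_ - _) ^+ 2)%:E; apply: eq_bigr => j _; rewrite dotv_grid_incr.
- by move=> i; rewrite grid_ge0// grid_ltE// ltnSn grid_le.
- by move=> i l; apply: grid_adapted; exact: ltnW.
- by move=> i l; apply: grid_moments; exact: ltnW.
- move=> s /andP[s0 st]; have [j jK sj] := grid_cell s0 st.
  by under eq_integral do rewrite (elem_eval_grid _ jK sj)//; exact: approx.
Qed.

Lemma ito_cell_error j : (j < K)%N ->
  (\int[P]_w ((N (tt j.+1) w - N (tt j) w - grid_drift j w) ^+ 2)%:E <= (9 * eta * dlt)%:E)%E.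
Proof.
move=> jK; have [h1 h2 h3] := grid_itv t0 t1 K0 jK.
have h4 : tt j.+1 < 1 by rewrite (le_lt_trans (grid_le t0 K0 jK)).
have := @ito_elem_bound _ _ _ _ _ _ bm _ _ integrand_measurable integrand_continuous N_ito
  (tt j) (tt j.+1) eta 'I_1 (fun k => tt j) (fun k => tt j.+1) (fun k => grid_integrand j)
  h1 h2 h4 eta0.
rewrite grid_step// => h; apply: le_trans (h _ _ _ _).
- rewrite le_eqVlt; apply/orP; left; apply/eqP; apply: eq_integral => w _.
  by congr ((_ - _) ^+ 2)%:E; rewrite /elem_int big_ord1 dotv_grid_incr.
- by move=> i; rewrite !lexx.
- by move=> i l; apply: grid_adapted; exact: ltnW.
- by move=> i l; apply: grid_moments; exact: ltnW.
- move=> s sj; under eq_integral do rewrite /elem_eval big_mkcond big_ord1/= sj.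
  exact: approx.
Qed.

(** Each cell contributes an error proportional to its length, so the sum does not grow with [K].
    This transfers the quadratic variation from [N] to the [D_j]. *)
Lemma ito_cells_error :
  (\int[P]_w (\sum_(j < K) (N (tt j.+1) w - N (tt j) w - grid_drift j w) ^+ 2)%:E <= (9 * eta)%:E)%E.
Proof.
have t01 s : 0 <= s -> s <= t -> 0 <= s < 1 by move=> -> st; rewrite (le_lt_trans st).
under eq_integral do rewrite -sumEFin.
rewrite ge0_integral_sum//; last 2 first.
- move=> j; apply/measurable_EFinP; apply: measurable_funX.
  apply: measurable_funB; first apply: measurable_funB.
  + by apply: (N_measurable bm N_ito); apply: t01; [exact: grid_ge0|exact: grid_le].
  + by apply: (N_measurable bm N_ito); apply: t01; [exact: grid_ge0|apply: grid_le => //; exact: ltnW].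
  + exact: grid_drift_measurable.
- by move=> j w _; rewrite lee_fin sqr_ge0.
apply: (@le_trans _ _ (\sum_(j < K) (9 * eta * dlt)%:E)%E).
  by apply: lee_sum => j _; exact: ito_cell_error.
rewrite sumEFin sumr_const card_ord -[(_ *+ K)]mulr_natr lee_fin.
rewrite (_ : 9 * eta * dlt * K%:R = 9 * eta * t); last by field; rewrite gt_eqF.
by rewrite ler_piMr ?mulr_ge0// ltW.
Qed.

End grid_approximation.

(** * The stochastic exponential tends to zero in probability *)

Section probability_bounds.
Context {R : realType} {d : measure_display} {T : measurableType d}.
Variable P : probability T R.

Lemma measurable_superlevel (c : R) (f : T -> R) : measurable_fun setT f ->
  measurable [set w | c <= f w].
Proof.
move=> mf; have := mf measurableT _ (measurable_itv `[c, +oo[); rewrite setTI.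
by congr measurable; apply/seteqP; split => w /=; rewrite in_itv/= andbT.
Qed.

Lemma markov_le (f : T -> R) (c e : R) : measurable_fun setT f ->
  (forall w, 0 <= f w) -> 0 < c -> (\int[P]_w (f w)%:E <= (c * e)%:E)%E ->
  (P [set w | (c <= f w)%R] <= e%:E)%E.
Proof.
move=> mf f0 c0 If; have mA := measurable_superlevel c mf.
rewrite -(@lee_pmul2l _ c%:E)// -EFinM; apply: le_trans If.
rewrite (_ : P _ = \int[P]_w (\1_[set w | (c <= f w)%R] w)%:E)%E; last by rewrite integral_indic// setIT.
rewrite -ge0_integralZl//; last 2 first.
- by apply/measurable_EFinP; exact: measurable_indic.
- exact: ltW.
apply: ge0_le_integral_nonmeasurable => w; first by rewrite mule_ge0// lee_fin ltW.
rewrite -EFinM lee_fin indicE; case: (boolP (w \in _)) => [|_]; last by rewrite mulr0.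
by rewrite inE mulr1.
Qed.

Lemma chebyshev_le (f : T -> R) (c e : R) : measurable_fun setT f -> 0 < c ->
  (\int[P]_w (f w ^+ 2)%:E <= (c ^+ 2 * e)%:E)%E ->
  (P [set w | (c <= `|f w|)%R] <= e%:E)%E.
Proof.
move=> mf c0 If; rewrite (_ : [set w | _] = [set w | c ^+ 2 <= f w ^+ 2]); last first.
  apply/seteqP; split => w /=; rewrite -[f w ^+ 2]real_normK ?num_real//.
    by move=> h; apply: lerXn2r => //; rewrite nnegrE// ltW.
  by rewrite ler_pXn2r// nnegrE// ltW.
apply: markov_le => //; last by rewrite exprn_gt0.
- exact: measurable_funX.
- by move=> w; exact: sqr_ge0.
Qed.

Lemma probabilityU_le (A C : set T) (a c : R) : measurable A -> measurable C ->
  (P A <= a%:E)%E -> (P C <= c%:E)%E -> (P (A `|` C) <= (a + c)%:E)%E.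
Proof. by move=> mA mC Pa Pc; apply: le_trans (measureU2 _ mA mC) _; rewrite EFinD leeD. Qed.

End probability_bounds.

Section grid_partition.
Context {R : realType}.
Variables (t : R) (K : nat).
Hypotheses (t0 : 0 < t) (K0 : (0 < K)%N).

Definition grid_partition : seq R := mkseq (fun j => grid t K j.+1) K.

Lemma part_pt_grid j : (j <= K)%N -> part_pt grid_partition j = grid t K j.
Proof.
case: j => [_|j jK]; first by rewrite grid0.
by rewrite /part_pt /= nth_mkseq.
Qed.

Lemma grid_partitionP : itv_partition 0 t grid_partition.
Proof.
split; last by rewrite (last_nth 0) size_mkseq -/(part_pt _ _) part_pt_grid// gridK.
apply/(pathP 0) => j; rewrite size_mkseq => jK.
by rewrite -/(part_pt _ _) part_pt_grid 1?ltnW// nth_mkseq// grid_ltE.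
Qed.

Lemma mesh_grid_partition : mesh grid_partition = t / K%:R.
Proof.
have tK : 0 < t / K%:R by rewrite divr_gt0// ltr0n.
rewrite /mesh size_mkseq.
rewrite (eq_bigr (fun _ => t / K%:R)) => [|j _]; last first.
  by rewrite part_pt_grid// part_pt_grid ?grid_step// ltnW.
rewrite big_const_ord; case: K K0 tK => // k _ tk /=.
elim: {2}k => [|j IH] /=; first by apply/max_idPl; exact: ltW.
by apply/max_idPl; rewrite IH.
Qed.

End grid_partition.

Lemma grid_step_cvg0 (R : realType) (t : R) : (fun k => t / k.+1%:R) @ \oo --> (0 : R).
Proof. by rewrite -(mulr0 t); apply: cvgMr; exact: cvg_harmonic. Qed.

Lemma near_grid_step (R : realType) (t a c : R) : 0 < c ->
  \forall k \near \oo, a * (t / k.+1%:R) < c.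
Proof.
move=> c0; have h : (fun k => a * (t / k.+1%:R)) @ \oo --> (0 : R).
  by rewrite -(mulr0 a); apply: cvgMr; exact: grid_step_cvg0.
have /cvgrPdist_lt/(_ _ c0) := h; apply: filterS => k.
by rewrite sub0r normrN; apply: le_lt_trans; exact: ler_norm.
Qed.

Section walk_energy_divergence.
Context {R : realType} {d : measure_display} {T : measurableType d}.
Variables (P : probability T R) (n : nat) (B : R -> T -> 'rV[R]_n).
Hypothesis bm : brownian_motion P B.
Variables (t : R) (K : nat) (s0 : R).
Hypotheses (t0 : 0 < t) (t1 : t < 1) (K0 : (0 < K)%N) (s01 : s0 < 1).
Local Notation dlt := (t / K%:R).
Local Notation tt := (grid t K).
Local Notation S := (grid_walk B t K).

(** The boolean factor is the indicator of [s0 <= t_j]: earlier times are dropped because [g] may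
    vanish there. *)
Definition late_energy i (w : T) : R := dlt * \sum_(j < K) (s0 <= tt j)%R%:R * S j i w ^+ 2.

Lemma late_energy_measurable i : measurable_fun setT (late_energy i).
Proof.
apply: measurable_funM => //; apply: measurable_sum => j; apply: measurable_funM => //.
by apply: measurable_funX; apply: (grid_walk_measurable bm) => //; exact: ltnW.
Qed.

(** Chebyshev at distance half the mean [m >= M]. The variance is at most [8 m + 8 / (1 - s0) + 16],
    hence at most [(24 + 8 / (1 - s0)) m] as [m >= 1], and it is divided by [m ^ 2 / 4]. *)
Lemma late_energy_small i (M e : R) : dlt <= 1 - t -> 0 < e -> 1 <= M ->
  4 * (24 + 8 * (1 - s0)^-1) <= e * M ->
  M + 1 / 2 + (1 - s0)^-1 <= - ln (1 - t) / 4 ->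
  (P [set w | (late_energy i w <= M / 2)%R] <= e%:E)%E.
Proof.
move=> dt e0 M1 Me Mt.
have dlt0 : 0 < dlt by rewrite divr_gt0// ltr0n.
have dltK : dlt * K%:R = t by rewrite divfK// gt_eqF// ltr0n.
have s10 : 0 < 1 - s0 by rewrite subr_gt0.
pose b j : R := (s0 <= tt j)%R%:R.
have b01 j : 0 <= b j <= 1 by rewrite /b; case: (s0 <= _); rewrite lexx ler01.
pose ma := dlt * \sum_(j < K) walk_var t K j.
pose m := dlt * \sum_(j < K) b j * walk_var t K j.
(* Dropping the times before [s0] loses at most [1 / (1 - s0)] of mean energy, a bound that does not
   depend on [t]. *)
have mma : ma <= m + (1 - s0)^-1.
  rewrite /ma /m -lerBlDl -mulrBr -sumrB.
  apply: (@le_trans _ _ (dlt * \sum_(j < K) (1 - s0)^-1)); last first.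
    rewrite sumr_const card_ord -[X in dlt * X]mulr_natl mulrA dltK ler_piMl ?invr_ge0 ?(ltW s10)//.
    exact: ltW.
  rewrite ler_wpM2l ?(ltW dlt0)//; apply: ler_sum => j _.
  rewrite /b; case: (leP s0 (tt j)) => h; rewrite ?mul1r ?mul0r ?subrr ?subr0 ?invr_ge0 ?(ltW s10)//.
  apply: (le_trans (walk_var_le t0 t1 K0 (ltnW (ltn_ord j)))).
  have g1 : 0 < 1 - tt j by rewrite subr_gt0 (lt_trans h).
  by rewrite lef_pV2 ?posrE// lerB// ltW.
have mM : M <= m.
  have := walk_var_sum_ge t0 t1 K0 dt; rewrite -/ma; move: mma Mt; lra.
have m0 : 0 < m by move: mM M1; lra.
have aS j : (j < K)%N -> all_moments P (S j i).
  by move=> /ltnW; exact: grid_walk_all_moments.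
have aV : all_moments P (fun w => late_energy i w - m).
  apply: all_momentsB; last exact: all_moments_cst.
  apply: all_momentsZ; apply: all_moments_sum => j _; apply: all_momentsZ.
  by apply: (all_momentsX 2); exact: aS.
apply: (@le_trans _ _ (P [set w | m / 2 <= `|late_energy i w - m|])).
  apply: le_measure; rewrite ?inE.
  - rewrite (_ : [set w | _] = [set w | - (M / 2) <= - late_energy i w]).
      by apply: measurable_superlevel; apply: measurableT_comp => //; exact: late_energy_measurable.
    by apply/seteqP; split => w /=; rewrite lerN2.
  - by apply: measurable_superlevel; apply: measurableT_comp => //; case: aV.
  - move=> w /= h; rewrite distrC; apply: le_trans (ler_norm _); move: h mM; lra.
apply: chebyshev_le; [by case: aV|by rewrite divr_gt0|].
rewrite integral_mean; last exact: (all_momentsX 2 aV).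
rewrite lee_fin; apply: (le_trans (walk_energy_variance bm t0 t1 K0 i dt b01)).
rewrite -/ma (_ : _ ^+ 2 * e = (m * (e * m)) / 4); last by field.
have : M * (4 * (24 + 8 * (1 - s0)^-1)) <= m * (e * m).
  apply: (@le_trans _ _ (m * (4 * (24 + 8 * (1 - s0)^-1)))).
    by rewrite ler_wpM2r// mulr_ge0// addr_ge0// mulr_ge0// invr_ge0 ltW.
  by rewrite ler_wpM2l ?(ltW m0)// (le_trans Me)// ler_wpM2l// ltW.
have : m * (4 * (24 + 8 * (1 - s0)^-1)) <= m * (e * m).
  by rewrite ler_wpM2l ?(ltW m0)// (le_trans Me)// ler_wpM2l// ltW.
have : 8 * (1 - s0)^-1 <= m * (8 * (1 - s0)^-1).
  rewrite ler_peMl//; first by rewrite mulr_ge0// invr_ge0 ltW.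
  exact: le_trans mM.
by move: mma mM M1; lra.
Qed.

End walk_energy_divergence.

Section exponent.
Context {R : realType} {d : measure_display} {T : measurableType d}.
Variables (P : probability T R) (n : nat) (B : R -> T -> 'rV[R]_n).
Hypothesis bm : brownian_motion P B.
Variables (g : R -> R) (H : R -> T -> 'rV[R]_n) (N Q : R -> T -> R).
Hypothesis N_ito : ito_integral P B H N.

(** [N 0 = 0] is not among the assumptions. It holds almost surely because a strictly increasing
    partition of [[0, 0]] is empty, so every simple integral at time 0 is 0; the threshold 1 is all
    that is used later. *)
Lemma ito_integral_start0 : (P [set w | (1 <= `|N 0 w|)%R] <= 0%:E)%E.
Proof.
have t01 : 0 <= (0 : R) < 1 by rewrite lexx ltr01.
have mN := N_measurable bm N_ito t01.
have [phi [_ h]] := ito_approx N_ito t01.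
apply: chebyshev_le => //; rewrite mulr0.
suff E : (fun k => \int[P]_w ((simple_integral (phi k) w - N 0 w) ^+ 2)%:E)%E =
    cst (\int[P]_w (N 0 w ^+ 2)%:E)%E.
  have c : (fun k : nat => \int[P]_w (N 0 w ^+ 2)%:E)%E @ \oo --> (\int[P]_w (N 0 w ^+ 2)%:E)%E by exact: cvg_cst.
  by rewrite E in h; rewrite (cvg_unique _ c h).
apply/funext => k; apply: eq_integral => w _; congr (_%:E).
suff -> : simple_integral (phi k) w = 0 by rewrite sub0r sqrrN.
rewrite /simple_integral; have [] := si_partition (phi k).
case: (si_part (phi k)) => [|x s] /=; first by rewrite big_ord0.
move=> /andP[x0 /(order_path_min lt_trans) /allP xs] /eqP l0.
have : x <= last x s by case: (lastP s) xs => [|s' y xs] //; rewrite last_rcons ltW// xs// mem_rcons mem_head.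
by rewrite l0 leNgt x0.
Qed.

Variables (t : R) (K : nat).
Hypotheses (t0 : 0 < t) (t1 : t < 1) (K0 : (0 < K)%N).
Local Notation dlt := (t / K%:R).
Local Notation tt := (grid t K).
Local Notation S := (grid_walk B t K).
Local Notation D := (grid_drift B g t K).

Let mD j : (j < K)%N -> measurable_fun setT (D j).
Proof. exact: (grid_drift_measurable bm g t0 t1 K0). Qed.

(** Markov's inequality for the exponential tilted by 1/2. The threshold is set so that, off this
    event, [sum D_j - (3 / 8) sum D_j ^ 2 < (a - sum D_j ^ 2) / 8 - lam], which is at most [- lam]
    once [sum D_j ^ 2 >= a]. *)
Lemma grid_exponential_bound a lam : (P [set w |
    (expR (a / 16 - lam / 2) <= expR (\sum_(j < K) D j w / 2 - (\sum_(j < K) (D j w / 2) ^+ 2) / 2))%R]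
  <= (expR (lam / 2 - a / 16))%:E)%E.
Proof.
apply: markov_le; rewrite ?expR_gt0//.
  apply: measurableT_comp => //; apply: measurable_funB.
    by apply: measurable_sum => j; apply: measurable_funM => //; exact: mD.
  apply: measurable_funM => //; apply: measurable_sum => j; apply: measurable_funX.
  by apply: measurable_funM => //; exact: mD.
rewrite -expRD (_ : _ + _ = 0); last by ring.
rewrite expR0.
have DE j w : \sum_(i < n) g (tt j) / 2 * S j i w * incr B (tt j) (tt j.+1) i w = D j w / 2.
  by rewrite /grid_drift mulr_suml; apply: eq_bigr => i _; ring.
apply: le_trans (@exp_martingale_le1 _ _ _ P n B bm tt (fun j i w => g (tt j) / 2 * S j i w) K _ _).
- rewrite le_eqVlt; apply/orP; left; apply/eqP; apply: eq_integral => w _.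
  have E1 : \sum_(j < K) D j w / 2 = \sum_(j < K) \sum_(i < n) g (tt j) / 2 * S j i w * incr B (tt j) (tt j.+1) i w.
    by apply: eq_bigr => j _; rewrite DE.
  have E2 : \sum_(j < K) (D j w / 2) ^+ 2 = \sum_(j < K) (\sum_(i < n) g (tt j) / 2 * S j i w * incr B (tt j) (tt j.+1) i w) ^+ 2.
    by apply: eq_bigr => j _; rewrite DE.
  by rewrite E1 E2.
- by move=> j jK; exact: grid_itv.
- by move=> j i jK; apply: measurable_funM => //; apply: grid_walk_adapted => //; exact: ltnW.
Qed.

(* Off the bad events [N_t <= D + 2] and [Q_t >= 3/4 sum D_j^2 - 2], where [D]
   is the sum of the [D_j]. *)
Lemma exponent_le (a lam m c : R) (i : 'I_n) s0 w :
  (forall s, s0 <= s < 1 -> c <= g s ^+ 2) -> 0 <= c -> a + 1 <= c * m ->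
  `|N 0 w| < 1 ->
  `|N t w - N 0 w - \sum_(j < K) D j w| < 1 ->
  \sum_(j < K) (N (tt j.+1) w - N (tt j) w - D j w) ^+ 2 < 3^-1 ->
  `|\sum_(j < K) (N (tt j.+1) w - N (tt j) w) ^+ 2 - Q t w| < 1 ->
  `|\sum_(j < K) D j w ^+ 2 - dlt * \sum_(j < K) \sum_l (g (tt j) * S j l w) ^+ 2| < 1 ->
  m < late_energy B t K s0 i w ->
  expR (\sum_(j < K) D j w / 2 - (\sum_(j < K) (D j w / 2) ^+ 2) / 2) < expR (a / 16 - lam / 2) ->
  N t w - 1 / 2 * Q t w < 3 - lam.
Proof.
move=> gc c0 am h0 h1 h2 h3 h4 h5; rewrite ltr_expR => h6.
have dlt0 : 0 < dlt by rewrite divr_gt0// ltr0n.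
set D1 := \sum_(j < K) D j w in h1; set D2 := \sum_(j < K) D j w ^+ 2 in h4.
have e1 : \sum_(j < K) D j w / 2 = D1 / 2 by rewrite mulr_suml.
have e2 : \sum_(j < K) (D j w / 2) ^+ 2 = D2 / 4.
  by rewrite mulr_suml; apply: eq_bigr => j _; field.
rewrite e1 e2 in h6.
set E := \sum_(j < K) (_ - _ - _) ^+ 2 in h2.
set V := \sum_(j < K) (_ - _) ^+ 2 in h3.
have VD : 3 / 4 * D2 - 3 * E <= V.
  (* [(D + r) ^ 2 >= (3 / 4) D ^ 2 - 3 r ^ 2], the difference being [(D / 2 + 2 r) ^ 2]; half of 3/4
     is the constant 3/8. *)
  rewrite /D2 /E !mulr_sumr -sumrB; apply: ler_sum => j _.
  by have := sqr_ge0 (D j w / 2 + 2 * (N (tt j.+1) w - N (tt j) w - D j w)); nra.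
set X2 := dlt * _ in h4.
(* Keep only coordinate [i] and the times after [s0], where [g ^ 2 >= c]. *)
have XL : c * late_energy B t K s0 i w <= X2.
  rewrite /late_energy mulrCA ler_wpM2l ?(ltW dlt0)// mulr_sumr; apply: ler_sum => j _.
  rewrite (bigD1 i)//= -[leLHS]addr0 lerD//; last by apply: sumr_ge0 => l _; exact: sqr_ge0.
  case: (leP s0 (tt j)) => hj; last by rewrite mul0r mulr0 sqr_ge0.
  rewrite mul1r exprMn ler_wpM2r ?sqr_ge0// gc// hj/=.
  by rewrite (le_lt_trans (grid_le t0 K0 (ltnW (ltn_ord j)))).
have cm : c * m <= c * late_energy B t K s0 i w by rewrite ler_wpM2l// ltW.
move: h0 h1 h3 h4; rewrite !ltr_norml => /andP[_ h0] /andP[_ h1] /andP[_ h3] /andP[h4 _].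
by move: h0 h1 h2 h3 h4 h6 VD XL cm am; lra.
Qed.

End exponent.

Section exponent_in_probability.
Context {R : realType} {d : measure_display} {T : measurableType d}.
Variables (P : probability T R) (n : nat) (B z : R -> T -> 'rV[R]_n).
Hypothesis bm : brownian_motion P B.
Hypothesis bb : brownian_bridge P B z.
Variables (g : R -> R) (H : R -> T -> 'rV[R]_n) (N Q : R -> T -> R).
Hypothesis cg : {within `[0, 1[, continuous g}.
Hypothesis HE : forall s w i, 0 <= s < 1 -> H s w ord0 i = g s * scaled_bridge z s i w.
Hypothesis N_ito : ito_integral P B H N.
Hypothesis Q_qv : quadratic_variation P N Q.
Variables (c s0 : R) (i : 'I_n).
Hypotheses (c0 : 0 < c) (s01 : s0 < 1).
Hypothesis gc : forall s, s0 <= s < 1 -> c <= g s ^+ 2.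

(** The order of choices is what makes this work: [a], [M] and [t] depend on [e], [lam], [c] and
    [s0] only; then come the bound [C] and the modulus of [g] on [[0, t]]; the number of cells is
    chosen last, large enough for all errors at once. *)
Lemma exponent_cvg_in_probability (lam e : R) : 0 < e -> exists2 t, 0 < t < 1 &
  (P [set w | (3 - lam <= N t w - 1 / 2 * Q t w)%R] <= (6 * e)%:E)%E.
Proof.
move=> e0.
have sum6 : 0 + e + e + e + e + e + e <= 6 * e by lra.
have e9 : 9 * (e / 27) <= 1 ^+ 2 * e by lra.
have e27 : 9 * (e / 27) <= 3^-1 * e by lra.
have halves (x y v : R) : x <= v / 2 -> y <= v / 2 -> x + y <= v by lra.
(* Solves [expR (lam / 2 - a / 16) = e], the bound of [grid_exponential_bound]. *)
pose a := 8 * lam - 16 * ln e.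
have ae : expR (lam / 2 - a / 16) = e.
  by rewrite (_ : _ - _ = ln e) ?lnK ?posrE// /a; field.
pose s1 := (1 - s0)^-1.
have s10 : 0 < s1 by rewrite invr_gt0 subr_gt0.
(* The three summands secure in turn [M1], [Me] and [aM]. *)
pose M := 1 + 4 * (24 + 8 * s1) / e + 2 * (`|a + 1| / c).
have q1 : 0 <= 4 * (24 + 8 * s1) / e by rewrite divr_ge0 ?(ltW e0)//; move: s10; lra.
have q2 : 0 <= `|a + 1| / c by rewrite divr_ge0// ltW.
have M1 : 1 <= M by rewrite /M; move: q1 q2; lra.
have Me : 4 * (24 + 8 * s1) <= e * M.
  rewrite [leRHS]mulrC -ler_pdivrMr// /M; move: q1 q2; lra.
have aM : a + 1 <= c * (M / 2).
  apply: (le_trans (ler_norm _)); rewrite [leRHS]mulrC -ler_pdivrMr// /M; move: q1 q2; lra.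
pose u := 4 * (M + 1 / 2 + s1).
have u0 : 0 < u by rewrite /u; move: M1 s10; lra.
(* Makes [- ln (1 - t) / 4] equal to the energy level required by [late_energy_small]. *)
pose t := 1 - expR (- u).
have t0 : 0 < t by rewrite /t subr_gt0 expR_lt1 oppr_lt0.
have t1 : t < 1 by rewrite /t ltrBlDr ltrDl expR_gt0.
have Mt : M + 1 / 2 + s1 <= - ln (1 - t) / 4.
  by rewrite /t subKr expRK /u opprK; lra.
have t10 : 0 < 1 - t by rewrite subr_gt0.
exists t; first by rewrite t0.
have sub : `[0, t] `<=` `[0, 1[%classic.
  by move=> x /=; rewrite !in_itv/= => /andP[-> xt]; rewrite (le_lt_trans xt).
have cgt := continuous_subspaceW sub cg.
have [C C0 gC] : exists2 C, 0 <= C & forall s, 0 <= s <= t -> `|g s| <= C.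
  have [x xt hx] := EVT_max (ltW t0) (within_continuous_sqr cgt).
  exists (1 + g x ^+ 2) => [|s st]; first by rewrite addr_ge0// sqr_ge0.
  have := hx s; rewrite in_itv/= => /(_ st).
  rewrite -[g s ^+ 2]real_normK ?num_real//; have := normr_ge0 (g s).
  by set y := `|g s|; set v := g x ^+ 2; nra.
(* [ito_cells_error] bounds a mean by [9 eta = e / 3], which Markov's inequality compares with the
   threshold 1/3. *)
pose eta := e / 27; have eta0 : 0 < eta by rewrite divr_gt0.
(* Square of the allowed oscillation of [g] over one cell: its share of the integrand error is then
   at most [eta / 2], and the mesh takes care of the other half. *)
pose om2 := eta * (1 - t) / (4 * n.+1%:R).
have om20 : 0 < om2 by rewrite divr_gt0 ?mulr_gt0.
have om0 : 0 < Num.sqrt om2 by rewrite sqrtr_gt0.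
have [r r0 gr] := segment_uniform_continuity cgt om0.
pose D k := grid_partition t k.+1.
have Dp k : itv_partition 0 t (D k) by exact: grid_partitionP.
have Dm : (fun k => mesh (D k)) @ \oo --> (0 : R).
  rewrite (_ : (fun k => _) = fun k => t / k.+1%:R); first exact: grid_step_cvg0.
  by apply/funext => k; exact: mesh_grid_partition.
have t01 : 0 <= t < 1 by rewrite t1 ltW.
have F1 := cvg_ereal_small e0 (qv_limit Q_qv t01 Dp Dm ltr01).
have F2 := near_grid_step t 1 r0.
have F3 := near_grid_step t 1 t10.
have F4 := near_grid_step t (n%:R * (18 * C ^+ 2 / (1 - t) ^+ 4)) (divr_gt0 eta0 (ltr0Sn _ 1)).
have F5 := near_grid_step t (24 * n%:R ^+ 4 * C ^+ 4 / (1 - t) ^+ 2) e0.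
have [k [f1 [f2 [f3 [f4 f5]]]]] := filter_ex (filterI F1 (filterI F2 (filterI F3 (filterI F4 F5)))).
rewrite mul1r in f2; rewrite mul1r in f3.
have K0 : (0 < k.+1)%N by [].
pose K := k.+1; rewrite -/K in K0 f1 f2 f3 f4 f5.
have approx j s : (j < K)%N -> grid t K j < s <= grid t K j.+1 ->
    (\int[P]_w (sqnormv (H s w - grid_integrand B g t K j w))%:E <= eta%:E)%E.
  move=> jK sj; have /andP[js sj'] := sj.
  have g0 := grid_ge0 t0 K0 j; have gt := grid_le t0 K0 jK.
  have st : 0 <= s <= t by rewrite (le_trans g0 (ltW js)) (le_trans sj').
  have gjt : 0 <= grid t K j <= t by rewrite g0 (le_trans (ltW js))//; case/andP: st.
  have gsj : `|g s - g (grid t K j)| <= Num.sqrt om2.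
    apply: gr => //; rewrite ger0_norm ?subr_ge0 ?(ltW js)//.
    by apply: le_lt_trans f2; rewrite -(grid_step t K0 j) lerB.
  apply: (le_trans (grid_integrand_error bm bb HE t0 t1 K0 jK sj (gC s st) gsj)).
  rewrite lee_fin sqr_sqrtr ?(ltW om20)// mulrDr.
  have : n%:R * (2 * om2 / (1 - t)) <= eta / 2.
    rewrite /om2 (_ : _ * _ = (eta / 2) * (n%:R / n.+1%:R)).
      have h : n%:R / n.+1%:R <= 1 :> R by rewrite ler_pdivrMr// mul1r ler_nat.
      by apply: ler_piMr h; rewrite divr_ge0// ltW.
    have fieldE (x y m v : R) : x != 0 -> y != 0 -> m * (2 * (v * y / (4 * x)) / y) = v / 2 * (m / x).
      by move=> x0 y0; field; rewrite x0 y0.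
    by apply: fieldE; rewrite ?gt_eqF.
  have : n%:R * (18 * C ^+ 2 * (t / K%:R) / (1 - t) ^+ 4) <= eta / 2.
    by rewrite (_ : _ * _ = n%:R * (18 * C ^+ 2 / (1 - t) ^+ 4) * (t / K%:R)); [exact: ltW|ring].
  exact: halves.
have mNs s : 0 <= s -> s <= t -> measurable_fun setT (N s).
  by move=> s0' st; apply: (N_measurable bm N_ito); rewrite s0' (le_lt_trans st).
have mNt := mNs t (ltW t0) (lexx t); have mN0 := mNs 0 (lexx 0) (ltW t0).
have mQ : measurable_fun setT (Q t) by exact: (qv_measurable Q_qv).
have mS j l : (j <= K)%N -> measurable_fun setT (grid_walk B t K j l).
  by move=> jK; exact: (grid_walk_measurable bm).
pose Dr j := grid_drift B g t K j.
have mD j : (j < K)%N -> measurable_fun setT (Dr j) := @grid_drift_measurable _ _ _ _ _ _ bm g _ _ t0 t1 K0 j.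
have mdN j : (j < K)%N -> measurable_fun setT (fun w => N (grid t K j.+1) w - N (grid t K j) w).
  move=> jK; apply: measurable_funB; apply: mNs; rewrite ?grid_ge0//; first exact: grid_le.
  by apply: grid_le => //; exact: ltnW.
(* The bad events: [b0] is null and each of the other six has probability at most [e]. Off their
   union [exponent_le] applies. *)
pose b0 := [set w | 1 <= `|N 0 w|].
pose b1 := [set w | 1 <= `|N t w - N 0 w - \sum_(j < K) Dr j w|].
pose b2 := [set w | 3^-1 <= \sum_(j < K) (N (grid t K j.+1) w - N (grid t K j) w - Dr j w) ^+ 2].
pose b3 := [set w | 1 <= `|\sum_(j < K) (N (grid t K j.+1) w - N (grid t K j) w) ^+ 2 - Q t w|].
pose b4 := [set w | 1 <= `|\sum_(j < K) Dr j w ^+ 2 - t / K%:R * \sum_(j < K) \sum_l (g (grid t K j) * grid_walk B t K j l w) ^+ 2|].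
pose b5 := [set w | late_energy B t K s0 i w <= M / 2].
pose b6 := [set w | expR (a / 16 - lam / 2) <= expR (\sum_(j < K) Dr j w / 2 - (\sum_(j < K) (Dr j w / 2) ^+ 2) / 2)].
have m0 : measurable b0 by apply: measurable_superlevel; exact: measurableT_comp.
have mf1 : measurable_fun setT (fun w => N t w - N 0 w - \sum_(j < K) Dr j w).
  apply: measurable_funB; first exact: measurable_funB.
  by apply: measurable_sum => j; exact: mD.
have m1 : measurable b1 by apply: measurable_superlevel; exact: measurableT_comp.
have mf2 : measurable_fun setT (fun w => \sum_(j < K) (N (grid t K j.+1) w - N (grid t K j) w - Dr j w) ^+ 2).
  apply: measurable_sum => j; apply: measurable_funX; apply: measurable_funB; [exact: mdN|exact: mD].
have m2 : measurable b2 by exact: measurable_superlevel.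
have m3 : measurable b3.
  apply: measurable_superlevel; apply: measurableT_comp => //; apply: measurable_funB => //.
  by apply: measurable_sum => j; apply: measurable_funX; exact: mdN.
have mf4 : measurable_fun setT (fun w => \sum_(j < K) Dr j w ^+ 2 - t / K%:R * \sum_(j < K) \sum_l (g (grid t K j) * grid_walk B t K j l w) ^+ 2).
  apply: measurable_funB; first by apply: measurable_sum => j; apply: measurable_funX; exact: mD.
  apply: measurable_funM => //; apply: measurable_sum => j; apply: measurable_sum => l.
  by apply: measurable_funX; apply: measurable_funM => //; apply: mS; exact: ltnW.
have m4 : measurable b4 by apply: measurable_superlevel; exact: measurableT_comp.
have m5 : measurable b5.
  rewrite (_ : b5 = [set w | - (M / 2) <= - late_energy B t K s0 i w]).
    by apply: measurable_superlevel; apply: measurableT_comp => //; exact: (late_energy_measurable bm).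
  by apply/seteqP; split => w /=; rewrite lerN2.
have m6 : measurable b6.
  apply: measurable_superlevel; apply: measurableT_comp => //; apply: measurable_funB.
    by apply: measurable_sum => j; apply: measurable_funM => //; exact: mD.
  apply: measurable_funM => //; apply: measurable_sum => j; apply: measurable_funX.
  by apply: measurable_funM => //; exact: mD.
have p0 : (P b0 <= 0%:E)%E by exact: (ito_integral_start0 bm N_ito).
have p1 : (P b1 <= e%:E)%E.
  apply: chebyshev_le => //; apply: (le_trans (ito_grid_error bm bb cg HE N_ito t0 t1 K0 (ltW eta0) approx)).
  by rewrite lee_fin.
have p2 : (P b2 <= e%:E)%E.
  apply: markov_le => //; first by move=> w; apply: sumr_ge0 => j _; exact: sqr_ge0.
  apply: (le_trans (ito_cells_error bm bb cg HE N_ito t0 t1 K0 (ltW eta0) approx)).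
  by rewrite lee_fin.
have p3 : (P b3 <= e%:E)%E.
  apply: le_trans (ltW f1); rewrite le_eqVlt; apply/orP; left; apply/eqP; congr (P _).
  rewrite /b3; congr mkset; apply/funext => w; congr (1 <= `|_ - _|).
  rewrite /D size_mkseq; apply: eq_bigr => j _.
  by rewrite !part_pt_grid// ltnW.
have p4 : (P b4 <= e%:E)%E.
  have aS j l : (j < K)%N -> all_moments P (grid_walk B t K j l).
    by move=> /ltnW; exact: grid_walk_all_moments.
  have a4 : all_moments P (fun w => \sum_(j < K) Dr j w ^+ 2 - t / K%:R * \sum_(j < K) \sum_l (g (grid t K j) * grid_walk B t K j l w) ^+ 2).
    apply: all_momentsB.
      apply: all_moments_sum => j _; apply: (all_momentsX 2); apply: all_moments_sum => l _.
      by apply: all_momentsM; [apply: all_momentsZ; exact: aS|exact: grid_incr_all_moments].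
    apply: all_momentsZ; apply: all_moments_sum => j _; apply: all_moments_sum => l _.
    by apply: (all_momentsX 2); apply: all_momentsZ; exact: aS.
  apply: chebyshev_le => //; rewrite integral_mean; last exact: (all_momentsX 2 a4).
  rewrite expr1n mul1r lee_fin; apply: le_trans (ltW f5).
  apply: (drift_square_error bm t0 t1 K0 (G := fun j => g (grid t K j))) => j jK.
  by apply: gC; rewrite grid_ge0// grid_le// ltnW.
have p5 : (P b5 <= e%:E)%E.
  exact: (late_energy_small bm t0 t1 K0 s01 i (ltW f3) e0 M1 Me Mt).
have p6 : (P b6 <= e%:E)%E.
  by have := @grid_exponential_bound _ _ _ _ _ _ bm g t K t0 t1 K0 a lam; rewrite ae.
have m01 := measurableU _ _ m0 m1; have p01 := probabilityU_le m0 m1 p0 p1.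
have m02 := measurableU _ _ m01 m2; have p02 := probabilityU_le m01 m2 p01 p2.
have m03 := measurableU _ _ m02 m3; have p03 := probabilityU_le m02 m3 p02 p3.
have m04 := measurableU _ _ m03 m4; have p04 := probabilityU_le m03 m4 p03 p4.
have m05 := measurableU _ _ m04 m5; have p05 := probabilityU_le m04 m5 p04 p5.
have m06 := measurableU _ _ m05 m6; have p06 := probabilityU_le m05 m6 p05 p6.
apply: le_trans (le_trans p06 _); last by rewrite lee_fin.
apply: le_measure; rewrite ?inE//.
  apply: measurable_superlevel; apply: measurable_funB => //.
  exact: measurable_funM.
move=> w /= hw; apply: contrapT => nb.
have lt (x y : R) : ~ (x <= y) -> y < x by move=> /negP; rewrite ltNge.
have n0 : ~ b0 w by move=> h; apply: nb; do 6 left.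
have n1 : ~ b1 w by move=> h; apply: nb; do 5 left; right.
have n2 : ~ b2 w by move=> h; apply: nb; do 4 left; right.
have n3 : ~ b3 w by move=> h; apply: nb; do 3 left; right.
have n4 : ~ b4 w by move=> h; apply: nb; do 2 left; right.
have n5 : ~ b5 w by move=> h; apply: nb; left; right.
have n6 : ~ b6 w by move=> h; apply: nb; right.
have := exponent_le t0 t1 K0 gc (ltW c0) aM (lt _ _ n0) (lt _ _ n1) (lt _ _ n2) (lt _ _ n3) (lt _ _ n4) (lt _ _ n5) (lt _ _ n6).
by rewrite ltNge hw.
Qed.

End exponent_in_probability.

(** * A positive martingale that tends to 0 in probability has no closing variable *)

Section not_extendable.
Context {R : realType} {d : measure_display} {T : measurableType d}.
Variables (P : probability T R) (n : nat) (B : R -> T -> 'rV[R]_n).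
Hypothesis bm : brownian_motion P B.
Variable M : R -> T -> R.
Hypothesis M_gt0 : forall t w, 0 <= t < 1 -> 0 < M t w.

(** On the event where [M t] is at least [e], its integral equals that of [M1], hence is below
    [m / 2] by absolute continuity of the integral of [M1]; elsewhere it is at most [e <= m / 4].
    The total would have to be the mean [m > 0] of [M 0]. *)
Lemma not_extendable_of_small :
  (forall e, 0 < e -> exists2 t, 0 < t < 1 & (P [set w | (e <= M t w)%R] <= e%:E)%E) ->
  ~ extendable_to_martingale P B M.
Proof.
move=> small [M1 [mM1 iM1 mart]].
have i01 : `[0, 1]%classic (0 : R) by rewrite /= in_itv/= lexx ler01.
have i11 : `[0, 1]%classic (1 : R) by rewrite /= in_itv/= ler01 lexx.
have iM t : 0 <= t < 1 -> P.-integrable setT (EFin \o M t).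
  move=> /andP[t0 t1]; have := mart_integrable mart (t := t).
  by rewrite t1; apply; rewrite /= in_itv/= t0 ltW.
have mM t : 0 <= t < 1 -> measurable_fun setT (EFin \o M t).
  by move=> /iM/measurable_int.
have ST t : filtration P B t setT by exact: (@measurableT _ (g_sigma_algebraType (filtration_gen P B t))).
have t00 : 0 <= (0 : R) < 1 by rewrite lexx ltr01.
pose m := fine (\int[P]_w (M 0 w)%:E)%E.
have mE : (\int[P]_w (M 0 w)%:E = m%:E)%E.
  by rewrite fineK//; apply: integrable_fin_num => //; exact: iM.
have m0 : 0 < m.
  have : 0 <= m by rewrite -lee_fin -mE; apply: integral_ge0 => w _; rewrite lee_fin ltW// M_gt0.
  rewrite le_eqVlt => /predU1P[me|//].
  have : (\int[P]_w `|(M 0 w)%:E| = 0)%E.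
    transitivity (\int[P]_w (M 0 w)%:E)%E; last by rewrite mE -me.
    apply: eq_integral => w _.
    by rewrite gee0_abs// lee_fin ltW// M_gt0.
  move/(ae_eq_integral_abs _ measurableT (mM 0 t00)) => [A [mA A0 sub]].
  have AT : A = setT.
    apply/seteqP; split => // w _; apply: sub => /= h.
    by have := h I => -[]; apply/eqP; rewrite gt_eqF// M_gt0.
  by have := probability_setT P; rewrite -AT A0 => /eqP; rewrite eq_sym onee_eq0.
have m20 : 0 < m / 2 by rewrite divr_gt0.
have [r [r0 hr]] := integral_normr_continuous iM1 m20.
(* [m / 4] controls the part where [M t] is small; [r / 2 < r] makes the event small enough for the
   absolute continuity of the integral of [M1]. *)
pose e := Num.min (m / 4) (r / 2).
have e0 : 0 < e by rewrite /e lt_min !divr_gt0.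
have em : e <= m / 4 by rewrite /e ge_min lexx.
have er : e < r.
  by apply: (@le_lt_trans _ _ (r / 2)); [rewrite /e ge_min lexx orbT|rewrite gtr_pMr// invf_lt1// ltr1n].
have [t t01 Pt] := small e e0; have /andP[t0 t1] := t01.
have t01' : 0 <= t < 1 by rewrite t1 ltW.
have it1 : `[0, 1]%classic t by rewrite /= in_itv/= !ltW.
pose A := [set w | e <= M t w].
have FA : filtration P B t A.
  have := mart_adapted mart it1; rewrite t1 => /(_ measurableT _ (measurable_itv `[e, +oo[)).
  rewrite setTI; congr (<<s _ >> _); apply/seteqP; split => w /=; by rewrite in_itv/= andbT.
have mA : measurable A by apply: (filtration_measurable bm (ltW t1)).
have mM1' : measurable_fun setT (EFin \o M1) by exact: measurable_int iM1.
have PAr : (P A < r%:E)%E by apply: (le_lt_trans Pt); rewrite lte_fin.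
have small_closing : (\int[P]_(w in A) (M1 w)%:E < (m / 2)%:E)%E.
  have iA : P.-integrable A (EFin \o M1) by apply: integrableS iM1.
  apply: (@le_lt_trans _ _ (\int[P]_(w in A) `|(M1 w)%:E|)%E).
    apply: (le_trans (lee_abs _)); apply: le_abse_integral => //.
    exact: measurable_int iA.
  have fin : (\int[P]_(w in A) `|(M1 w)%:E|)%E \is a fin_num.
    by apply: integrable_fin_num => //; exact: integrable_abse.
  by rewrite -(fineK fin) lte_fin; exact: hr.
have half1 : (\int[P]_(w in A) (M t w)%:E < (m / 2)%:E)%E.
  have := mart_condexp mart it1 i11 (ltW t1) FA; rewrite ltxx t1 => <-.
  exact: small_closing.
have half2 : (\int[P]_(w in ~` A) (M t w)%:E <= (m / 4)%:E)%E.
  apply: (@le_trans _ _ (\int[P]_(w in ~` A) (cst e%:E w))%E).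
    apply: ge0_le_integral => //; first exact: measurableC.
    - by move=> w _; rewrite lee_fin ltW// M_gt0.
    - by apply: measurable_funTS; exact: mM.
    - by move=> w /= /negP; rewrite -ltNge lee_fin => /ltW.
  rewrite integral_cst//; last exact: measurableC.
  apply: (@le_trans _ _ (e%:E * 1)%E); last by rewrite mule1 lee_fin.
  by rewrite lee_wpmul2l ?lee_fin ?(ltW e0)//; apply: probability_le1; exact: measurableC.
have total : (\int[P]_w (M t w)%:E = m%:E)%E.
  by have := mart_condexp mart i01 it1 (ltW t0) (ST 0); rewrite t1 ltr01 mE.
have : (\int[P]_w (M t w)%:E = \int[P]_(w in A) (M t w)%:E + \int[P]_(w in ~` A) (M t w)%:E)%E.
  rewrite -[in LHS](setUv A) ge0_integral_setU//.
  - exact: measurableC.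
  - by rewrite setUv; exact: mM.
  - by move=> w _; rewrite lee_fin ltW// M_gt0.
  - by apply/disj_setPCl.
rewrite total; move: half1 half2.
case: (\int[P]_(w in A) _)%E => [x||]//; case: (\int[P]_(w in ~` A) _)%E => [y||]//.
by rewrite lte_fin lee_fin -EFinD => h1 h2 [h3]; move: h1 h2 h3 m0; lra.
Qed.

End not_extendable.

(* [g = 1 - (1 - t) f] is the factor by which the integrand of [N] differs
   from [z / (1 - t)]. *)
Lemma drift_factor (R : realType) (f : R -> R) :
  (exists2 alpha : R, 1 < alpha & forall t : R, 0 <= t < 1 -> f t = 1 / (1 - t) `^ alpha) \/
  (exists c : R, [/\ 0 < c, c != 1 & forall t : R, 0 <= t < 1 -> f t = c / (1 - t)]) ->
  exists g : R -> R, [/\ {within `[0, 1[, continuous g},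
    forall t, 0 <= t < 1 -> 1 - (1 - t) * f t = g t &
    exists c s0 : R, [/\ 0 < c, s0 < 1 & forall s, s0 <= s < 1 -> c <= g s ^+ 2]].
Proof.
case=> [[al al1 fE]|[c [c0 c1 fE]]].
  (* This is [1 - (1 - t) ^ (1 - alpha)], written with [expR] and [ln] so that continuity is
     immediate. *)
  exists (fun t => 1 - expR ((1 - al) * ln (1 - t))); split.
  - apply/subspace_continuousP => s; rewrite /= in_itv/= => /andP[_ s1].
    apply: cvg_within_filter; apply: cvgB; first exact: cvg_cst.
    apply: continuous_cvg; first exact: continuous_expR.
    apply: cvgMr; apply: continuous_cvg; first by apply: continuous_ln; rewrite subr_gt0.
    by apply: cvgB; [exact: cvg_cst|exact: cvg_id].
  - move=> t t01; have /andP[_ t1] := t01; have t10 : 0 < 1 - t by rewrite subr_gt0.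
    rewrite fE// /powR gt_eqF// div1r -expRN -{1}(lnK (x := 1 - t)) ?posrE// -expRD.
    by congr (_ - expR _); ring.
  - pose s0 : R := 1 - expR (- (al - 1)^-1).
    have al0 : 0 < al - 1 by rewrite subr_gt0.
    exists 1, s0; split => //; first by rewrite /s0 ltrBlDr ltrDl expR_gt0.
    move=> s /andP[s0s s1]; have s10 : 0 < 1 - s by rewrite subr_gt0.
    have l : ln (1 - s) <= - (al - 1)^-1.
      rewrite -[leRHS]expRK ler_ln ?posrE ?expR_gt0//.
      by move: s0s; rewrite /s0; lra.
    have : 1 <= (1 - al) * ln (1 - s).
      have : (al - 1) * (al - 1)^-1 <= (al - 1) * - ln (1 - s).
        by rewrite ler_wpM2l ?(ltW al0)// lerNr.
      by rewrite mulfV ?gt_eqF//; lra.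
    set x := (1 - al) * _ => x1.
    have := @expR_ge1Dx R x; set y := expR x => xy.
    have : 1 <= y - 1 by move: xy x1; lra.
    by move=> h; rewrite -sqrrN opprB expr2; nra.
exists (cst (1 - c)); split.
- by move=> s; exact: cvg_cst.
- move=> t t01; have /andP[_ t1] := t01; have t10 : 0 < 1 - t by rewrite subr_gt0.
  by rewrite fE//= mulrCA divff ?gt_eqF// mulr1.
- exists ((1 - c) ^+ 2), 0; split => //.
  by rewrite exprn_even_gt0//= subr_eq0 eq_sym.
Qed.

Theorem mainTheorem4 (R : realType) (d : measure_display)
    (T : measurableType d) (P : probability T R) (n : nat)
    (B z : R -> T -> 'rV[R]_n) (f : R -> R) (N Q M : R -> T -> R)
    (n_ge1 : (1 <= n)%N)
    (B_bm : brownian_motion P B)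
    (z_bridge : brownian_bridge P B z)
    (f_def : (exists2 alpha : R, 1 < alpha &
               forall t : R, 0 <= t < 1 -> f t = 1 / (1 - t) `^ alpha) \/
             (exists c : R, [/\ 0 < c, c != 1 &
               forall t : R, 0 <= t < 1 -> f t = c / (1 - t)]))
    (N_def : ito_integral P B (fun s w => (1 / (1 - s) - f s) *: z s w) N)
    (Q_def : quadratic_variation P N Q)
    (M_def : forall (t : R) (w : T), 0 <= t < 1 -> M t w = expR (N t w - 1 / 2 * Q t w)) :
  ~ extendable_to_martingale P B M.
Proof.
have [g [cg gE [c [s0 [c0 s01 gc]]]]] := drift_factor f_def.
have HE s w i : 0 <= s < 1 ->
    ((1 / (1 - s) - f s) *: z s w) ord0 i = g s * scaled_bridge z s i w.
  move=> s1; rewrite mxE -gE// /scaled_bridge; have /andP[_ s1'] := s1.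
  by field; rewrite gt_eqF// subr_gt0.
apply: (not_extendable_of_small B_bm) => [t w t01|e e0]; first by rewrite M_def// expR_gt0.
have e60 : 0 < e / 6 by rewrite divr_gt0.
(* [n >= 1] provides the one coordinate whose energy is used, the first. The level [lam = 3 - ln e]
   turns [3 - lam] into [ln e], and [e / 6] absorbs the factor 6. *)
have [t t01 Pt] := exponent_cvg_in_probability B_bm z_bridge cg HE N_def Q_def
  (Ordinal n_ge1) c0 s01 gc (3 - ln e) e60.
exists t => //; have /andP[t0 t1] := t01.
rewrite (_ : 6 * (e / 6) = e) in Pt; last by field.
apply: le_trans Pt; rewrite le_eqVlt; apply/orP; left; apply/eqP; congr (P _).
have leE x : (e <= expR x) = (ln e <= x).
  by rewrite -[X in _ = (_ <= X)]expRK ler_ln ?posrE ?expR_gt0.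
by apply/seteqP; split => w /=; rewrite M_def ?(ltW t0)// leE subKr.
Qed.
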